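(* Let $\mathbb{G}$ be a coamenable locally compact quantum group and let $\omega\in \mathrm{M}(\mathbb{G})$ be a contractive idempotent functional. Suppose that $|\omega|_r$ is a Haar idempotent, and let $(\mathbb{H},\pi)$ be the associated compact quantum subgroup of $\mathbb{G}$ (so that $\pi:\mathrm{C}_0(\mathbb{G})\to \mathrm{C}(\mathbb{H})$ is the corresponding surjective morphism and $|\omega|_r=h_{\mathbb{H}}\circ\pi$, where $h_{\mathbb{H}}$ is the Haar state of $\mathbb{H}$). Then there exists a group-like unitary $u\in \mathrm{C}(\mathbb{H})$ such that \[ \omega(a)=h_{\mathbb{H}}(\pi(a)u)\qquad\text{for all } a\in \mathrm{C}_0(\mathbb{G}). \] Moreover, $|\omega|_r=|\omega|_l$.
   Context: Locally compact quantum groups are in the $C^*$-algebraic sense of Kustermans and Vaes: $\mathbb{G}$ is given by a $C^*$-algebra $\mathrm{C}_0(\mathbb{G})$ with a coassociative nondegenerate $^*$-homomorphism $\Delta:\mathrm{C}_0(\mathbb{G})\to M(\mathrm{C}_0(\mathbb{G})\otimes \mathrm{C}_0(\mathbb{G}))$ (comultiplication) satisfying the cancellation laws $\overline{\mathrm{span}}\,\Delta(\mathrm{C}_0(\mathbb{G}))(\mathrm{C}_0(\mathbb{G})\otimes 1)=\mathrm{C}_0(\mathbb{G})\otimes \mathrm{C}_0(\mathbb{G})=\overline{\mathrm{span}}\,\Delta(\mathrm{C}_0(\mathbb{G}))(1\otimes \mathrm{C}_0(\mathbb{G}))$, and admitting faithful KMS left and right invariant Haar weights. $\mathbb{G}$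 is coamenable if $\mathrm{C}_0(\mathbb{G})$ admits a bounded counit; all locally compact quantum groups considered are assumed coamenable. If $\mathrm{C}_0(\mathbb{G})$ is unital, $\mathbb{G}$ is compact, one writes $\mathrm{C}(\mathbb{G})$, and there is a unique left and right invariant (faithful) Haar state. A unitary $u\in \mathrm{C}(\mathbb{H})$, $\mathbb{H}$ compact, is group-like if $\Delta_{\mathbb{H}}(u)=u\otimes u$. A compact quantum group $\mathbb{H}$ is a (closed) compact quantum subgroup of $\mathbb{G}$ if there is a surjective $^*$-homomorphism $\pi:\mathrm{C}_0(\mathbb{G})\to \mathrm{C}(\mathbb{H})$ intertwining the coproducts; one writes $(\mathbb{H},\pi)$. $\mathrm{M}(\mathbb{G})=\mathrm{C}_0(\mathbb{G})^*$ with product $\omega\star\mu=(\omega\otimes\mu)\circ\Delta$. An idempotent functional is a nonzero $\omega\in \mathrm{M}(\mathbb{G})$ with $\omega\star\omega=\omega$; it is contractive if $\|\omega\|\le1$. An idempotent state $\sigma$ (idempotent functional that is a state) is a Haar idempotent if there is a compact quantum subgroup $(\mathbb{H},\pi)$ of $\mathbb{G}$ with $\sigma=h_{\mathbb{H}}\circ\pi$. For a $C^*$-algebra $A$, $\omega\in A^*$, $x,y\in A^{**}$: $\omega.x(y)=\omega(xy)$ and $x.\omega(y)=\omega(yx)$. The polar decomposition of $\omega$ is the unique $\omega=w.|\omega|_r$ with $|\omega|_r\in A^*$ positive (right absolute value) and $w\in A^{**}$ a partial isometry such that $w^*w$ is the support projection of $|\omega|_r$. The left absolute value is $|\omega|_l=w.|\omega|_r.w^*$.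 *)

(* Defs.v *)
From HB Require Import structures.
From mathcomp Require Import all_boot all_order all_algebra complex.
From mathcomp Require Import all_classical all_reals.
From mathcomp Require Import ereal topology normedtype derive.

Set Implicit Arguments.
Unset Strict Implicit.
Unset Printing Implicit Defensive.

Import Order.TTheory GRing.Theory Num.Theory.
Import numFieldNormedType.Exports.

Local Open Scope classical_set_scope.
Local Open Scope ring_scope.
Local Open Scope complex_scope.

(* Not necessarily unital.  As everywhere for normed modules over [R[i]], the
   norm takes its values in [R[i]], where [0 <= z] means that [z] is a
   nonnegative real number. *)
HB.mixin Record isCStarAlgebra (R : realType) A of CompleteNormedModule R[i] A
  := {
  cmul : A -> A -> A;
  star : A -> A;
  cmulA : associative cmul;
  cmulPl : forall (k : R[i]) (x y z : A),
    cmul (k *: x + y) z = k *: cmul x z + cmul y z;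
  cmulPr : forall (k : R[i]) (x y z : A),
    cmul x (k *: y + z) = k *: cmul x y + cmul x z;
  cnormM : forall x y : A, `|cmul x y| <= `|x| * `|y|;
  starP : forall (k : R[i]) (x y : A),
    star (k *: x + y) = k^* *: star x + star y;
  starK : involutive star;
  starM : forall x y : A, star (cmul x y) = cmul (star y) (star x);
  cstar_identity : forall x : A, `|cmul (star x) x| = `|x| ^+ 2
}.

#[short(type="cstarAlgType")]
HB.structure Definition CStarAlgebra (R : realType) :=
  {A of CompleteNormedModule R[i] A & isCStarAlgebra R A}.

Infix "**" := cmul (at level 40, left associativity) : ring_scope.

Definition is_unit (R : realType) (A : cstarAlgType R) (e : A) :=
  forall a : A, e ** a = a /\ a ** e = a.

Definition unital (R : realType) (A : cstarAlgType R) := exists e : A, is_unit e.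

Definition unitary (R : realType) (A : cstarAlgType R) (u : A) :=
  is_unit (star u ** u) /\ is_unit (u ** star u).

Definition positive_cone (R : realType) (A : cstarAlgType R) : set A :=
  [set x | exists b : A, x = star b ** b].
Arguments positive_cone {R} A _.

Definition star_hom (R : realType) (A B : cstarAlgType R) (f : A -> B) :=
  [/\ forall (k : R[i]) x y, f (k *: x + y) = k *: f x + f y,
      forall x y, f (x ** y) = f x ** f y
    & forall x, f (star x) = star (f x)].

Definition lspan (R : realType) (V : completeNormedModType R[i]) (S : set V) :
    set V :=
  [set x | exists2 s : seq (R[i] * V),
    (forall p, p \in s -> S p.2) & x = \sum_(p <- s) p.1 *: p.2].

Record dual (R : realType) (A : cstarAlgType R) := Dual {
  dual_fun :> {linear A -> R[i]^o};
  dual_continuous : continuous dual_fun }.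

Definition dual_norm (R : realType) (A : cstarAlgType R) (f : dual A) : R :=
  sup [set complex.Re `|f a| | a in [set a : A | `|a| <= 1]].

Definition positive_functional (R : realType) (A : cstarAlgType R)
    (f : dual A) :=
  forall a : A, 0 <= (f (star a ** a) : R[i]).

Definition state (R : realType) (A : cstarAlgType R) (f : dual A) :=
  positive_functional f /\ dual_norm f = 1.

Lemma dual_boundP (R : realType) (A : cstarAlgType R) (f : dual A) :
  exists2 M : R, 0 <= M & forall a, `|f a| <= M%:C * `|a|.
Proof.
have /linear_boundedP/pinfty_ex_gt0[k k0 Hk] :=
  continuous_linear_bounded 0 (@dual_continuous _ _ f 0).
have kE : k = (complex.Re k)%:C by rewrite RRe_real// gtr0_real.
exists (complex.Re k); last by move=> a; rewrite -kE; exact: Hk.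
by rewrite -lecR -kE ltW.
Qed.

Lemma Re_norm (R : realType) (V : normedModType R[i]) (x : V) :
  (complex.Re `|x|)%:C = `|x|.
Proof. by rewrite RRe_real// normr_real. Qed.

Lemma Re_norm_ge0 (R : realType) (V : normedModType R[i]) (x : V) :
  0 <= complex.Re `|x|.
Proof. by rewrite -lecR Re_norm normr_ge0. Qed.

Lemma dual_norm_has_sup (R : realType) (A : cstarAlgType R) (f : dual A) :
  has_sup [set complex.Re `|f a| | a in [set a : A | `|a| <= 1]].
Proof.
split; first by exists (complex.Re `|f 0|), 0 => //=; rewrite normr0 ler01.
have [M M0 HM] := dual_boundP f.
exists M => _ [a /= a1 <-]; rewrite -lecR (Re_norm (f a)).
by apply: le_trans (HM a) _; rewrite ler_piMr// lecR.
Qed.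

Lemma dual_norm_bound (R : realType) (A : cstarAlgType R) (f : dual A) (a : A) :
  `|f a| <= (dual_norm f)%:C * `|a|.
Proof.
have [->|a0] := eqVneq a 0; first by rewrite linear0 !normr0 mulr0.
have n0 : 0 < `|a| by rewrite normr_gt0.
have -> : `|f a| = `|f (`|a|^-1 *: a)| * `|a|.
  by rewrite linearZ/= normrZ normfV normr_id mulrAC mulVf ?mul1r// normr_eq0.
rewrite ler_wpM2r// -(Re_norm (f (`|a|^-1 *: a))) lecR.
apply: ub_le_sup; first by have [] := dual_norm_has_sup f.
by exists (`|a|^-1 *: a) => //=; rewrite normrZ normfV normr_id mulVf// normr_eq0.
Qed.

Lemma dual_norm_le (R : realType) (A : cstarAlgType R) (f : dual A) (M : R) :
  0 <= M -> (forall a, `|f a| <= M%:C * `|a|) -> dual_norm f <= M.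
Proof.
move=> M0 HM; apply: ge_sup; first by have [] := dual_norm_has_sup f.
move=> _ [a /= a1 <-]; rewrite -lecR (Re_norm (f a)).
by apply: le_trans (HM a) _; rewrite ler_piMr// lecR.
Qed.

Lemma dual_norm_ge0 (R : realType) (A : cstarAlgType R) (f : dual A) :
  0 <= dual_norm f.
Proof.
apply: ub_le_sup; first by have [] := dual_norm_has_sup f.
by exists 0; rewrite ?linear0 ?normr0//=; rewrite normr0 ler01.
Qed.

Lemma dual_of_subproof (R : realType) (A : cstarAlgType R) (f : A -> R[i]^o)
    (fP : linear f) :
  (exists M : R, forall a, `|f a| <= M%:C * `|a|) ->
  continuous (HB.pack f (GRing.isLinear.Build _ _ _ _ _ fP) : {linear A -> R[i]^o}).
Proof.
move=> [M HM]; apply/linear_bounded_continuous/linear_boundedP.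
near=> r => a /=; apply: le_trans (HM a) _; rewrite ler_wpM2r//.
by near: r; apply: nbhs_pinfty_ge; rewrite complex_real.
Unshelve. all: by end_near. Qed.

Definition dual_of (R : realType) (A : cstarAlgType R) (f : A -> R[i]^o)
    (fP : linear f) (fM : exists M : R, forall a, `|f a| <= M%:C * `|a|) :
  dual A := Dual (dual_of_subproof (fP := fP) fM).
Arguments dual_of {R A} f fP fM.

Lemma norm_star (R : realType) (A : cstarAlgType R) (a : A) :
  `|star a| = `|a|.
Proof.
have le_star (b : A) : `|b| <= `|star b|.
  have [->|b0] := eqVneq b 0; first by rewrite normr0.
  have := cnormM (star b) b; rewrite cstar_identity expr2.
  by rewrite ler_pM2r// normr_gt0.
by apply/eqP; rewrite eq_le le_star andbT -[in leRHS](starK a) le_star.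
Qed.

Lemma dual_lactP (R : realType) (A : cstarAlgType R) (a : A) (f : dual A) :
  linear (fun b : A => f (b ** a)).
Proof. by move=> k x y; rewrite cmulPl linearP. Qed.

Lemma dual_lact_bound (R : realType) (A : cstarAlgType R) (a : A) (f : dual A)
  (b : A) : `|f (b ** a)| <= (dual_norm f * complex.Re `|a|)%:C * `|b|.
Proof.
apply: le_trans (dual_norm_bound f _) _; rewrite rmorphM/= Re_norm -mulrA.
rewrite ler_wpM2l ?lecR ?dual_norm_ge0// mulrC; exact: cnormM.
Qed.

(* [a.f : b |-> f (b a)] *)
Definition dual_lact (R : realType) (A : cstarAlgType R) (a : A) (f : dual A) :
    dual A :=
  dual_of (fun b => f (b ** a)) (dual_lactP a f)
    (ex_intro _ _ (dual_lact_bound a f)).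

Lemma dual_ractP (R : realType) (A : cstarAlgType R) (f : dual A) (a : A) :
  linear (fun b : A => f (a ** b)).
Proof. by move=> k x y; rewrite cmulPr linearP. Qed.

Lemma dual_ract_bound (R : realType) (A : cstarAlgType R) (f : dual A) (a : A)
  (b : A) : `|f (a ** b)| <= (dual_norm f * complex.Re `|a|)%:C * `|b|.
Proof.
apply: le_trans (dual_norm_bound f _) _; rewrite rmorphM/= Re_norm -mulrA.
rewrite ler_wpM2l ?lecR ?dual_norm_ge0//; exact: cnormM.
Qed.

(* [f.a : b |-> f (a b)] *)
Definition dual_ract (R : realType) (A : cstarAlgType R) (f : dual A) (a : A) :
    dual A :=
  dual_of (fun b => f (a ** b)) (dual_ractP f a)
    (ex_intro _ _ (dual_ract_bound f a)).

Lemma dual_starP (R : realType) (A : cstarAlgType R) (f : dual A) :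
  linear (fun a : A => (f (star a) : R[i])^* : R[i]^o).
Proof.
by move=> k x y; rewrite starP linearP/= rmorphD/= rmorphM/= conjcK.
Qed.

Lemma dual_star_bound (R : realType) (A : cstarAlgType R) (f : dual A) (a : A) :
  `|(f (star a) : R[i])^* : R[i]^o| <= (dual_norm f)%:C * `|a|.
Proof.
rewrite -[in leRHS]norm_star; apply: le_trans _ (dual_norm_bound f _).
by rewrite (normcJ (f (star a))).
Qed.

Definition dual_star (R : realType) (A : cstarAlgType R) (f : dual A) :
    dual A :=
  dual_of (fun a => (f (star a) : R[i])^*) (dual_starP f)
    (ex_intro _ _ (dual_star_bound f)).

(* Elements of [A**]: the bounded linear functionals on [A*].  Linearity is
   stated through pointwise equalities in [A*], so that no vector space
   structure on [dual A] is needed. *)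
Record bidual (R : realType) (A : cstarAlgType R) := Bidual {
  bidual_fun :> dual A -> R[i];
  bidual_linear : forall (k : R[i]) (f g h : dual A),
    (forall a, h a = k * f a + g a) ->
    bidual_fun h = k * bidual_fun f + bidual_fun g;
  bidual_bounded : exists M : R,
    forall f, `|bidual_fun f| <= (M * dual_norm f)%:C }.

Lemma bidual_boundP (R : realType) (A : cstarAlgType R) (x : bidual A) :
  exists2 M : R, 0 <= M & forall f, `|x f| <= (M * dual_norm f)%:C.
Proof.
have [M HM] := bidual_bounded x; exists `|M| => // f.
apply: le_trans (HM f) _; rewrite lecR ler_wpM2r ?dual_norm_ge0//.
exact: ler_norm.
Qed.

Lemma bidual_lactP (R : realType) (A : cstarAlgType R) (x : bidual A)
  (f : dual A) : linear (fun a : A => x (dual_ract f a) : R[i]^o).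
Proof.
move=> k a b.
by apply: (@bidual_linear _ _ x k) => c /=; rewrite cmulPl linearP.
Qed.

Lemma bidual_lact_bound (R : realType) (A : cstarAlgType R) (x : bidual A)
    (M : R) (f : dual A) : 0 <= M ->
    (forall f, `|x f| <= (M * dual_norm f)%:C) ->
  forall a : A, `|x (dual_ract f a)| <= (M * dual_norm f)%:C * `|a|.
Proof.
move=> M0 HM a; apply: le_trans (HM _) _; rewrite -Re_norm -rmorphM lecR -mulrA.
rewrite ler_wpM2l// dual_norm_le//.
  by rewrite mulr_ge0 ?dual_norm_ge0 ?Re_norm_ge0.
exact: dual_ract_bound.
Qed.

Lemma bidual_lact_ex (R : realType) (A : cstarAlgType R) (x : bidual A)
    (f : dual A) :
  exists M : R, forall a : A,
    `|x (dual_ract f a) : R[i]^o| <= M%:C * `|a|.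
Proof.
have [M M0 HM] := bidual_boundP x.
by exists (M * dual_norm f) => a; exact: bidual_lact_bound.
Qed.

(* [x.f : y |-> f (y x)], restricted to [y] in [A] *)
Definition bidual_lact (R : realType) (A : cstarAlgType R) (x : bidual A)
    (f : dual A) : dual A :=
  dual_of (fun a => x (dual_ract f a)) (bidual_lactP x f) (bidual_lact_ex x f).

Lemma bidual_ractP (R : realType) (A : cstarAlgType R) (f : dual A)
  (x : bidual A) : linear (fun a : A => x (dual_lact a f) : R[i]^o).
Proof.
move=> k a b.
by apply: (@bidual_linear _ _ x k) => c /=; rewrite cmulPr linearP.
Qed.

Lemma bidual_ract_ex (R : realType) (A : cstarAlgType R) (f : dual A)
    (x : bidual A) :
  exists M : R, forall a : A,
    `|x (dual_lact a f) : R[i]^o| <= M%:C * `|a|.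
Proof.
have [M M0 HM] := bidual_boundP x.
exists (M * dual_norm f) => a; apply: le_trans (HM _) _.
rewrite -Re_norm -rmorphM lecR -mulrA.
rewrite ler_wpM2l// dual_norm_le//.
  by rewrite mulr_ge0 ?dual_norm_ge0 ?Re_norm_ge0.
exact: dual_lact_bound.
Qed.

(* [f.x : y |-> f (x y)], restricted to [y] in [A] *)
Definition bidual_ract (R : realType) (A : cstarAlgType R) (f : dual A)
    (x : bidual A) : dual A :=
  dual_of (fun a => x (dual_lact a f)) (bidual_ractP f x) (bidual_ract_ex f x).

Lemma bidual_mulP (R : realType) (A : cstarAlgType R) (x y : bidual A)
    (k : R[i]) (f g h : dual A) :
  (forall a, h a = k * f a + g a) ->
  x (bidual_lact y h) = k * x (bidual_lact y f) + x (bidual_lact y g).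
Proof. by move=> E; do 2![apply: bidual_linear => ? /=]. Qed.

Lemma bidual_mul_bounded (R : realType) (A : cstarAlgType R) (x y : bidual A) :
  exists M : R, forall f, `|x (bidual_lact y f)| <= (M * dual_norm f)%:C.
Proof.
have [M M0 HM] := bidual_boundP x; have [N N0 HN] := bidual_boundP y.
exists (M * N) => f; apply: le_trans (HM _) _; rewrite lecR -mulrA.
rewrite ler_wpM2l// dual_norm_le//; first by rewrite mulr_ge0 ?dual_norm_ge0.
exact: bidual_lact_bound.
Qed.

(* The Arens product, which extends the product of [A] and is the product of
   the enveloping von Neumann algebra. *)
Definition bidual_mul (R : realType) (A : cstarAlgType R) (x y : bidual A) :
    bidual A :=
  @Bidual R A (fun f => x (bidual_lact y f)) (@bidual_mulP R A x y)
    (bidual_mul_bounded x y).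

Lemma bidual_starP (R : realType) (A : cstarAlgType R) (x : bidual A)
    (k : R[i]) (f g h : dual A) :
  (forall a, h a = k * f a + g a) ->
  (x (dual_star h))^* = k * (x (dual_star f))^* + (x (dual_star g))^*.
Proof.
move=> E; rewrite (@bidual_linear _ _ x k^* (dual_star f) (dual_star g)).
  by rewrite rmorphD rmorphM/= conjcK.
by move=> a /=; rewrite E rmorphD rmorphM.
Qed.

Lemma bidual_star_bounded (R : realType) (A : cstarAlgType R) (x : bidual A) :
  exists M : R, forall f, `|(x (dual_star f))^*| <= (M * dual_norm f)%:C.
Proof.
have [M M0 HM] := bidual_boundP x; exists M => f.
rewrite normcJ; apply: le_trans (HM _) _; rewrite lecR ler_wpM2l//.
apply: dual_norm_le; first exact: dual_norm_ge0.
exact: dual_star_bound.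
Qed.

Definition bidual_star (R : realType) (A : cstarAlgType R) (x : bidual A) :
    bidual A :=
  @Bidual R A (fun f => (x (dual_star f))^*) (@bidual_starP R A x)
    (bidual_star_bounded x).

Definition projection (R : realType) (A : cstarAlgType R) (p : bidual A) :=
  bidual_mul p p =1 p /\ bidual_star p =1 p.

Definition partial_isometry (R : realType) (A : cstarAlgType R) (w : bidual A) :=
  bidual_mul (bidual_mul w (bidual_star w)) w =1 w.

(* [p] is the smallest projection of [A**] with [f.p = f]; for projections,
   [p <= q] means [p q = p]. *)
Definition support_projection (R : realType) (A : cstarAlgType R)
    (f : dual A) (p : bidual A) :=
  [/\ projection p, bidual_ract f p =1 f
    & forall q : bidual A, projection q -> bidual_ract f q =1 f ->
        bidual_mul p q =1 p].

(* [f = w.g], where [g] is the right absolute value of [f]. *)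
Definition polar_decomposition (R : realType) (A : cstarAlgType R)
    (f : dual A) (w : bidual A) (g : dual A) :=
  [/\ positive_functional g, partial_isometry w,
      support_projection g (bidual_mul (bidual_star w) w)
    & f =1 bidual_lact w g].

Definition left_absolute_value (R : realType) (A : cstarAlgType R)
    (w : bidual A) (g : dual A) : dual A :=
  bidual_ract (bidual_lact w g) (bidual_star w).

(* Double centralisers.  The identity [multP] forces both maps to be linear,
   bounded and module maps, and each of them determines the other. *)
Record mult (R : realType) (B : cstarAlgType R) := Mult {
  lmult : B -> B;
  rmult : B -> B;
  multP : forall a b : B, a ** lmult b = rmult a ** b }.

Definition mult_of (R : realType) (B : cstarAlgType R) (x : B) : mult B :=
  Mult (fun a b : B => cmulA a x b).

Lemma mult_mul_subproof (R : realType) (B : cstarAlgType R) (m n : mult B)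
  (a b : B) : a ** lmult m (lmult n b) = rmult n (rmult m a) ** b.
Proof. by rewrite !multP. Qed.

Definition mult_mul (R : realType) (B : cstarAlgType R) (m n : mult B) :
  mult B := Mult (mult_mul_subproof m n).

Lemma mult_star_subproof (R : realType) (B : cstarAlgType R) (m : mult B)
  (a b : B) :
  a ** star (rmult m (star b)) = star (lmult m (star a)) ** b.
Proof.
by rewrite -[in LHS](starK a) -[in RHS](starK b) -!starM multP.
Qed.

Definition mult_star (R : realType) (B : cstarAlgType R) (m : mult B) :
  mult B := Mult (mult_star_subproof m).

Lemma mult_lin_subproof (R : realType) (B : cstarAlgType R) (k : R[i])
  (m n : mult B) (a b : B) :
  a ** (k *: lmult m b + lmult n b) = (k *: rmult m a + rmult n a) ** b.
Proof. by rewrite cmulPr cmulPl !multP. Qed.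

(* [k m + n] *)
Definition mult_lin (R : realType) (B : cstarAlgType R) (k : R[i])
    (m n : mult B) : mult B :=
  Mult (mult_lin_subproof k m n).

Definition mult_eq (R : realType) (B : cstarAlgType R) (m n : mult B) :=
  lmult m =1 lmult n /\ rmult m =1 rmult n.

Definition mult_star_hom (R : realType) (A B : cstarAlgType R)
    (D : A -> mult B) :=
  [/\ forall (k : R[i]) x y, mult_eq (D (k *: x + y)) (mult_lin k (D x) (D y)),
      forall x y, mult_eq (D (x ** y)) (mult_mul (D x) (D y))
    & forall x, mult_eq (D (star x)) (mult_star (D x))].

Definition nondegenerate (R : realType) (A B : cstarAlgType R)
    (D : A -> mult B) :=
  closure (lspan [set lmult (D a) b | a in [set: A] & b in [set: B]]) = [set: B].

(* [M = D(m)] for the canonical extension [M(A) -> M(B)] of a nondegenerate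
   [D : A -> M(B)], which is determined by [D(m) D(a) = D(m a)]. *)
Definition extends_to (R : realType) (A B : cstarAlgType R) (D : A -> mult B)
    (m : mult A) (M : mult B) :=
  forall a : A, mult_eq (mult_mul M (D a)) (D (lmult m a)).

(* The filter of (traces on [B] of) strict neighbourhoods of [m] in [M(B)]. *)
Definition strict_nbhs (R : realType) (B : cstarAlgType R) (m : mult B) :
    set_system B :=
  [set U | exists s : seq B, exists2 d : R, 0 < d &
    [set x | forall b, b \in s -> `|lmult m b - x ** b| < d%:C /\
                                  `|rmult m b - b ** x| < d%:C] `<=` U].

(* [z = f(m)] for the strictly continuous extension of [f] to [M(B)]. *)
Definition strict_value (R : realType) (B : cstarAlgType R) (f : dual B)
    (m : mult B) (z : R[i]) :=
  (f x : R[i]^o) @[x --> strict_nbhs m] --> (z : R[i]^o).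

(* An element of the algebraic tensor product of [A] and [B] is represented by
   a list of elementary tensors. *)
Definition alg_mul (R : realType) (A B : cstarAlgType R)
    (s t : seq (A * B)) : seq (A * B) :=
  [seq (p.1 ** q.1, p.2 ** q.2) | p <- s, q <- t].

Definition alg_star (R : realType) (A B : cstarAlgType R) (s : seq (A * B)) :
    seq (A * B) :=
  [seq (star p.1, star p.2) | p <- s].

(* [(f (x) g)(s)] *)
Definition alg_eval (R : realType) (A B : cstarAlgType R)
    (f : dual A) (g : dual B) (s : seq (A * B)) : R[i] :=
  \sum_(p <- s) f p.1 * g p.2.

(* [T], with the elementary tensors [t], is the spatial tensor product of [A]
   and [B]: the completion of the algebraic tensor product for the norm
     sup { || (rho_f (x) rho_g)(s) || : f, g positive functionals },
   [rho_f] and [rho_g] being the GNS representations.  As the classes of the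
   elements [y] of the algebraic tensor product are dense in the tensor product
   of the GNS spaces, with [|| s y ||^2 = (f (x) g)(y^* s^* s y)], the last
   condition says that the norm of [T] is this supremum. *)
Definition spatial_tensor (R : realType) (A B T : cstarAlgType R)
    (t : A -> B -> T) :=
  [/\ (forall (k : R[i]) a a' b, t (k *: a + a') b = k *: t a b + t a' b) /\
      (forall (k : R[i]) a b b', t a (k *: b + b') = k *: t a b + t a b'),
      forall a a' b b', t (a ** a') (b ** b') = t a b ** t a' b',
      forall a b, t (star a) (star b) = star (t a b),
      closure (lspan [set t a b | a in [set: A] & b in [set: B]]) = [set: T]
    & forall (s : seq (A * B)) (c : R), 0 <= c ->
        `|\sum_(p <- s) t p.1 p.2| <= c%:C <->
        forall (f : dual A) (g : dual B),
          positive_functional f -> positive_functional g ->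
        forall y : seq (A * B),
          alg_eval f g
            (alg_mul (alg_mul (alg_star y) (alg_star s)) (alg_mul s y))
          <= (c ^+ 2)%:C * alg_eval f g (alg_mul (alg_star y) y)].

(* [z = (f (x) g)(m)] for [m] in [M(T)], [T] the tensor product of [A] and
   [B]. *)
Definition tensor_value (R : realType) (A B T : cstarAlgType R)
    (t : A -> B -> T) (f : dual A) (g : dual B) (m : mult T) (z : R[i]) :=
  exists2 h : dual T, (forall a b, h (t a b) = f a * g b) & strict_value h m z.

(* [b = (f (x) id)(m)] and [a = (id (x) f)(m)], tested against the functionals
   on the remaining leg. *)
Definition lslice (R : realType) (A B T : cstarAlgType R)
    (t : A -> B -> T) (f : dual A) (m : mult T) (b : B) :=
  forall g : dual B, tensor_value t f g m (g b).

Definition rslice (R : realType) (A B T : cstarAlgType R)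
    (t : A -> B -> T) (f : dual B) (m : mult T) (a : A) :=
  forall g : dual A, tensor_value t g f m (g a).

(* A weight is a map [A_+ -> [0, +oo]]; it is represented by a map on [A] whose
   values outside of [A_+] are irrelevant.  Proper weights are the nonzero,
   densely defined, lower semicontinuous ones. *)
Definition proper_weight (R : realType) (A : cstarAlgType R)
    (phi : A -> \bar R) :=
  let Apos := positive_cone A in
  [/\ [/\ forall x, Apos x -> (0 <= phi x)%E,
          forall x y, Apos x -> Apos y -> phi (x + y) = (phi x + phi y)%E
        & forall (r : R) x, 0 <= r -> Apos x ->
            phi (r%:C *: x) = (r%:E * phi x)%E],
      exists2 x, Apos x & phi x != 0%E,
      Apos `<=` closure [set x | Apos x /\ (phi x < +oo)%E]
    & forall r : R, closed [set x | Apos x /\ (phi x <= r%:E)%E]].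

Definition faithful_weight (R : realType) (A : cstarAlgType R)
    (phi : A -> \bar R) :=
  forall x, positive_cone A x -> phi x = 0%E -> x = 0.

Definition one_parameter_group (R : realType) (A : cstarAlgType R)
    (sigma : R -> A -> A) :=
  [/\ forall r, star_hom (sigma r),
      forall a, sigma 0 a = a,
      forall r s a, sigma (r + s) a = sigma r (sigma s a)
    & forall a, continuous (fun r : R^o => sigma r a)].

(* [a] belongs to the domain of [sigma_(i/2)] and [b = sigma_(i/2)(a)]: the
   orbit of [a] extends to a continuous function on the strip
   [0 <= Im z <= 1/2], analytic inside it, with value [b] at [i/2]. *)
Definition half_analytic (R : realType) (A : cstarAlgType R)
    (sigma : R -> A -> A) (a b : A) :=
  exists F : R[i]^o -> A,
    [/\ {within [set z : R[i]^o | 0 <= complex.Im z <= 2^-1], continuous F},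
        forall z : R[i]^o, 0 < complex.Im z < 2^-1 -> derivable F z 1,
        forall r : R, F r%:C = sigma r a
      & F (0 +i* 2^-1) = b].

Definition kms_weight (R : realType) (A : cstarAlgType R) (phi : A -> \bar R) :=
  proper_weight phi /\
  exists sigma : R -> A -> A,
    [/\ one_parameter_group sigma,
        forall r x, positive_cone A x -> phi (sigma r x) = phi x
      & forall a b, half_analytic sigma a b ->
          phi (star a ** a) = phi (b ** star b)].

(* For a positive functional [f], the number [f(1)] is the norm of [f]. *)
Definition left_invariant_weight (R : realType) (A T : cstarAlgType R)
    (t : A -> A -> T) (Delta : A -> mult T) (phi : A -> \bar R) :=
  forall (a : A) (f : dual A),
    positive_cone A a -> (phi a < +oo)%E -> positive_functional f ->
  exists2 b, lslice t f (Delta a) b & phi b = ((dual_norm f)%:E * phi a)%E.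

Definition right_invariant_weight (R : realType) (A T : cstarAlgType R)
    (t : A -> A -> T) (Delta : A -> mult T) (phi : A -> \bar R) :=
  forall (a : A) (f : dual A),
    positive_cone A a -> (phi a < +oo)%E -> positive_functional f ->
  exists2 b, rslice t f (Delta a) b & phi b = ((dual_norm f)%:E * phi a)%E.

(* [(Delta (x) id) Delta = (id (x) Delta) Delta], where [T3] is the threefold
   tensor product, [tl (t x y) z = tr x (t y z)] being the tensor of [x], [y]
   and [z]; [D1] is [Delta (x) id] and [D2] is [id (x) Delta]. *)
Definition coassociative (R : realType) (A T T3 : cstarAlgType R)
    (t : A -> A -> T) (tl : T -> A -> T3) (tr : A -> T -> T3)
    (Delta : A -> mult T) :=
  exists D1 D2 : T -> mult T3,
    [/\ mult_star_hom D1 /\ mult_star_hom D2,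
        forall x y u z,
          lmult (D1 (t x y)) (tl u z) = tl (lmult (Delta x) u) (y ** z),
        forall x y u z,
          lmult (D2 (t x y)) (tr z u) = tr (x ** z) (lmult (Delta y) u)
      & forall a, exists2 M : mult T3,
          extends_to D1 (Delta a) M & extends_to D2 (Delta a) M].

(* [u = Delta(a)(b (x) 1)], resp. [u = Delta(a)(1 (x) b)], in [M(T)] *)
Definition cancel1 (R : realType) (A T : cstarAlgType R) (t : A -> A -> T)
    (Delta : A -> mult T) (a b : A) (u : T) :=
  forall x y, u ** t x y = lmult (Delta a) (t (b ** x) y).

Definition cancel2 (R : realType) (A T : cstarAlgType R) (t : A -> A -> T)
    (Delta : A -> mult T) (a b : A) (u : T) :=
  forall x y, u ** t x y = lmult (Delta a) (t x (b ** y)).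

Definition cancellation_laws (R : realType) (A T : cstarAlgType R)
    (t : A -> A -> T) (Delta : A -> mult T) :=
  [/\ forall a b, exists u, cancel1 t Delta a b u,
      closure (lspan [set u | exists a b, cancel1 t Delta a b u]) = [set: T],
      forall a b, exists u, cancel2 t Delta a b u
    & closure (lspan [set u | exists a b, cancel2 t Delta a b u]) = [set: T]].

(* [C02] and [C03] are the twofold and threefold spatial tensor powers of [C0];
   as these are unique up to a unique isomorphism respecting the elementary
   tensors, they are carried as data. *)
Record lcqg (R : realType) := LCQG {
  C0 : cstarAlgType R;
  C02 : cstarAlgType R;
  C03 : cstarAlgType R;
  tens : C0 -> C0 -> C02;
  tens_spatial : spatial_tensor tens;
  tensl : C02 -> C0 -> C03;
  tensl_spatial : spatial_tensor tensl;
  tensr : C0 -> C02 -> C03;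
  tensr_spatial : spatial_tensor tensr;
  tensA : forall x y z : C0, tensl (tens x y) z = tensr x (tens y z);
  Delta : C0 -> mult C02;
  Delta_hom : mult_star_hom Delta;
  Delta_nondegenerate : nondegenerate Delta;
  Delta_coassociative : coassociative tens tensl tensr Delta;
  Delta_cancellation : cancellation_laws tens Delta;
  left_haar_weight : exists phi : C0 -> \bar R,
    [/\ kms_weight phi, faithful_weight phi
      & left_invariant_weight tens Delta phi];
  right_haar_weight : exists psi : C0 -> \bar R,
    [/\ kms_weight psi, faithful_weight psi
      & right_invariant_weight tens Delta psi] }.

Arguments tens {R} l _ _.
Arguments Delta {R} l _.

Definition counit (R : realType) (G : lcqg R) (e : dual (C0 G)) :=
  [/\ forall x y, e (x ** y) = e x * e y,
      forall x, e (star x) = (e x : R[i])^*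
    & forall a, lslice (tens G) e (Delta G a) a /\
                rslice (tens G) e (Delta G a) a].

Definition coamenable (R : realType) (G : lcqg R) :=
  exists e : dual (C0 G), counit e.

Definition compact_qg (R : realType) (G : lcqg R) := unital (C0 G).

(* [h] is the product of [f] and [g] in [M(G) = C0(G)^*]. *)
Definition convolution (R : realType) (G : lcqg R) (f g h : dual (C0 G)) :=
  forall a, tensor_value (tens G) f g (Delta G a) (h a).

Definition idempotent_functional (R : realType) (G : lcqg R)
    (f : dual (C0 G)) :=
  ~ (f =1 fun=> 0) /\ convolution f f f.

(* [(id (x) h) Delta(a) = h(a) 1 = (h (x) id) Delta(a)] *)
Definition haar_state (R : realType) (H : lcqg R) (h : dual (C0 H)) :=
  [/\ state h,
      forall a, h (star a ** a) = 0 -> a = 0,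
      forall a e, is_unit e -> rslice (tens H) h (Delta H a) (h a *: e)
    & forall a e, is_unit e -> lslice (tens H) h (Delta H a) (h a *: e)].

Definition group_like (R : realType) (H : lcqg R) (u : C0 H) :=
  mult_eq (Delta H u) (mult_of (tens H u u)).

(* [pi] intertwines the coproducts: [(pi (x) pi) Delta_G = Delta_H pi], where
   [P] is [pi (x) pi]. *)
Definition compact_quantum_subgroup (R : realType) (G H : lcqg R)
    (pi : C0 G -> C0 H) :=
  [/\ compact_qg H, star_hom pi, forall b, exists a, pi a = b
    & exists P : C02 G -> C02 H,
        [/\ star_hom P, forall x y, P (tens G x y) = tens H (pi x) (pi y)
          & forall a, extends_to (fun t => mult_of (P t))
              (Delta G a) (Delta H (pi a))]].

Definition haar_idempotent (R : realType) (G H : lcqg R) (pi : C0 G -> C0 H)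
    (h : dual (C0 H)) (f : dual (C0 G)) :=
  [/\ state f, idempotent_functional f, compact_quantum_subgroup pi,
      haar_state h & forall a, f a = h (pi a)].

(* Main.v *)
(* Let [omega = w.|omega|_r] with [|omega|_r = h o pi].  The functional
   [a |-> omega(a)] is bounded for the seminorm [h(pi(a) pi(a)^* )^(1/2)], hence is a
   limit of functionals [h(pi(.) c_n)] with [c_n] Cauchy in [L^2(h)], and the
   relation [|omega|_r(w^* w) = 1] says that the limit has norm 1.  So [omega]
   factors as [om o pi], where [om] is idempotent on the compact quantum group.

   The limit is found inside [C(H)] by slicing: by right invariance and the
   Cauchy-Schwarz inequality,
     || (id (x) h)(Delta(a)(1 (x) c)) ||^2 <= h(a a^* ) h(c^* c),
   so that [x_n = (id (x) h)(Delta(c_n^* )(1 (x) c_n))] converges in norm to some [x]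
   with [||x|| <= 1], and idempotency gives [om(x) = 1].  Faithfulness of [h]
   then yields [x x^* = 1] and [om = h(. x^* )], the equality case of
   Cauchy-Schwarz for [h (x) h] yields [Delta(x) = x (x) x], and the projection
   [p = x^* x] is group-like, so that [h(p) = h(p)^2] and [p = 1].  Take [u = x^*].
   Finally [h(u^* . u) = h], since [Delta(u^* b u) = (u (x) u)^* Delta(b)(u (x) u)]
   allows to compute [(h (x) h)((1 (x) u^* ) Delta(b) (1 (x) u))] in two ways; this is
   [|omega|_l = |omega|_r].

   The C*-theory is obtained from square roots [1 - r] of [1 - x], [||x|| <= 1]:
   they write selfadjoint elements as real parts of unitaries, which gives the
   contractivity of *-homomorphisms, approximate units, and the fact that the
   GNS representation of a faithful state is isometric. *)
Require Import Defs.
From HB Require Import structures.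
From mathcomp Require Import all_boot all_order all_algebra complex.
From mathcomp Require Import all_classical all_reals.
From mathcomp Require Import ereal topology normedtype derive.
From mathcomp Require Import ring lra.

Set Implicit Arguments.
Unset Strict Implicit.
Unset Printing Implicit Defensive.

Import Order.TTheory GRing.Theory Num.Theory.
Import numFieldNormedType.Exports.

Local Open Scope classical_set_scope.
Local Open Scope complex_scope.
Local Open Scope ring_scope.

(** * Linear normal forms and norms *)

(* A reflexive decision procedure for identities in a module, to which [ring]
   does not apply: it leaves one identity between coefficients per atom. *)
Section LinearNormalForm.
Variables (K : comPzRingType) (V : lmodType K).

Inductive lexp :=
  | LVar of nat | LZero | LAdd of lexp & lexp | LOpp of lexp
  | LScale of K & lexp | LMuln of lexp & nat.

Fixpoint leval (env : seq V) (e : lexp) : V :=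
  match e with
  | LVar n => nth 0 env n
  | LZero => 0
  | LAdd a b => leval env a + leval env b
  | LOpp a => - leval env a
  | LScale k a => k *: leval env a
  | LMuln a n => leval env a *+ n
  end.

Fixpoint lcoef (e : lexp) (n : nat) : K :=
  match e with
  | LVar m => if eqn m n then 1 else 0
  | LZero => 0
  | LAdd a b => lcoef a n + lcoef b n
  | LOpp a => - lcoef a n
  | LScale k a => k * lcoef a n
  | LMuln a m => lcoef a n *+ m
  end.

Fixpoint lcoefs_eq (a b : lexp) (n : nat) : Prop :=
  match n with
  | 0%N => True
  | m.+1 => lcoef a m = lcoef b m /\ lcoefs_eq a b m
  end.

Lemma leval_coef env e :
  leval env e = \sum_(i < size env) lcoef e i *: nth 0 env i.
Proof.
elim: e => [m||a IHa b IHb|a IHa|k a IHa|a IHa m] /=.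
- case: (ltnP m (size env)) => [lt_m|le_m]; last first.
    rewrite nth_default// big1// => i _; case: (@eqnP m i) => [mi|_].
      by move: (ltn_ord i); rewrite -mi ltnNge le_m.
    by rewrite scale0r.
  rewrite (bigD1 (Ordinal lt_m))//= eqnE eqxx scale1r big1 ?addr0// => i.
  case: (@eqP _ m i) => [mi|_ _]; last by rewrite scale0r.
  by move/negP; case; apply/eqP/val_inj.
- by rewrite big1// => i _; rewrite scale0r.
- by rewrite IHa IHb -big_split/=; apply: eq_bigr => i _; rewrite scalerDl.
- by rewrite IHa -sumrN; apply: eq_bigr => i _; rewrite scaleNr.
- by rewrite IHa scaler_sumr; apply: eq_bigr => i _; rewrite scalerA.
- by rewrite IHa -sumrMnl; apply: eq_bigr => i _; rewrite scalerMnl.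
Qed.

Lemma leval_eq env a b : lcoefs_eq a b (size env) -> leval env a = leval env b.
Proof.
move=> ab; rewrite !leval_coef; apply: eq_bigr => -[i /= lti] _.
congr (_ *: _); elim: (size env) lti ab => //= n IHn lti [abn /IHn abn'].
by move: lti; rewrite ltnS leq_eqVlt => /predU1P[->|/abn'].
Qed.

End LinearNormalForm.

Ltac lmem x env :=
  match env with
  | nil => false
  | cons x _ => true
  | cons _ ?r => lmem x r
  end.

Ltac lindex x env :=
  match env with
  | cons x _ => constr:(0%N)
  | cons _ ?r => let n := lindex x r in constr:(S n)
  end.

Ltac latoms t env :=
  match t with
  | @GRing.add _ ?a ?b => let env' := latoms a env in latoms b env'
  | @GRing.opp _ ?a => latoms a env
  | @GRing.scale _ _ _ ?a => latoms a env
  | @GRing.natmul _ ?a _ => latoms a env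
  | @GRing.zero _ => env
  | _ => match lmem t env with true => env | false => constr:(cons t env) end
  end.

Ltac lreify K t env :=
  match t with
  | @GRing.add _ ?a ?b =>
      let a' := lreify K a env in let b' := lreify K b env in
      constr:(@LAdd K a' b')
  | @GRing.opp _ ?a => let a' := lreify K a env in constr:(@LOpp K a')
  | @GRing.scale _ _ ?k ?a =>
      let a' := lreify K a env in constr:(@LScale K k a')
  | @GRing.natmul _ ?a ?n =>
      let a' := lreify K a env in constr:(@LMuln K a' n)
  | @GRing.zero _ => constr:(@LZero K)
  | _ => let n := lindex t env in constr:(@LVar K n)
  end.

Ltac lmod_over K :=
  match goal with
  | |- @eq ?V ?l ?r =>
      let env := latoms l (@nil V) in
      let env := latoms r env in
      let a := lreify K l env in
      let b := lreify K r env in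
      refine (@leval_eq K _ env a b _); cbn [size lcoefs_eq lcoef eqn Nat.eqb];
      repeat split
  end.

(** * Real-valued norms and completeness with explicit rates *)

Section Norm.
Context {R : realType}.
Implicit Type V : normedModType R[i].

Definition nrm V (x : V) : R := complex.Re `|x|.

Lemma nrmE V (x : V) : `|x| = (nrm x)%:C.
Proof. by rewrite /nrm Re_norm. Qed.

Lemma nrm_ge0 V (x : V) : 0 <= nrm x.
Proof. exact: Re_norm_ge0. Qed.

Lemma nrm0 V : nrm (0 : V) = 0.
Proof. by rewrite /nrm normr0. Qed.

Lemma nrm_eq0 V (x : V) : nrm x = 0 -> x = 0.
Proof. by move=> x0; apply/eqP; rewrite -normr_eq0 nrmE x0. Qed.

Lemma nrmN V (x : V) : nrm (- x) = nrm x.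
Proof. by rewrite /nrm normrN. Qed.

Lemma nrmB V (x y : V) : nrm (x - y) = nrm (y - x).
Proof. by rewrite /nrm distrC. Qed.

Lemma nrmD V (x y : V) : nrm (x + y) <= nrm x + nrm y.
Proof. by rewrite -lecR rmorphD/= -!nrmE ler_normD. Qed.

Lemma nrm_triangle V (x y z : V) : nrm (x - z) <= nrm (x - y) + nrm (y - z).
Proof. by apply: le_trans (nrmD _ _); rewrite addrA subrK. Qed.

Lemma nrmZ V (k : R[i]) (x : V) : nrm (k *: x) = nrm (k : R[i]^o) * nrm x.
Proof. by apply/complexI; rewrite rmorphM/= -!nrmE normrZ. Qed.

Lemma nrmcM (a b : R[i]) :
  nrm (a * b : R[i]^o) = nrm (a : R[i]^o) * nrm (b : R[i]^o).
Proof. exact: (nrmZ a (b : R[i]^o)). Qed.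

Lemma nrmcJ (a : R[i]) : nrm (a^* : R[i]^o) = nrm (a : R[i]^o).
Proof. by congr complex.Re; exact: (normcJ a). Qed.

Lemma conj_real (a : R) : (a%:C)^* = a%:C :> R[i].
Proof. exact: conjc_real. Qed.

Lemma nrm_real (a : R) : nrm (a%:C : R[i]^o) = `|a|.
Proof. by apply/complexI; rewrite -nrmE normc_def/= expr0n addr0 sqrtr_sqr. Qed.

Lemma nrm_real_ge0 (a : R) : 0 <= a -> nrm (a%:C : R[i]^o) = a.
Proof. by move=> a0; rewrite nrm_real ger0_norm. Qed.

Lemma nrmi : nrm ('i : R[i]^o) = 1.
Proof. by apply/complexI; rewrite -nrmE normc_def/= expr0n expr1n add0r sqrtr1. Qed.

Lemma nrmZr V (c : R) (x : V) : 0 <= c -> nrm (c%:C *: x) = c * nrm x.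
Proof. by move=> c0; rewrite nrmZ nrm_real_ge0. Qed.

Lemma nrm_sqr (a : R[i]) : (nrm (a : R[i]^o) ^+ 2)%:C = a * a^*.
Proof. by rewrite rmorphXn/= -nrmE sqr_normc. Qed.

Lemma Re_le_nrm (a : R[i]) : complex.Re a <= nrm (a : R[i]^o).
Proof.
have := normc_ge_Re a; rewrite (nrmE (a : R[i]^o)) lecR.
by apply: le_trans; rewrite ler_norm.
Qed.

Lemma ge0_ReE (a : R[i]) : 0 <= a -> a = (complex.Re a)%:C.
Proof. by case: a => x y; rewrite lecE/= => /andP[/eqP-> _]. Qed.

Lemma Re_ge0 (a : R[i]) : 0 <= a -> 0 <= complex.Re a.
Proof. by case: a => x y; rewrite lecE/= => /andP[]. Qed.

Lemma nrm_small V (x y : V) : (forall e : R, 0 < e -> nrm (x - y) <= e) -> x = y.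
Proof.
move=> H; apply/eqP; rewrite -subr_eq0; apply/eqP; apply: nrm_eq0.
apply/eqP; rewrite eq_le nrm_ge0 andbT; apply/ler_addgt0Pr => e e0.
by rewrite add0r H.
Qed.

Lemma cvg_nrm V (u : nat -> V) (l : V) : (u @ \oo --> l) ->
  forall e : R, 0 < e -> exists N, forall n, (N <= n)%N -> nrm (l - u n) < e.
Proof.
move=> /cvgrPdist_lt H e e0; have ec0 : 0 < e%:C by rewrite ltcR.
have [N _ HN] := H _ ec0; exists N => n Nn.
by rewrite -ltcR -nrmE; apply: HN.
Qed.

(* A rate version of completeness; it also covers [R[i]], which carries no
   structure of complete normed module. *)
Definition rate_complete V := forall (u : nat -> V) (e : nat -> R),
  (forall n m, (n <= m)%N -> nrm (u m - u n) <= e n) ->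
  (forall d : R, 0 < d -> exists N, e N <= d) ->
  exists l, forall n, nrm (l - u n) <= e n.

Lemma cauchy_rate (V : completeNormedModType R[i]) : rate_complete V.
Proof.
move=> u e Hu He; have : cvg (u @ \oo).
  apply/cauchy_cvgP/cauchy_ballP => d d0.
  have dE : d = (complex.Re d)%:C by rewrite RRe_real// gtr0_real.
  have [|N HN] := He (complex.Re d / 4).
    by rewrite divr_gt0// -ltcR -dE.
  rewrite near_map2; exists ([set n | (N <= n)%N], [set n | (N <= n)%N]) => /=.
    by split; exists N.
  move=> [n m] /= [Nn Nm]; rewrite -ball_normE/= nrmE dE ltcR.
  have := nrm_triangle (u n) (u N) (u m); have := Hu _ _ Nn; have := Hu _ _ Nm.
  rewrite (nrmB (u N)); have : 0 < complex.Re d by rewrite -ltcR -dE.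
  lra.
move=> /cvg_ex[l ul]; exists l => n; apply/ler_addgt0Pl => d d0.
have [N HN] := cvg_nrm ul d0.
have := HN _ (leq_maxl N n); have := Hu _ _ (leq_maxr N n).
have := nrm_triangle l (u (maxn N n)) (u n); lra.
Qed.

(** The intervals [[x n - e n, x n + e n]] meet pairwise, so the supremum of the left endpoints lies
    in all of them. *)
Lemma real_cauchy_rate (x e : nat -> R) :
  (forall n m, (n <= m)%N -> `|x m - x n| <= e n) ->
  exists l, forall n, `|l - x n| <= e n.
Proof.
move=> Hx; pose S := [set x n - e n | n in [set: nat]].
have e0 n : 0 <= e n by apply: le_trans (Hx n n _); rewrite ?normr_ge0.
have xe n m : x n - e n <= x m + e m.
  case: (leqP n m) => [/Hx|/ltnW/Hx]; rewrite ler_norml => /andP[]; have := e0 n;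
    by have := e0 m; lra.
have supS : has_sup S.
  by split; [exists (x 0 - e 0), 0|exists (x 0 + e 0) => _ [n _ <-]; exact: xe].
exists (sup S) => n; rewrite ler_norml; apply/andP; split.
  have : x n - e n <= sup S by apply: ub_le_sup; [have [] := supS|exists n].
  lra.
have : sup S <= x n + e n.
  by apply: ge_sup; [have [] := supS|move=> _ [m _ <-]; exact: xe].
lra.
Qed.

Lemma complex_rate_complete : rate_complete R[i]^o.
Proof.
move=> u e Hu He.
have nrmRe (z : R[i]) : `|complex.Re z| <= nrm (z : R[i]^o).
  by have := normc_ge_Re z; rewrite (nrmE (z : R[i]^o)) lecR.
have nrmIm (z : R[i]) : `|complex.Im z| <= nrm (z : R[i]^o).
  have := nrmRe (z * 'i%C); rewrite ReiNIm normrN nrmcM; congr (_ <= _).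
  by rewrite [X in _ * X](_ : _ = 1) ?mulr1//; exact: nrmi.
have nrm_le (z : R[i]) :
    nrm (z : R[i]^o) <= `|complex.Re z| + `|complex.Im z|.
  rewrite {1}(complexE z); apply: le_trans (nrmD (_ : R[i]^o) _) _.
  rewrite nrmcM (_ : nrm ('i%C : R[i]^o) = 1) ?mul1r; last exact: nrmi.
  by rewrite !nrm_real.
have [|a Ha] := @real_cauchy_rate (fun n => complex.Re (u n)) e.
  move=> n m /Hu; apply: le_trans; apply: le_trans (nrmRe _).
  by case: (u n) (u m) => x y [].
have [|b Hb] := @real_cauchy_rate (fun n => complex.Im (u n)) e.
  move=> n m /Hu; apply: le_trans; apply: le_trans (nrmIm _).
  by case: (u n) (u m) => x y [].
exists (a +i* b)%C => n; apply/ler_addgt0Pr => d d0.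
(* Componentwise limits only give the rate [2 * e N]. Going through an index [m] beyond both [N] and
   [n] costs [3 * e N <= d] and restores the exact rate [e n]. *)
have [|N HN] := He (d / 3); first by rewrite divr_gt0.
pose m := maxn N n.
have := nrm_triangle ((a +i* b)%C : R[i]^o) (u N) (u m).
have := nrm_triangle ((a +i* b)%C : R[i]^o) (u m) (u n).
have := Hu _ _ (leq_maxl N n); have := Hu _ _ (leq_maxr N n); rewrite -/m.
have := nrm_le ((a +i* b)%C - u N); rewrite (nrmB (u N)).
have := Ha N; have := Hb N.
by case: (u N) => x y /=; lra.
Qed.

Lemma nrm_small_rate V (x y : V) (K : R) (e : nat -> R) :
  (forall d : R, 0 < d -> exists N, e N <= d) -> 0 <= K ->
  (forall n, nrm (x - y) <= K * e n) -> x = y.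
Proof.
move=> He K0 Hxy; apply: nrm_small => d d0.
have K1 : 0 < K + 1 by rewrite ltr_wpDl.
have [|N HN] := He (d / (K + 1)); first by rewrite divr_gt0.
have [eN0|eN0] := leP 0 (e N); last first.
  by apply: le_trans (Hxy N) _; apply: le_trans (ltW d0); rewrite mulr_ge0_le0// ltW.
apply: le_trans (Hxy N) _.
move: HN; rewrite ler_pdivlMr// mulrDr mulr1 mulrC; lra.
Qed.

End Norm.

(** * C*-algebras and square roots *)

Section CStarBasics.
Context {R : realType} {A : cstarAlgType R}.
Implicit Types (x y z : A) (k : R[i]).

Lemma cmulDl x y z : (x + y) ** z = x ** z + y ** z.
Proof. by have := cmulPl 1 x y z; rewrite !scale1r. Qed.

Lemma cmulDr x y z : x ** (y + z) = x ** y + x ** z.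
Proof. by have := cmulPr 1 x y z; rewrite !scale1r. Qed.

Lemma cmul0l x : 0 ** x = 0.
Proof. by apply: (@addrI _ (0 ** x)); rewrite -cmulDl !addr0. Qed.

Lemma cmul0r x : x ** 0 = 0.
Proof. by apply: (@addrI _ (x ** 0)); rewrite -cmulDr !addr0. Qed.

Lemma cmulZl k x y : (k *: x) ** y = k *: (x ** y).
Proof. by rewrite -[k *: x]addr0 cmulPl cmul0l addr0. Qed.

Lemma cmulZr k x y : x ** (k *: y) = k *: (x ** y).
Proof. by rewrite -[k *: y]addr0 cmulPr cmul0r addr0. Qed.

Lemma cmulNl x y : (- x) ** y = - (x ** y).
Proof. by rewrite -scaleN1r cmulZl scaleN1r. Qed.

Lemma cmulNr x y : x ** (- y) = - (x ** y).
Proof. by rewrite -scaleN1r cmulZr scaleN1r. Qed.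

Lemma cmulBl x y z : (x - y) ** z = x ** z - y ** z.
Proof. by rewrite cmulDl cmulNl. Qed.

Lemma cmulBr x y z : x ** (y - z) = x ** y - x ** z.
Proof. by rewrite cmulDr cmulNr. Qed.

Lemma cmulMnl x y n : (x *+ n) ** y = (x ** y) *+ n.
Proof. by elim: n => [|n IHn]; rewrite ?mulr0n ?cmul0l// !mulrS cmulDl IHn. Qed.

Lemma cmulMnr x y n : x ** (y *+ n) = (x ** y) *+ n.
Proof. by elim: n => [|n IHn]; rewrite ?mulr0n ?cmul0r// !mulrS cmulDr IHn. Qed.

Lemma starD x y : star (x + y) = star x + star y.
Proof. by have := starP 1 x y; rewrite !scale1r rmorph1 scale1r. Qed.

Lemma star0 : star (0 : A) = 0.
Proof. by apply: (@addrI _ (star 0)); rewrite -starD !addr0. Qed.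

Lemma starZ k x : star (k *: x) = k^* *: star x.
Proof. by rewrite -[k *: x]addr0 starP star0 addr0. Qed.

Lemma starN x : star (- x) = - star x.
Proof. by apply/eqP; rewrite -addr_eq0 -starD addNr star0. Qed.

Lemma starB x y : star (x - y) = star x - star y.
Proof. by rewrite starD starN. Qed.

Lemma starMn x n : star (x *+ n) = star x *+ n.
Proof. by elim: n => [|n IHn]; rewrite ?mulr0n ?star0// !mulrS starD IHn. Qed.

Lemma nrmM x y : nrm (x ** y) <= nrm x * nrm y.
Proof. by rewrite -lecR rmorphM/= -!nrmE cnormM. Qed.

Lemma nrm_star x : nrm (star x) = nrm x.
Proof. by rewrite /nrm norm_star. Qed.

Lemma nrm_cstar x : nrm (star x ** x) = nrm x ^+ 2.
Proof. by apply/complexI; rewrite rmorphXn/= -!nrmE cstar_identity. Qed.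

Lemma nrm_cstar' x : nrm (x ** star x) = nrm x ^+ 2.
Proof. by have := nrm_cstar (star x); rewrite starK nrm_star. Qed.

Lemma cstar_eq0 x : star x ** x = 0 -> x = 0.
Proof.
move=> x0; apply: nrm_eq0; apply/eqP; rewrite -[_ == _]orbb -mulf_eq0 -expr2.
by rewrite -nrm_cstar x0 nrm0.
Qed.

Lemma cmul_lreg x y : (forall z, z ** x = z ** y) -> x = y.
Proof.
move=> H; apply/eqP; rewrite -subr_eq0; apply/eqP/cstar_eq0.
by rewrite cmulBr H subrr.
Qed.

Definition self_adjoint x := star x = x.

End CStarBasics.

Ltac cexpand :=
  rewrite ?(cmulDl, cmulDr, cmulNl, cmulNr, cmulZl, cmulZr, cmulMnl, cmulMnr,
            cmul0l, cmul0r, starD, starN, starZ, starMn, starM, starK, star0,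
            cmulA).

Section SquareRoot.
Context {R : realType} {A : cstarAlgType R}.
Implicit Types x y z : A.

(** Fixed-point iteration for [2r - r^2 = x], that is [(1 - r)^2 = 1 - x]. Working with [r] in place
    of [1 - r] avoids a unit. *)
Fixpoint sqrt_seq (x : A) n : A :=
  if n is m.+1 then 2^-1 *: (x + sqrt_seq x m ** sqrt_seq x m) else 0.

(** The same iteration for the scalar [x = 1]: a bounded increasing majorant. *)
Fixpoint sqrt_bnd n : R :=
  if n is m.+1 then (1 + sqrt_bnd m ^+ 2) / 2 else 0.

Lemma sqrt_bnd_ge0 n : 0 <= sqrt_bnd n <= 1.
Proof. by elim: n => [|n /andP[]] /=; rewrite ?lexx ?ler01//; nra. Qed.

Lemma sqrt_bnd_homo n m : (n <= m)%N -> sqrt_bnd n <= sqrt_bnd m.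
Proof.
apply: (@homo_leq _ _ (fun a b => a <= b)) => //.
  by move=> a b c; exact: le_trans.
elim=> [|k IHk] /=; first by have := sqrt_bnd_ge0 1; move=> /andP[].
have /andP[] := sqrt_bnd_ge0 k; have /andP[] := sqrt_bnd_ge0 k.+1.
by move=> /=; nra.
Qed.

Lemma nrm_half (x : A) : nrm (2^-1 *: x) = nrm x / 2.
Proof.
rewrite nrmZ mulrC; congr (_ * _).
have -> : (2^-1 : R[i]) = (2^-1 : R)%:C by rewrite fmorphV rmorph_nat.
by rewrite nrm_real_ge0// invr_ge0.
Qed.

Lemma sqrt_seq_bnd x n : nrm x <= 1 -> nrm (sqrt_seq x n) <= sqrt_bnd n.
Proof.
move=> x1; elim: n => [|n IHn] /=; first by rewrite nrm0.
rewrite nrm_half ler_pM2r// (le_trans (nrmD _ _))// lerD//.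
by rewrite (le_trans (nrmM _ _))// expr2 ler_pM ?nrm_ge0.
Qed.

Lemma sqrt_seq_diff x n : nrm x <= 1 ->
  nrm (sqrt_seq x n.+1 - sqrt_seq x n) <= sqrt_bnd n.+1 - sqrt_bnd n.
Proof.
move=> x1; elim: n => [|n IHn].
  by rewrite /= !subr0 cmul0l addr0 nrm_half; lra.
set a := sqrt_seq x n.+1; set b := sqrt_seq x n.
(* The symmetrised factorisation of [a^2 - b^2] does not require [a] and [b] to commute. *)
have -> : sqrt_seq x n.+2 - a =
    2^-1 *: (2^-1 *: ((a - b) ** (a + b) + (a + b) ** (a - b))).
  have -> : sqrt_seq x n.+2 = 2^-1 *: (x + a ** a) by [].
  rewrite {3}/a /= -/b; cexpand; lmod_over R[i]; by field.
rewrite !nrm_half.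
have H0 : nrm ((a - b) ** (a + b) + (a + b) ** (a - b)) <=
    2 * (nrm (a - b) * nrm (a + b)).
  apply: le_trans (nrmD _ _) _.
  by have := nrmM (a - b) (a + b); have := nrmM (a + b) (a - b); nra.
have ab : nrm (a + b) <= sqrt_bnd n.+1 + sqrt_bnd n.
  by rewrite (le_trans (nrmD _ _))// lerD// sqrt_seq_bnd.
have H1 : nrm (a - b) * nrm (a + b) <=
    (sqrt_bnd n.+1 - sqrt_bnd n) * (sqrt_bnd n.+1 + sqrt_bnd n).
  by rewrite ler_pM ?nrm_ge0.
have e1 : sqrt_bnd n.+1 = (1 + sqrt_bnd n ^+ 2) / 2 by [].
have -> : sqrt_bnd n.+2 = (1 + sqrt_bnd n.+1 ^+ 2) / 2 by [].
by move: H0 H1 e1; move: (sqrt_bnd n.+1) (sqrt_bnd n) => u v; lra.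
Qed.

Lemma sqrt_seq_cauchy x n m : nrm x <= 1 -> (n <= m)%N ->
  nrm (sqrt_seq x m - sqrt_seq x n) <= sqrt_bnd m - sqrt_bnd n.
Proof.
move=> x1 /subnK<-; elim: (m - n)%N => [|k IHk].
  by rewrite add0n !subrr nrm0.
apply: le_trans (nrm_triangle _ (sqrt_seq x (k + n)) _) _.
have := sqrt_seq_diff (k + n) x1; rewrite !addSn; lra.
Qed.

(** The increments are dominated by those of the scalar majorant, so the iteration converges with
    rate [sup S - sqrt_bnd n]. Self-adjointness and commutation hold for each iterate and pass to
    the limit. *)
Lemma exists_one_sub_sqrt x : self_adjoint x -> nrm x <= 1 ->
  exists r, [/\ self_adjoint r, nrm r <= 1, r *+ 2 - r ** r = x
    & forall y, y ** x = x ** y -> y ** r = r ** y].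
Proof.
move=> xsa x1; pose S := [set sqrt_bnd n | n in [set: nat]].
have supS : has_sup S.
  split; first by exists (sqrt_bnd 0), 0%N.
  by exists 1 => _ [n _ <-]; have /andP[] := sqrt_bnd_ge0 n.
pose e n := sup S - sqrt_bnd n.
have He d : 0 < d -> exists N, e N <= d.
  move=> d0; have [_ [N _ <-] HN] := sup_adherent d0 supS.
  by exists N; rewrite /e; lra.
have le_sup n : sqrt_bnd n <= sup S.
  by apply: ub_le_sup; [have [] := supS|exists n].
have [n m nm|r Hr] := @cauchy_rate R A (sqrt_seq x) e _ He.
  by apply: le_trans (sqrt_seq_cauchy x1 nm) _; rewrite lerD2r le_sup.
have {}Hr n : nrm (r - sqrt_seq x n) <= e n by exact: Hr.
have sup1 : sup S <= 1.
  by apply: ge_sup; [have [] := supS|move=> _ [n _ <-]; have /andP[] := sqrt_bnd_ge0 n].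
have e0 n : 0 <= e n by rewrite subr_ge0.
have e1 n : e n <= 1 by have /andP[] := sqrt_bnd_ge0 n; rewrite /e; lra.
have s1 n : nrm (sqrt_seq x n) <= 1.
  by apply: le_trans (sqrt_seq_bnd n x1) _; have /andP[] := sqrt_bnd_ge0 n.
have ssa n : self_adjoint (sqrt_seq x n).
  rewrite /self_adjoint; elim: n => [|n IHn] /=; first by rewrite star0.
  rewrite starZ starD starM IHn xsa; congr (_ *: _).
  by rewrite fmorphV rmorph_nat.
have r1 : nrm r <= 1.
  apply/ler_addgt0Pl => d d0; have [N HN] := He _ d0.
  have := nrm_triangle r (sqrt_seq x N) 0; rewrite !subr0.
  by have := Hr N; have := s1 N; lra.
exists r; split => //.
- apply: (nrm_small_rate He (ler0n _ 2)) => n.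
  apply: le_trans (nrm_triangle _ (sqrt_seq x n) _) _.
  rewrite -{1}(ssa n) -starB nrm_star (nrmB (sqrt_seq x n)).
  by have := Hr n; lra.
- apply: (nrm_small_rate He (ler0n _ 6)) => n.
  have -> : r *+ 2 - r ** r - x =
    (r - sqrt_seq x n.+1) *+ 2 - r ** (r - sqrt_seq x n)
     - (r - sqrt_seq x n) ** sqrt_seq x n.
    rewrite /=; cexpand; lmod_over R[i]; by field.
  have := nrmD ((r - sqrt_seq x n.+1) *+ 2 - r ** (r - sqrt_seq x n))
    (- ((r - sqrt_seq x n) ** sqrt_seq x n)).
  have := nrmD ((r - sqrt_seq x n.+1) *+ 2) (- (r ** (r - sqrt_seq x n))).
  have := nrmD (r - sqrt_seq x n.+1) (r - sqrt_seq x n.+1).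
  rewrite !nrmN -mulr2n.
  have := nrmM r (r - sqrt_seq x n); have := nrmM (r - sqrt_seq x n) (sqrt_seq x n).
  have e2 : e n.+1 <= e n.
    by rewrite /e lerD2l lerN2 sqrt_bnd_homo.
  have := Hr n; have := Hr n.+1; have := s1 n; have := e0 n.
  have := nrm_ge0 (r - sqrt_seq x n); have := nrm_ge0 (sqrt_seq x n); have := nrm_ge0 r; nra.
- move=> y yx; apply: (nrm_small_rate He (K := 2 * nrm y)) => [|n].
    by rewrite mulr_ge0 ?nrm_ge0.
  have ys : y ** sqrt_seq x n = sqrt_seq x n ** y.
    elim: n => [|n IHn] /=; first by rewrite cmul0l cmul0r.
    by rewrite cmulZr cmulZl cmulDr cmulDl yx cmulA IHn -cmulA IHn cmulA.
  have -> : y ** r - r ** y = y ** (r - sqrt_seq x n) - (r - sqrt_seq x n) ** y.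
    by cexpand; rewrite ys; lmod_over R[i]; by ring.
  have := nrmD (y ** (r - sqrt_seq x n)) (- ((r - sqrt_seq x n) ** y)).
  rewrite nrmN.
  have := nrmM y (r - sqrt_seq x n); have := nrmM (r - sqrt_seq x n) y.
  have := Hr n; have := nrm_ge0 y; nra.
Qed.

End SquareRoot.

Section Unitaries.
Context {R : realType} {A : cstarAlgType R}.
Implicit Types x y z q : A.

(* Both conditions say that [1 + q] is unitary in the unitization. *)
Definition unitary_shift q :=
  q + star q + star q ** q = 0 /\ q + star q + q ** star q = 0.

Lemma conj_i : ('i : R[i])^* = - 'i.
Proof. exact: conjCi. Qed.

Lemma mulii : ('i : R[i]) * 'i = -1.
Proof. by rewrite -expr2 sqrCi. Qed.

Lemma exists_unitary_shift x : self_adjoint x -> nrm x <= 1 ->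
  exists q, unitary_shift q /\ star q - q = ('i *+ 2) *: x.
Proof.
move=> xsa x1; have [||r [rsa r1 rx comm]] := @exists_one_sub_sqrt _ _ (x ** x).
- by rewrite /self_adjoint starM xsa.
- by apply: le_trans (nrmM _ _) _; have := nrm_ge0 x; nra.
have xr : x ** r = r ** x by apply: comm; rewrite !cmulA.
(* Here [1 - r] is a square root of [1 - x^2] commuting with [x], and [1 + q = (1 - r) - ix]. *)
exists (- r - 'i *: x); split; [split|]; cexpand; rewrite rsa xsa conj_i ?xr ?scalerA
  ?mulrN ?mulNr ?mulii -?rx ?opprK; lmod_over R[i]; by ring: mulii.
Qed.

Lemma unitary_shift_star q : unitary_shift q -> unitary_shift (star q).
Proof. by move=> [q1 q2]; split; rewrite starK [star q + q]addrC. Qed.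

End Unitaries.

Lemma nrm_muln2 (R : realType) (V : normedModType R[i]) (x : V) :
  nrm (x *+ 2) = 2 * nrm x.
Proof.
rewrite -scaler_nat nrmZ; congr (_ * _).
by rewrite -(rmorph_nat (real_complex R)) (nrm_real_ge0 (ler0n _ 2)).
Qed.

Lemma nrm_2i (R : realType) (V : normedModType R[i]) (x : V) :
  nrm (('i *+ 2) *: x) = 2 * nrm x.
Proof. by rewrite -scalerMnl nrm_muln2 nrmZ nrmi mul1r. Qed.

(** * Contractivity of representations by adjointable maps *)

Section Representation.
Context {R : realType} {A B : cstarAlgType R} (L : A -> B -> B).
Hypothesis L_linear : forall k x y z, L (k *: x + y) z = k *: L x z + L y z.
Hypothesis L_mul : forall x y z, L (x ** y) z = L x (L y z).
Hypothesis L_star : forall x y z, star (L x y) ** z = star y ** L (star x) z.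

Let LD x y z : L (x + y) z = L x z + L y z.
Proof. by have := L_linear 1 x y z; rewrite !scale1r. Qed.

Let L0 z : L 0 z = 0.
Proof. by apply: (@addrI _ (L 0 z)); rewrite -LD !addr0. Qed.

Let LZ k x z : L (k *: x) z = k *: L x z.
Proof. by rewrite -[k *: x]addr0 L_linear L0 addr0. Qed.

Lemma rep_unitary q z : unitary_shift q -> nrm (z + L q z) = nrm z.
Proof.
move=> [q1 _]; apply/eqP; rewrite -(@eqrXn2 _ 2) ?nrm_ge0// -!nrm_cstar.
have -> : star (z + L q z) ** (z + L q z) =
    star z ** z + star z ** L (q + star q + star q ** q) z.
  by rewrite !LD L_mul; cexpand; rewrite !L_star; cexpand;
    lmod_over R[i]; by ring.
by rewrite q1 L0 cmul0r addr0.
Qed.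

(** For [x] self-adjoint of norm at most 1, [2i L x] is a difference of two isometries [z + L q z];
    scaling gives all self-adjoint [x]. The general case is [star (L a z) ** L a z = star z ** L
    (star a ** a) z]. *)
Lemma rep_contractive a z : nrm (L a z) <= nrm a * nrm z.
Proof.
have sa1 x : self_adjoint x -> nrm x <= 1 -> nrm (L x z) <= nrm z.
  move=> xsa x1; have [q [uq qx]] := exists_unitary_shift xsa x1.
  have := nrm_2i (L x z); rewrite -LZ -qx LD -scaleN1r LZ scaleN1r.
  have -> : L (star q) z - L q z = (z + L (star q) z) - (z + L q z).
    by lmod_over R[i]; by ring.
  move=> E; have := nrmD (z + L (star q) z) (- (z + L q z)).
  rewrite E nrmN !rep_unitary//; first by lra.
  exact: unitary_shift_star.
have sa x : self_adjoint x -> nrm (L x z) <= nrm x * nrm z.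
  move=> xsa; have [x0|x0] := eqVneq (nrm x) 0.
    by rewrite (nrm_eq0 x0) L0 !nrm0 mul0r.
  have xp : 0 < nrm x by rewrite lt_neqAle eq_sym x0 nrm_ge0.
  pose y := (nrm x)^-1%:C *: x.
  have xE : x = (nrm x)%:C *: y.
    by rewrite scalerA -rmorphM/= divff ?rmorph1 ?scale1r.
  rewrite {1}xE LZ nrmZ nrm_real_ge0 ?nrm_ge0// ler_wpM2l ?nrm_ge0//; apply: sa1.
    by rewrite /self_adjoint starZ xsa; congr (_ *: _); exact: conj_real.
  by rewrite nrmZ nrm_real_ge0 ?invr_ge0 ?nrm_ge0// mulVf.
have H : nrm (L a z) ^+ 2 <= (nrm a * nrm z) ^+ 2.
  rewrite -nrm_cstar L_star -L_mul (le_trans (nrmM _ _))// nrm_star.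
  have := sa (star a ** a); rewrite /self_adjoint starM starK nrm_cstar.
  by move=> /(_ erefl); have := nrm_ge0 z; nra.
by rewrite -(@ler_pXn2r _ 2) ?nnegrE// ?mulr_ge0 ?nrm_ge0.
Qed.

End Representation.

Lemma star_hom_contractive (R : realType) (A B : cstarAlgType R) (f : A -> B) a :
  star_hom f -> nrm (f a) <= nrm a.
Proof.
move=> [fl fM fs]; have [->|fa0] := eqVneq (nrm (f a)) 0; first exact: nrm_ge0.
(* Evaluated at [star (f a)], the C*-identity turns the operator bound into a bound on
   [nrm (f a)]. *)
have := @rep_contractive _ _ _ (fun x z => f x ** z) _ _ _ a (star (f a)).
rewrite nrm_cstar' nrm_star expr2 ler_pM2r ?lt_neqAle ?nrm_ge0 ?andbT 1?eq_sym//.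
apply => [k x y z|x y z|x y z].
- by rewrite fl; cexpand.
- by rewrite fM cmulA.
- by rewrite starM fs cmulA.
Qed.

Lemma mult_star_hom_contractive (R : realType) (A B : cstarAlgType R)
    (D : A -> mult B) a z : mult_star_hom D ->
  nrm (lmult (D a) z) <= nrm a * nrm z /\ nrm (rmult (D a) z) <= nrm a * nrm z.
Proof.
move=> [Dl DM Ds].
have Hl x y : nrm (lmult (D x) y) <= nrm x * nrm y.
  refine (@rep_contractive _ _ _ (fun x z => lmult (D x) z) _ _ _ x y).
  - by move=> k u v w; rewrite (Dl k u v).1.
  - by move=> u v w; rewrite (DM u v).1.
  move=> u v w; by rewrite (Ds u).1/= -starM -multP starM starK.
split=> //; have := Hl (star a) (star z).
by rewrite (Ds a).1/= !nrm_star starK.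
Qed.

Section NormOfCommutingSquares.
Context {R : realType} {A : cstarAlgType R}.

(* [a + i s] is [k] times a unitary, and [a] is its real part. *)
Lemma commuting_squares_bound (a s : A) (k : R) : self_adjoint a ->
  self_adjoint s -> 0 <= k -> a ** s = s ** a ->
  (forall z, a ** a ** z + s ** s ** z = (k ^+ 2)%:C *: z) -> nrm a <= k.
Proof.
move=> asa ssa k0 comm H.
have U z (c : R[i]) : c^* = - c -> c * c = -1 ->
    nrm (a ** z + c *: (s ** z)) <= k * nrm z.
  move=> cc c2; set w := _ + _.
  have E : star w ** w = (k ^+ 2)%:C *: (star z ** z).
    rewrite -cmulZr -H /w; cexpand; rewrite asa ssa cc scalerA ?mulNr ?mulrN c2.
    rewrite -[star z ** a ** s]cmulA comm; cexpand; lmod_over R[i]; by ring.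
  have : nrm w ^+ 2 <= (k * nrm z) ^+ 2.
    rewrite -nrm_cstar E nrmZ nrm_real_ge0 ?exprn_ge0// nrm_cstar exprMn.
    exact: lexx.
  by rewrite ler_pXn2r ?nnegrE// ?mulr_ge0 ?nrm_ge0.
have Ha z : nrm (a ** z) <= k * nrm z.
  have := U z 'i (conj_i) mulii.
  have := U z (- 'i); rewrite rmorphN/= conj_i mulrNN => /(_ erefl mulii).
  move=> H1 H2.
  have : nrm ((a ** z) *+ 2) = 2 * nrm (a ** z).
    exact: nrm_muln2.
  have -> : (a ** z) *+ 2 = (a ** z + - 'i *: (s ** z)) + (a ** z + 'i *: (s ** z)).
    by lmod_over R[i]; by ring.
  by have := nrmD (a ** z + - 'i *: (s ** z)) (a ** z + 'i *: (s ** z)); lra.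
have := Ha (star a); rewrite nrm_cstar' nrm_star expr2.
by have [->//|a0] := eqVneq (nrm a) 0;
  rewrite ler_pM2r// lt_neqAle eq_sym a0 nrm_ge0.
Qed.

End NormOfCommutingSquares.

(** * Approximate units *)

Section ApproximateUnit.
Context {R : realType} {A : cstarAlgType R}.
Implicit Types x y z e q : A.

(** This is [U^n - 1] for [U = 1 + q], a form that makes sense without a unit. *)
Fixpoint shift_pow q n : A :=
  if n is m.+1 then q + shift_pow q m + shift_pow q m ** q else 0.

(** The sum of [U^k - 1] over [k < n]; thus [z *+ n + shift_sum q n ** z] is [n] times the Cesaro
    mean of the powers of [U], applied to [z]. *)
Fixpoint shift_sum q n : A :=
  if n is m.+1 then shift_sum q m + shift_pow q m else 0.

Lemma nrm_unitary_shift q z : unitary_shift q -> nrm (z + q ** z) = nrm z.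
Proof.
move=> uq; refine (@rep_unitary _ _ _ (fun x y => x ** y) _ _ _ q z uq).
- by move=> k x y w; rewrite cmulPl.
- by move=> x y w; rewrite cmulA.
- by move=> x y w; rewrite starM -cmulA.
Qed.

Lemma nrm_shift_pow q n z : unitary_shift q ->
  nrm (z + shift_pow q n ** z) = nrm z.
Proof.
move=> uq; elim: n z => [|n IHn] z /=; first by rewrite cmul0l addr0.
rewrite -(nrm_unitary_shift z uq) -[RHS]IHn; congr nrm.
by cexpand; lmod_over R[i]; by ring.
Qed.

Lemma nrm_shift_sum q n z : unitary_shift q ->
  nrm (z *+ n + shift_sum q n ** z) <= n%:R * nrm z.
Proof.
move=> uq; elim: n => [|n IHn] /=; first by rewrite cmul0l mulr0n addr0 nrm0 mul0r.
have -> : z *+ n.+1 + (shift_sum q n + shift_pow q n) ** z =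
    (z *+ n + shift_sum q n ** z) + (z + shift_pow q n ** z).
  by rewrite mulrS; cexpand; lmod_over R[i]; by ring.
rewrite (le_trans (nrmD _ _))// -natr1 mulrDl mul1r lerD//.
by rewrite nrm_shift_pow.
Qed.

(** Geometric sum: the sum of [U^k] over [k < n], times [U - 1], is [U^n - 1]. The next telescoping
    identity does the same with [star U - 1]. *)
Lemma shift_sum_mul q n : q *+ n + shift_sum q n ** q = shift_pow q n.
Proof.
elim: n => [|n IHn] /=; first by rewrite cmul0l addr0.
by rewrite -IHn mulrS; cexpand; lmod_over R[i]; by ring.
Qed.

Lemma shift_sum_star q n : unitary_shift q ->
  star q *+ n.+1 + shift_sum q n.+1 ** star q = star q - shift_pow q n.
Proof.
move=> [_ q2]; have qq : q ** star q = - q - star q.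
  by apply/eqP; rewrite -opprD -addr_eq0 addrC q2.
elim: n => [|n IHn].
  by rewrite /= add0r cmul0l mulr1n addr0 subr0.
have -> : star q *+ n.+2 + shift_sum q n.+2 ** star q =
    (star q *+ n.+1 + shift_sum q n.+1 ** star q) +
    (star q + shift_pow q n.+1 ** star q).
  have -> : shift_sum q n.+2 = shift_sum q n.+1 + shift_pow q n.+1 by [].
  by rewrite cmulDl [in LHS]mulrS; lmod_over R[i]; by ring.
rewrite IHn /=; cexpand; rewrite -cmulA qq; cexpand.
by lmod_over R[i]; by ring.
Qed.

Lemma nrm_shift_le2 q : (forall z, nrm (z + q ** z) <= nrm z) -> nrm q <= 2.
Proof.
move=> /(_ (star q)) H; have [->|q0] := eqVneq (nrm q) 0; first by [].
rewrite -(@ler_pM2r _ (nrm q)) ?lt_neqAle ?nrm_ge0 ?andbT 1?eq_sym//.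
rewrite -expr2 -nrm_cstar'; move: H; rewrite nrm_star => H.
have := nrm_triangle (q ** star q) (- star q) 0; rewrite !subr0 opprK nrmN.
by rewrite nrm_star addrC [_ + star q]addrC; lra.
Qed.

Definition left_contraction e := forall z, nrm (z - e ** z) <= nrm z.
Definition right_contraction e := forall z, nrm (z - z ** e) <= nrm z.

(* The unitary [U = 1 + q] satisfies [U^* - U = 2ix] with [x] a multiple of
   [b b^*], and the Cesaro means of its powers are contractions [1 - e] for which
   [(1 - e)(U^* - U)] telescopes. *)
Lemma left_approximate_unit1 b (d : R) : 0 < d ->
  exists e, left_contraction e /\ nrm (b - e ** b) <= d.
Proof.
move=> d0; pose K : R := nrm b ^+ 2 + 1.
have K0 : 0 < K by rewrite ltr_wpDl// sqr_ge0.
have Ki0 : 0 <= K^-1 by rewrite invr_ge0 ltW.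
pose x := K^-1%:C *: (b ** star b).
have xsa : self_adjoint x.
  rewrite /self_adjoint starZ starM starK; congr (_ *: _); exact: conj_real.
have x1 : nrm x <= 1.
  rewrite nrmZr// nrm_cstar' mulrC ler_pdivrMr//.
  by rewrite mul1r lerDl.
have [q [uq qx]] := exists_unitary_shift xsa x1.
(* Chosen so that [3 * K / n <= d ^+ 2], where [3 * K / n] will bound [(1 - e) b (star b)]. *)
pose N := Num.truncn (3 * K / d ^+ 2); pose n : R := N.+1%:R.
have n0 : 0 < n by rewrite ltr0n.
have ni0 : 0 <= n^-1 by rewrite invr_ge0 ltW.
have Nd : 3 * K / n <= d ^+ 2.
  rewrite ler_pdivrMr// [X in _ <= X]mulrC -ler_pdivrMr ?exprn_gt0//.
  exact: ltW (truncnS_gt _).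
pose e := - (n^-1%:C *: shift_sum q N.+1).
have eE z : z - e ** z = n^-1%:C *: (z *+ N.+1 + shift_sum q N.+1 ** z).
  rewrite /e cmulNl opprK cmulZl scalerDr -[z *+ _]scaler_nat scalerA.
  by rewrite -(rmorph_nat (real_complex R)) -rmorphM/= mulVf ?gt_eqF// scale1r.
have ec : left_contraction e.
  move=> z; rewrite eE nrmZr//.
  by rewrite mulrC ler_pdivrMr// mulrC nrm_shift_sum.
exists e; split=> //.
have pow2 m : nrm (shift_pow q m) <= 2.
  by apply: nrm_shift_le2 => z; rewrite nrm_shift_pow.
(* After telescoping, three terms of norm at most 2 remain; the factor [2i] halves their sum to
   3. *)
have ex : nrm (x - e ** x) <= 3 / n.
  rewrite eE nrmZr// mulrC ler_pM2r ?invr_gt0//.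
  have := nrm_2i (x *+ N.+1 + shift_sum q N.+1 ** x).
  have -> : ('i *+ 2) *: (x *+ N.+1 + shift_sum q N.+1 ** x) =
      (star q *+ N.+1 + shift_sum q N.+1 ** star q) -
      (q *+ N.+1 + shift_sum q N.+1 ** q).
    rewrite scalerDr -cmulZr -scalerMnr -qx cmulBr mulrnBl.
    by rewrite opprD addrACA.
  rewrite shift_sum_star// shift_sum_mul => E.
  have := nrmD (star q - shift_pow q N) (- shift_pow q N.+1).
  have := nrmD (star q) (- shift_pow q N).
  have q2 : nrm q <= 2 by apply: nrm_shift_le2 => z; rewrite nrm_unitary_shift.
  by rewrite E !nrmN nrm_star; have := pow2 N; have := pow2 N.+1; lra.
have K_C : (K%:C : R[i]) *: x = b ** star b.
  by rewrite /x scalerA -rmorphM/= divff ?gt_eqF// rmorph1 scale1r.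
pose w := b ** star b - e ** (b ** star b).
have wE : nrm w <= 3 * K / n.
  rewrite /w -K_C cmulZr -scalerBr (nrmZr _ (ltW K0)).
  by rewrite -mulrA mulrCA ler_pM2l// mulrC.
have : nrm (b - e ** b) ^+ 2 <= d ^+ 2.
  rewrite -nrm_cstar'; apply: le_trans Nd; apply: le_trans wE.
  (* With [w = (1 - e) b (star b)] this is the adjoint of [(1 - e) (star w)], and [1 - e] is a
     contraction. *)
  have -> : (b - e ** b) ** star (b - e ** b) = star (star w - e ** star w).
    by rewrite /w; cexpand; lmod_over R[i]; by ring.
  by rewrite nrm_star (le_trans (ec _))// nrm_star.
by rewrite ler_pXn2r ?nnegrE ?nrm_ge0// ltW.
Qed.

(** For [w = star (z - z ** e)] one has [star w ** w = z ** (w - e ** w)], whose norm is at most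
    [nrm z * nrm w]. *)
Lemma left_contraction_right e : left_contraction e -> right_contraction e.
Proof.
move=> ec z; pose w := star (z - z ** e).
have H : nrm w ^+ 2 <= nrm z * nrm w.
  rewrite -nrm_cstar /w starK cmulBl -cmulA -cmulBr.
  by rewrite (le_trans (nrmM _ _))// ler_wpM2l ?nrm_ge0.
rewrite -nrm_star -/w; have [->|w0] := eqVneq (nrm w) 0; first exact: nrm_ge0.
rewrite -(@ler_pM2r _ (nrm w)) ?lt_neqAle ?nrm_ge0 ?andbT 1?eq_sym//.
Qed.

Lemma left_contraction_star e : left_contraction e -> left_contraction (star e).
Proof.
move=> /left_contraction_right ec z; rewrite -(starK z) -starM -starB !nrm_star.
by rewrite (le_trans (ec _))// nrm_star.
Qed.

Lemma left_contraction_comp e1 e2 : left_contraction e1 -> left_contraction e2 ->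
  left_contraction (e1 + e2 - e2 ** e1).
Proof.
move=> H1 H2 z; apply: le_trans (H1 z); apply: le_trans (H2 _).
by have -> : z - (e1 + e2 - e2 ** e1) ** z = z - e1 ** z - e2 ** (z - e1 ** z);
  [cexpand; lmod_over R[i]; by ring|exact: lexx].
Qed.

(** Induction on the list: [e2] handles the residue [b - e1 ** b], and [1 - e = (1 - e2) (1 - e1)]
    keeps the earlier bounds because [1 - e2] is a contraction. *)
Lemma left_approximate_unit (s : seq A) (d : R) : 0 < d ->
  exists2 e, left_contraction e & forall b, b \in s -> nrm (b - e ** b) <= d.
Proof.
move=> d0; elim: s => [|b s [e1 c1 H1]].
  by exists 0 => // z; rewrite cmul0l subr0.
have [e2 [c2 H2]] := left_approximate_unit1 (b - e1 ** b) d0.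
have E c : c - (e1 + e2 - e2 ** e1) ** c = c - e1 ** c - e2 ** (c - e1 ** c).
  by cexpand; lmod_over R[i]; by ring.
exists (e1 + e2 - e2 ** e1); first exact: left_contraction_comp.
move=> c; rewrite inE E => /predU1P[->//|cs].
by apply: le_trans (c2 _) _; exact: H1.
Qed.

(** In [1 - e = (1 - star e2) (1 - e1)] the factor [1 - e1] is small on [s] from the left and
    [1 - star e2] is small on [t] from the right; the other factor is each time a contraction. *)
Lemma approximate_unit (s t : seq A) (d : R) : 0 < d -> exists e,
  (forall b, b \in s -> nrm (b - e ** b) <= d) /\
  (forall b, b \in t -> nrm (b - b ** e) <= d).
Proof.
move=> d0; have [e1 c1 H1] := left_approximate_unit s d0.
have [e2 c2 H2] := left_approximate_unit (map star t) d0.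
have c2' := left_contraction_star c2.
exists (e1 + star e2 - star e2 ** e1); split=> [b bs|b bt].
  have -> : b - (e1 + star e2 - star e2 ** e1) ** b =
      b - e1 ** b - star e2 ** (b - e1 ** b).
    by cexpand; lmod_over R[i]; by ring.
  by apply: le_trans (c2' _) _; exact: H1.
have -> : b - b ** (e1 + star e2 - star e2 ** e1) =
    b - b ** star e2 - (b - b ** star e2) ** e1.
  by cexpand; lmod_over R[i]; by ring.
apply: le_trans (left_contraction_right c1 _) _.
rewrite -nrm_star starB starM starK; apply: H2.
by rewrite map_f.
Qed.

Lemma cmul_rreg (x y : A) : (forall z, x ** z = y ** z) -> x = y.
Proof.
move=> H; apply: (can_inj starK); apply: cmul_lreg => z.
by rewrite -[z]starK -!starM H.
Qed.

(** Strict density of [A] in its multipliers. The witness is [rmult m e]: one has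
    [rmult m e ** b = e ** lmult m b] and [b ** rmult m e = rmult m (b ** e)], so [e] must be a left
    unit near the [lmult m b] and a right unit near the [b]. *)
Lemma strict_approximation (m : mult A) (C : R) :
  (forall z, nrm (rmult m z) <= C * nrm z) ->
  forall (s : seq A) (d : R), 0 < d -> exists x, forall b, b \in s ->
    nrm (lmult m b - x ** b) < d /\ nrm (rmult m b - b ** x) < d.
Proof.
move=> mC s d d0; pose K := `|C| + 1.
have K0 : 0 < K by rewrite ltr_wpDl.
have KC : C <= K by rewrite /K; have := ler_norm C; lra.
have K1 : 1 <= K by rewrite /K; have := normr_ge0 C; lra.
pose d' := d / 2 / K; have d'0 : 0 < d' by rewrite !divr_gt0.
have d'E : K * d' = d / 2 by rewrite /d' mulrC divfK ?gt_eqF.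
have [e [H1 H2]] := approximate_unit (map (lmult m) s) s d'0.
exists (rmult m e) => b bs; split.
  rewrite -multP; apply: le_lt_trans (H1 _ _) _; first exact: map_f.
  by move: d'E; nra.
have -> : rmult m b - b ** rmult m e = rmult m (b - b ** e).
  apply: cmul_rreg => z; rewrite cmulBl -cmulA -!multP cmulA.
  by rewrite cmulBl.
apply: le_lt_trans (mC _) _; have := H2 _ bs; have := nrm_ge0 (b - b ** e).
by move: d'E; nra.
Qed.

End ApproximateUnit.

(** * Positive functionals *)

Notation cabs z := (nrm (z : _[i]^o)).

Section Scalars.
Context {R : realType}.
Implicit Types (a b c : R[i]).

Lemma cabs_sqrE (b : R[i]) : cabs b ^+ 2 = complex.Re b ^+ 2 + complex.Im b ^+ 2.
Proof. by apply/complexI; rewrite add_Re2_Im2 rmorphXn/= -nrmE. Qed.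

(** The discriminant argument behind every Cauchy-Schwarz estimate below. That the values are real
    forces [b'] to be the conjugate of [b], so hermitian symmetry is a conclusion. *)
Lemma psd_quadratic_scalar (a b b' c : R[i]) : 0 <= a -> 0 <= c ->
  (forall k : R[i], 0 <= a + k * b + k^* * b' + k * k^* * c) ->
  b' = b^* /\ cabs b ^+ 2 <= complex.Re a * complex.Re c.
Proof.
move=> a0 c0 H; have ar := Re_ge0 a0; have cr := Re_ge0 c0.
have H' (x y : R) (k := x +i* y) :
    complex.Im (a + k * b + k^* * b' + k * k^* * c) = 0 /\
    0 <= complex.Re (a + k * b + k^* * b' + k * k^* * c).
  by have := H k; rewrite lecE => /andP[/eqP-> ->].
rewrite cabs_sqrE; move: H' ar cr; clear -R.
case: a b b' c => [a a'] [b1 b2] [d1 d2] [c c'] /= H ar cr.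
have h0 := H 0 0; have h1 := H 1 0; have h2 := H (-1) 0; have h3 := H 0 1.
have c'0 : c' = 0 by move: h0 h1 h2 => /=; lra.
have d2E : d2 = - b2 by move: h0 h1 h2 => /=; lra.
have d1E : d1 = b1 by move: h0 h3 => /=; lra.
split; first by rewrite d1E d2E.
pose D := b1 ^+ 2 + b2 ^+ 2; rewrite -/D.
have D0 : 0 <= D by rewrite addr_ge0 ?sqr_ge0.
(* The value at [k = - t b^*]. The best choice is [t = 1/c]; for [c = 0], a large [t] forces
   [D = 0]. *)
have K t : 0 <= a - 2 * t * D + t ^+ 2 * D * c.
  have [_] := H (- t * b1) (t * b2) => /=.
  rewrite d1E d2E c'0 /D => H3; apply: (le_trans H3).
  by rewrite le_eqVlt; apply/orP; left; apply/eqP; ring.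
have [c0|c0] := eqVneq c 0.
  rewrite c0 mulr0; have [->//|Dn0] := eqVneq D 0.
  have := K ((a + 1) / D); rewrite c0 mulr0 addr0 -mulrA divfK//; lra.
have cp : 0 < c by rewrite lt_neqAle eq_sym c0.
have := K c^-1.
have -> : a - 2 * c^-1 * D + c^-1 ^+ 2 * D * c = a - D / c by field.
by rewrite subr_ge0 ler_pdivrMr.
Qed.

Lemma ge0_approx (z : R[i]) :
  (forall d : R, 0 < d -> exists2 c : R[i], 0 <= c & cabs (z - c) <= d) -> 0 <= z.
Proof.
move=> H; have {}H d : 0 < d -> exists2 x : R, 0 <= x &
    (complex.Re z - x) ^+ 2 + complex.Im z ^+ 2 <= d ^+ 2.
  move=> d0; have [c c0 Hc] := H d d0; exists (complex.Re c); first exact: Re_ge0.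
  have : cabs (z - c) ^+ 2 <= d ^+ 2 by rewrite ler_pXn2r ?nnegrE ?nrm_ge0// ltW.
  by rewrite cabs_sqrE (ge0_ReE c0); case: (z) => x y /=; rewrite oppr0 addr0.
rewrite lecE/=; apply/andP; split.
  apply/negPn/negP => z0; have /H[x _] : 0 < `|complex.Im z| / 2.
    by rewrite divr_gt0// normr_gt0.
  have : 0 < `|complex.Im z| ^+ 2 by rewrite exprn_gt0// normr_gt0.
  by rewrite exprMn real_normK ?num_real//; have := sqr_ge0 (complex.Re z - x); nra.
rewrite leNgt; apply/negP => z0; have /H[x x0] : 0 < - complex.Re z / 2.
  by rewrite divr_gt0// oppr_gt0.
by have := sqr_ge0 (complex.Im z); nra.
Qed.

End Scalars.

(** * The GNS seminorm of a positive functional *)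

Section Functionals.
Context {R : realType} {A : cstarAlgType R}.
Implicit Types (f : dual A) (x y z : A).

Lemma dualD f x y : f (x + y) = (f x : R[i]) + f y.
Proof. exact: linearD. Qed.

Lemma dualZ f (k : R[i]) x : f (k *: x) = k * (f x : R[i]).
Proof. exact: linearZ. Qed.

Lemma dualN f x : f (- x) = - (f x : R[i]).
Proof. exact: linearN. Qed.

Lemma dualB f x y : f (x - y) = (f x : R[i]) - f y.
Proof. exact: linearB. Qed.

Lemma dual0 f : f 0 = 0 :> R[i].
Proof. exact: linear0. Qed.

Lemma dual_sum f (I : Type) (s : seq I) (F : I -> A) :
  f (\sum_(i <- s) F i) = \sum_(i <- s) (f (F i) : R[i]).
Proof. exact: linear_sum. Qed.

Lemma dual_nrm f x : cabs (f x) <= dual_norm f * nrm x.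
Proof. by rewrite -lecR rmorphM/= -!nrmE dual_norm_bound. Qed.

Definition l2 f x : R := Num.sqrt (complex.Re (f (star x ** x) : R[i])).

Lemma l2_ge0 f x : 0 <= l2 f x.
Proof. exact: sqrtr_ge0. Qed.

Context (f : dual A) (f_pos : positive_functional f).

Lemma l2_sqr x : f (star x ** x) = (l2 f x ^+ 2)%:C :> R[i].
Proof.
have := f_pos x => fx; rewrite /l2 sqr_sqrtr; last exact: Re_ge0.
exact: ge0_ReE.
Qed.

Lemma psd_form x y : f (star y ** x) = (f (star x ** y) : R[i])^* :> R[i] /\
  cabs (f (star x ** y)) <= l2 f x * l2 f y.
Proof.
have [||k|E1 E2] := @psd_quadratic_scalar _ (f (star x ** x)) (f (star x ** y))
    (f (star y ** x)) (f (star y ** y)).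
- exact: f_pos.
- exact: f_pos.
- have := f_pos (x + k *: y); cexpand; rewrite !dualD !dualZ.
  congr (_ <= _); rewrite !addrA mulrA [k * k^*]mulrC.
  by ring.
split=> //; move: E2; rewrite !l2_sqr /= -exprMn.
by rewrite ler_pXn2r// nnegrE ?mulr_ge0 ?l2_ge0 ?nrm_ge0.
Qed.

Lemma pos_conj x y : f (star y ** x) = (f (star x ** y) : R[i])^* :> R[i].
Proof. by have [] := psd_form x y. Qed.

Lemma cauchy_schwarz x y : cabs (f (star x ** y)) <= l2 f x * l2 f y.
Proof. by have [] := psd_form x y. Qed.

Lemma l2D x y : l2 f (x + y) <= l2 f x + l2 f y.
Proof.
rewrite -(@ler_pXn2r _ 2) ?nnegrE ?addr_ge0 ?l2_ge0// -lecR -l2_sqr.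
cexpand; rewrite !dualD !l2_sqr (pos_conj x y).
have -> : (l2 f x ^+ 2)%:C + (f (star x ** y) : R[i])^* +
  ((f (star x ** y) : R[i]) + (l2 f y ^+ 2)%:C) =
  (l2 f x ^+ 2 + l2 f y ^+ 2 + 2 * complex.Re (f (star x ** y) : R[i]))%:C.
  case: (f (star x ** y) : R[i]) => u v; apply/eqP; rewrite eq_complex /=.
  by apply/andP; split; apply/eqP; rewrite /=; ring.
rewrite lecR; have := Re_le_nrm (f (star x ** y)).
by have := cauchy_schwarz x y; lra.
Qed.

Lemma l2Z (k : R[i]) x : l2 f (k *: x) = cabs k * l2 f x.
Proof.
apply/eqP; rewrite -(@eqrXn2 _ 2) ?mulr_ge0 ?nrm_ge0 ?l2_ge0//.
apply/eqP/complexI; rewrite -l2_sqr exprMn rmorphM/= nrm_sqr -l2_sqr.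
by cexpand; rewrite !dualZ mulrA.
Qed.

(** For [nrm u <= 1], take [r] with [(1 - r)^2 = 1 - star u ** u]; the defect [f (star y ** y) - f
    (star (u ** y) ** (u ** y))] is then [f] of the square of [y - r ** y]. *)
Lemma l2_mul x y : l2 f (x ** y) <= nrm x * l2 f y.
Proof.
have H1 u : nrm u <= 1 -> l2 f (u ** y) <= l2 f y.
  move=> u1; have [||r [rsa _ rx _]] := @exists_one_sub_sqrt _ _ (star u ** u).
  - by rewrite /self_adjoint starM starK.
  - by rewrite nrm_cstar; have := nrm_ge0 u; nra.
  rewrite -(@ler_pXn2r _ 2) ?nnegrE ?l2_ge0// -lecR -!l2_sqr -subr_ge0.
  rewrite -dualB; have -> : star y ** y - star (u ** y) ** (u ** y) =
      star (y - r ** y) ** (y - r ** y).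
    rewrite starM !cmulA -[_ ** star u ** u]cmulA -rx; cexpand; rewrite rsa.
    by lmod_over R[i]; by ring.
  exact: f_pos.
have [x0|x0] := eqVneq (nrm x) 0.
  rewrite x0 mul0r (nrm_eq0 x0) cmul0l -[X in l2 f X](scale0r (0 : A)) l2Z.
  by rewrite nrm0 mul0r.
have xp : 0 < nrm x by rewrite lt_neqAle eq_sym x0 nrm_ge0.
pose u := (nrm x)^-1%:C *: x.
have xE : x = (nrm x)%:C *: u.
  by rewrite scalerA -rmorphM/= divff ?rmorph1 ?scale1r.
rewrite {1}xE cmulZl l2Z nrm_real_ge0 ?nrm_ge0// ler_wpM2l ?nrm_ge0//.
by apply: H1; rewrite nrmZr ?invr_ge0 ?nrm_ge0// mulVf.
Qed.

End Functionals.

Section UnitalPositive.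
Context {R : realType} {A : cstarAlgType R} {e : A} (eU : is_unit e).
Implicit Types (x y z : A).

Lemma unitl x : e ** x = x.
Proof. by have [] := eU x. Qed.

Lemma unitr x : x ** e = x.
Proof. by have [] := eU x. Qed.

Lemma star_unit : star e = e.
Proof. by rewrite -[LHS]unitl -[X in X ** _](starK e) -starM unitl starK. Qed.

Lemma nrm_unit : nrm e <= 1.
Proof.
have := nrm_cstar e; rewrite star_unit unitl expr2.
have [->|e0] := eqVneq (nrm e) 0; first by rewrite ler01.
by rewrite -{1}[nrm e]mulr1 => /(mulfI e0) <-.
Qed.

Context (f : dual A) (f_pos : positive_functional f).

Lemma pos_star x : f (star x) = (f x : R[i])^* :> R[i].
Proof. by have := pos_conj f_pos e x; rewrite star_unit unitl unitr. Qed.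

Lemma l2_unit_sqr : f e = (l2 f e ^+ 2)%:C :> R[i].
Proof. by rewrite -l2_sqr// star_unit unitl. Qed.

Lemma pos_le_l2 x : cabs (f x) <= l2 f e * l2 f x.
Proof. by have := cauchy_schwarz f_pos e x; rewrite star_unit unitl. Qed.

Lemma l2_le_nrm x : l2 f x <= nrm x * l2 f e.
Proof. by have := l2_mul f_pos x e; rewrite unitr. Qed.

Lemma state_unit : dual_norm f = 1 -> f e = 1 :> R[i].
Proof.
move=> f1; suff E : l2 f e = 1 by rewrite l2_unit_sqr E expr1n.
have := dual_nrm f e; rewrite f1 mul1r l2_unit_sqr nrm_real_ge0 ?sqr_ge0//.
have := nrm_unit; have := l2_ge0 f e => e0 e1 e2.
have : dual_norm f <= l2 f e ^+ 2.
  apply: dual_norm_le => [|x]; first exact: sqr_ge0.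
  rewrite nrmE nrmE -rmorphM lecR; have := pos_le_l2 x; have := l2_le_nrm x.
  by have := nrm_ge0 x; nra.
rewrite f1; nra.
Qed.

End UnitalPositive.

(** * Faithful functionals on unital algebras *)

Section Faithful.
Context {R : realType} {A : cstarAlgType R} {e : A} (eU : is_unit e).
Context (h : dual A) (h_pos : positive_functional h).
Hypothesis h_faithful : forall a, h (star a ** a) = 0 -> a = 0.
Implicit Types (x y z d : A).

(** Here [e - x ** x] is the square of [e - r], and [e - r] is the real part of the unitary
    [(e - r) + ix]. *)
Lemma nrm_unit_sub_sqr x : self_adjoint x -> nrm x <= 1 -> nrm (e - x ** x) <= 1.
Proof.
move=> xsa x1; have [||r [rsa _ rx comm]] := @exists_one_sub_sqrt _ _ (x ** x).
- by rewrite /self_adjoint starM xsa.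
- by apply: le_trans (nrmM _ _) _; have := nrm_ge0 x; nra.
have xr : x ** r = r ** x by apply: comm; rewrite !cmulA.
have rE : e - x ** x = (e - r) ** (e - r).
  by rewrite -rx; cexpand; rewrite !(unitl eU) !(unitr eU); lmod_over R[i]; by ring.
have sr : self_adjoint (e - r) by rewrite /self_adjoint starB rsa (star_unit eU).
have : nrm (e - r) <= 1.
  apply: (commuting_squares_bound sr xsa ler01).
    by cexpand; rewrite xr (unitl eU) (unitr eU).
  move=> z; rewrite -rE -cmulDl subrK (unitl eU).
  by rewrite expr1n scale1r.
rewrite rE => H; apply: le_trans (nrmM _ _) _; have := nrm_ge0 (e - r); nra.
Qed.

(* With [|d|] the square root of [d^2] and [z = |d| - d], we have
   [|d| z = - d z], so that [h(z^* |d| z) = 0] and then [z = 0]. *)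
Lemma faithful_positive d : self_adjoint d ->
  (forall z, 0 <= (h (star z ** d ** z) : R[i])) ->
  exists s, [/\ self_adjoint s, s ** s = d
    & forall y, y ** d = d ** y -> y ** s = s ** y].
Proof.
move=> dsa dpos; pose K : R := nrm d + 1.
have K0 : 0 < K by rewrite ltr_wpDl ?nrm_ge0.
have Ki0 : 0 <= K^-1 by rewrite invr_ge0 ltW.
pose g := K^-1%:C *: d.
have dE : d = K%:C *: g by rewrite scalerA -rmorphM/= divff ?gt_eqF// rmorph1 scale1r.
have gsa : self_adjoint g.
  by rewrite /self_adjoint starZ dsa; congr (_ *: _); exact: conj_real.
have g1 : nrm g <= 1 by rewrite nrmZr// mulrC ler_pdivrMr// mul1r /K; lra.
have gpos z : 0 <= (h (star z ** g ** z) : R[i]).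
  by rewrite /g cmulZr cmulZl dualZ mulr_ge0 ?lecR.
have comm_g y : y ** d = d ** y -> y ** g = g ** y.
  by move=> yd; rewrite /g cmulZr cmulZl yd.
move: g dE gsa g1 gpos comm_g => g dE gsa g1 gpos comm_g.
have [||r1 [r1sa r11 r1E comm1]] := @exists_one_sub_sqrt _ _ (e - g ** g).
- by rewrite /self_adjoint starB starM gsa (star_unit eU).
- exact: nrm_unit_sub_sqr.
have [r2 [r2sa r21 r2E comm2]] := exists_one_sub_sqrt r1sa r11.
(* For the rescaled [g], [m] is the absolute value, with [m ** m = g ** g], and [k] is a square root
   of [m]. *)
pose m := e - r1; pose k := e - r2.
have ksa : self_adjoint k by rewrite /self_adjoint starB r2sa (star_unit eU).
have kE : k ** k = m.
  rewrite /k /m -r2E; cexpand; rewrite !(unitl eU) !(unitr eU).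
  by lmod_over R[i]; by ring.
have msa : self_adjoint m by rewrite /self_adjoint starB r1sa (star_unit eU).
have mE : m ** m = g ** g.
  have -> : g ** g = e - (e - g ** g) by rewrite subKr.
  rewrite -r1E /m; cexpand; rewrite !(unitl eU) !(unitr eU).
  by lmod_over R[i]; by ring.
have comm y : y ** g = g ** y -> y ** k = k ** y.
  move=> yg; have y1 : y ** r1 = r1 ** y.
    apply: comm1; rewrite cmulBr cmulBl (unitl eU) (unitr eU).
    by rewrite cmulA yg -cmulA yg cmulA.
  by rewrite /k cmulBr cmulBl (unitl eU) (unitr eU) (comm2 y y1).
have gm : g ** m = m ** g by rewrite -kE cmulA comm// -cmulA comm// cmulA.
move: m k ksa kE msa mE comm gm => m k ksa kE msa mE comm gm.
pose z := m - g.
have zsa : self_adjoint z by rewrite /self_adjoint starB msa gsa.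
have mz : m ** z = - (g ** z).
  by rewrite /z; cexpand; rewrite mE gm opprB.
have kz : k ** z = 0.
  apply: h_faithful; apply: le_anti; rewrite h_pos andbT.
  have -> : star (k ** z) ** (k ** z) = - (star z ** g ** z).
    by rewrite starM ksa -!cmulA (cmulA k) kE mz cmulNr.
  by rewrite dualN oppr_le0.
have gz : g ** z = 0.
  by rewrite -[LHS]opprK -mz -kE -cmulA kz cmul0r oppr0.
have z0 : z = 0.
  by apply: h_faithful; rewrite zsa {1}/z cmulBl mz gz oppr0 addr0 dual0.
have mg : m = g by apply/eqP; rewrite -subr_eq0 -/z z0.
exists ((Num.sqrt K)%:C *: k); split.
- by rewrite /self_adjoint starZ ksa; congr (_ *: _); exact: conj_real.
- rewrite cmulZl cmulZr scalerA kE mg -rmorphM/= -expr2 sqr_sqrtr ?ltW//.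
- by move=> y /comm_g/comm yk; rewrite cmulZl cmulZr yk.
Qed.

(** The GNS representation of a faithful functional is isometric. For [g = star b ** b] the
    hypothesis makes [c^4 - g^2] positive against [h], hence a square [s^2] with [s] commuting with
    [g]; then [g^2 + s^2 = c^4] bounds [g] by [c^2]. *)
Lemma faithful_nrm_le (b : A) (c : R) : 0 <= c ->
  (forall y, l2 h (b ** y) <= c * l2 h y) -> nrm b <= c.
Proof.
move=> c0 Hb; pose g := star b ** b.
have gsa : self_adjoint g by rewrite /self_adjoint starM starK.
have Hg y : l2 h (g ** y) <= c ^+ 2 * l2 h y.
  have E : l2 h (g ** y) ^+ 2 <= (c * l2 h (g ** y)) * (c * l2 h y).
    have : cabs (h (star (b ** (g ** y)) ** (b ** y))) <=
        (c * l2 h (g ** y)) * (c * l2 h y).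
      apply: le_trans (cauchy_schwarz h_pos _ _) _.
      by rewrite ler_pM ?l2_ge0.
    apply: le_trans; rewrite -(nrm_real_ge0 (sqr_ge0 (l2 h (g ** y)))) -l2_sqr//.
    rewrite le_eqVlt; apply/orP; left; apply/eqP; congr (nrm (h _ : R[i]^o)).
    by rewrite !starM -!cmulA.
  have := l2_ge0 h (g ** y); rewrite le_eqVlt => /predU1P[<-|gy0].
    by rewrite mulr_ge0 ?sqr_ge0 ?l2_ge0.
  by rewrite -(ler_pM2r gy0) -expr2 (le_trans E)//; lra.
pose d := (c ^+ 4)%:C *: e - g ** g.
have dsa : self_adjoint d.
  rewrite /self_adjoint /d starB starZ starM gsa (star_unit eU); congr (_ *: _ - _).
  exact: conj_real.
have [|s [ssa ss comm]] := faithful_positive dsa.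
  move=> z; have -> : star z ** d ** z =
      (c ^+ 4)%:C *: (star z ** z) - star (g ** z) ** (g ** z).
    by rewrite starM gsa /d; cexpand; rewrite (unitr eU).
  rewrite dualB dualZ !l2_sqr// -rmorphM -rmorphB lecR subr_ge0.
  have -> : c ^+ 4 * l2 h z ^+ 2 = (c ^+ 2 * l2 h z) ^+ 2.
    by rewrite exprMn -exprM.
  by rewrite ler_pXn2r ?nnegrE ?mulr_ge0 ?sqr_ge0 ?l2_ge0.
have gd : g ** d = d ** g.
  by rewrite /d; cexpand; rewrite (unitl eU) (unitr eU).
have : nrm g <= c ^+ 2.
  apply: (commuting_squares_bound gsa ssa (sqr_ge0 c) (comm _ gd)) => z.
  rewrite ss /d; cexpand; rewrite (unitl eU) addrC subrK.
  by rewrite -exprM.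
by rewrite nrm_cstar ler_pXn2r ?nnegrE ?nrm_ge0.
Qed.

End Faithful.

(** * Spatial tensor products *)

Lemma inv_rate (R : realType) (C d : R) : 0 < d -> exists N : nat, C / N.+1%:R <= d.
Proof.
move=> d0; exists (Num.truncn (C / d)); rewrite ler_pdivrMr ?ltr0n//.
rewrite [X in _ <= X]mulrC -ler_pdivrMr//; exact: ltW (truncnS_gt _).
Qed.

(** [X] is a bare set of representatives, and the Lipschitz bound makes [phi] depend only on [i s].
    The value at [z] is specified by one estimate against every [s], from which linearity and norm
    bounds can be read off. *)
Lemma extend_by_density (R : realType) (X : Type) (T : normedModType R[i])
    (V : normedModType R[i]) (i : X -> T) (phi : X -> V) (K : R) :
  rate_complete V -> 0 <= K ->
  (forall s s', nrm (phi s - phi s') <= K * nrm (i s - i s')) ->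
  (forall z (d : R), 0 < d -> exists s, nrm (z - i s) <= d) ->
  forall z, exists v, forall s, nrm (v - phi s) <= K * nrm (z - i s).
Proof.
move=> Vc K0 HK Hd z.
have [s Hs] : {s : nat -> X & forall n, nrm (z - i (s n)) <= n.+1%:R^-1}.
  apply: (choice (P := fun n x => nrm (z - i x) <= n.+1%:R^-1)) => n.
  by apply: Hd; rewrite invr_gt0 ltr0n.
have inv_le n m : (n <= m)%N -> m.+1%:R^-1 <= n.+1%:R^-1 :> R.
  by move=> nm; rewrite lef_pV2 ?posrE ?ltr0n// ler_nat.
have [n m nm|d|v Hv] := Vc (phi \o s) (fun n => (K * 2) / n.+1%:R).
- apply: le_trans (HK _ _) _; rewrite -mulrA ler_wpM2l//.
  have := nrm_triangle (i (s m)) z (i (s n)); rewrite (nrmB _ z).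
  have := Hs n; have := Hs m; have := inv_le _ _ nm.
  by move: (m.+1%:R^-1 : R) (n.+1%:R^-1 : R) => u v; lra.
- exact: inv_rate.
exists v => s'; apply/ler_addgt0Pr => d d0; have [N HN] := inv_rate (K * 3) d0.
have := nrm_triangle v (phi (s N)) (phi s'); have := Hv N => /=.
have := HK (s N) s'; have := nrm_triangle (i (s N)) z (i s').
rewrite (nrmB (i (s N)) z); have := Hs N; move: HN.
rewrite -!mulrA; set u := N.+1%:R^-1 => HN Hu H1 H2 H3 H4.
have : K * nrm (i (s N) - i s') <= K * (u + nrm (z - i s')).
  by rewrite ler_wpM2l//; lra.
by rewrite mulrDr; lra.
Qed.

Section Tensor.
Context {R : realType} {A B T : cstarAlgType R} (t : A -> B -> T).
Hypothesis t_spatial : spatial_tensor t.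
Implicit Types (a : A) (b : B) (s : seq (A * B)).

Definition ten s : T := \sum_(p <- s) t p.1 p.2.

Lemma tenDl a a' b : t (a + a') b = t a b + t a' b.
Proof. by have [[/(_ 1 a a' b)]] := t_spatial; rewrite !scale1r. Qed.

Lemma tenDr a b b' : t a (b + b') = t a b + t a b'.
Proof. by have [[_ /(_ 1 a b b')]] := t_spatial; rewrite !scale1r. Qed.

Lemma ten0l b : t 0 b = 0.
Proof. by apply: (@addrI _ (t 0 b)); rewrite -tenDl !addr0. Qed.

Lemma ten0r a : t a 0 = 0.
Proof. by apply: (@addrI _ (t a 0)); rewrite -tenDr !addr0. Qed.

Lemma tenZl k a b : t (k *: a) b = k *: t a b.
Proof.
by have [[/(_ k a 0 b)]] := t_spatial; rewrite ten0l !addr0.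
Qed.

Lemma tenZr k a b : t a (k *: b) = k *: t a b.
Proof.
by have [[_ /(_ k a b 0)]] := t_spatial; rewrite ten0r !addr0.
Qed.

Lemma tenBl a a' b : t (a - a') b = t a b - t a' b.
Proof. by rewrite -[- a']scaleN1r tenDl tenZl scaleN1r. Qed.

Lemma tenBr a b b' : t a (b - b') = t a b - t a b'.
Proof. by rewrite -[- b']scaleN1r tenDr tenZr scaleN1r. Qed.

Lemma tenM a a' b b' : t a b ** t a' b' = t (a ** a') (b ** b').
Proof. by have [_ ->] := t_spatial. Qed.

Lemma ten_star a b : star (t a b) = t (star a) (star b).
Proof. by have [_ _ ->] := t_spatial. Qed.

Lemma ten_dense (z : T) (d : R) : 0 < d -> exists s, nrm (z - ten s) <= d.
Proof.
move=> d0; have [_ _ _ H _] := t_spatial.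
have : [set: T] z by []; rewrite -H => Hz.
have : nbhs z (ball z d%:C) by apply: nbhsx_ballx; rewrite ltcR.
move=> /Hz[_ [[s Hs ->]]]; rewrite -ball_normE/= nrmE ltcR => Hzs.
have [s' s'E] : exists s', ten s' = \sum_(p <- s) p.1 *: p.2.
  elim: s Hs {Hzs} => [|[k u] s IHs] Hs; first by exists [::]; rewrite /ten !big_nil.
  have [|s' s'E] := IHs; first by move=> p ps; apply: Hs; rewrite inE ps orbT.
  have /Hs/= [a _ [b _ uE]] : (k, u) \in (k, u) :: s by rewrite inE eqxx.
  exists ((k *: a, b) :: s'); rewrite /ten !big_cons -s'E /= tenZl uE.
  by [].
by exists s'; rewrite s'E ltW.
Qed.

Lemma ten_cat s s' : ten (s ++ s') = ten s + ten s'.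
Proof. exact: big_cat. Qed.

Lemma ten_scale k s : ten [seq (k *: p.1, p.2) | p <- s] = k *: ten s.
Proof.
by rewrite /ten big_map scaler_sumr; apply: eq_bigr => p _ /=; rewrite tenZl.
Qed.

Lemma ten_mul s s' : ten (alg_mul s s') = ten s ** ten s'.
Proof.
rewrite /ten /alg_mul big_allpairs_dep /=.
elim: s => [|p s IHs]; first by rewrite !big_nil cmul0l.
rewrite !big_cons IHs cmulDl; congr (_ + _).
elim: s' {IHs} => [|q s' IHs]; first by rewrite !big_nil cmul0r.
by rewrite !big_cons IHs cmulDr tenM.
Qed.

Lemma ten_alg_star s : ten (alg_star s) = star (ten s).
Proof.
rewrite /ten /alg_star big_map; elim: s => [|p s IHs].
  by rewrite !big_nil star0.
by rewrite !big_cons IHs starD ten_star.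
Qed.

Lemma ten_ext_eq (V : normedModType R[i]) (F G : T -> V) (K : R) :
  (forall z z', F (z - z') = F z - F z') -> (forall z, nrm (F z) <= K * nrm z) ->
  (forall z z', G (z - z') = G z - G z') -> (forall z, nrm (G z) <= K * nrm z) ->
  (forall s, F (ten s) = G (ten s)) -> F =1 G.
Proof.
move=> FB FK GB GK FG z; apply: nrm_small => d d0.
pose K' := `|K| + 1; have K'0 : 0 < K' by rewrite ltr_wpDl.
have KK' : K <= K' by rewrite /K'; have := ler_norm K; lra.
have [s Hs] := ten_dense z (divr_gt0 d0 (mulr_gt0 K'0 (ltr0n _ 2))).
have -> : F z - G z = F (z - ten s) - G (z - ten s).
  by rewrite FB GB FG opprB addrA subrK.
apply: le_trans (nrmD _ _) _; rewrite nrmN.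
have H : K' * nrm (z - ten s) <= d / 2.
  by move: Hs; rewrite invfM mulrA -mulrA mulrCA ler_pdivlMl.
have := FK (z - ten s); have := GK (z - ten s); have := nrm_ge0 (z - ten s).
by nra.
Qed.

Lemma tensor_ext (V : normedModType R[i]) (psi : A -> B -> V) (K : R) :
  rate_complete V -> 0 <= K ->
  (forall k a a' b, psi (k *: a + a') b = k *: psi a b + psi a' b) ->
  (forall s, nrm (\sum_(p <- s) psi p.1 p.2) <= K * nrm (ten s)) ->
  exists F : T -> V, [/\ linear F, forall a b, F (t a b) = psi a b
    & forall z, nrm (F z) <= K * nrm z].
Proof.
move=> Vc K0 psil HK; pose phi s := \sum_(p <- s) psi p.1 p.2.
have psi0 b : psi 0 b = 0.
  have := psil 1 0 0 b; rewrite !scale1r addr0 => H.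
  by apply: (@addrI _ (psi 0 b)); rewrite -H addr0.
have phiZ k s : phi [seq (k *: p.1, p.2) | p <- s] = k *: phi s.
  rewrite /phi big_map scaler_sumr; apply: eq_bigr => p _ /=.
  by rewrite -[k *: p.1]addr0 psil psi0 addr0.
have phiD s s' : phi (s ++ s') = phi s + phi s' by exact: big_cat.
have phiB s s' : nrm (phi s - phi s') <= K * nrm (ten s - ten s').
  rewrite -[- phi s']scaleN1r -[- ten s']scaleN1r -phiZ -phiD -ten_scale -ten_cat.
  exact: HK.
have ext := extend_by_density Vc K0 phiB ten_dense.
have [F HF] : {F : T -> V & forall z s, nrm (F z - phi s) <= K * nrm (z - ten s)}.
  exact: (choice (P := fun z v => forall s, nrm (v - phi s) <= K * nrm (z - ten s))) ext.
exists F; split.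
- move=> k z z'; apply: (@nrm_small _ _ _ _) => d d0.
  (* At precision [d / M] the errors add up to at most [(M - 1) * (d / M)]; the added 1 keeps [M]
     positive. *)
  pose M := K * (nrm (k : R[i]^o) + 1) * 2 + 1.
  have M0 : 0 < M by rewrite /M ltr_wpDl// !mulr_ge0// addr_ge0// nrm_ge0.
  have [s Hs] := ten_dense z (divr_gt0 d0 M0).
  have [s' Hs'] := ten_dense z' (divr_gt0 d0 M0).
  pose s'' := [seq (k *: p.1, p.2) | p <- s] ++ s'.
  have phi'' : phi s'' = k *: phi s + phi s' by rewrite /s'' phiD phiZ.
  have ten'' : ten s'' = k *: ten s + ten s' by rewrite /s'' ten_cat ten_scale.
  have := HF (k *: z + z') s''; rewrite phi'' ten''.
  have -> : k *: z + z' - (k *: ten s + ten s') = k *: (z - ten s) + (z' - ten s').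
    by lmod_over R[i]; by ring.
  have H1 := HF z s; have H2 := HF z' s'.
  have -> : F (k *: z + z') - (k *: F z + F z') =
      (F (k *: z + z') - (k *: phi s + phi s')) - (k *: (F z - phi s) + (F z' - phi s')).
    by lmod_over R[i]; by ring.
  move=> H3; apply: le_trans (nrmD _ _) _; rewrite nrmN.
  have := nrmD (k *: (F z - phi s)) (F z' - phi s').
  have := nrmD (k *: (z - ten s)) (z' - ten s').
  rewrite !nrmZ; set kk := nrm (k : R[i]^o) in M M0 Hs Hs' *.
  have kk0 : 0 <= kk by exact: nrm_ge0.
  move=> H4 H5.
  have H6 : kk * nrm (F z - phi s) <= kk * (K * (d / M)).
    by rewrite ler_wpM2l// (le_trans H1)// ler_wpM2l.
  have H7 : nrm (F z' - phi s') <= K * (d / M).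
    by rewrite (le_trans H2)// ler_wpM2l.
  have H8 : K * nrm (k *: (z - ten s) + (z' - ten s')) <= K * (kk * (d / M) + d / M).
    rewrite ler_wpM2l// (le_trans H4)// lerD// ler_wpM2l//.
  have : (M - 1) * (d / M) <= d.
    by rewrite mulrBl mul1r mulrC divfK ?gt_eqF// gerBl divr_ge0// ltW.
  rewrite /M; move: (d / M) H3 H5 H6 H7 H8 => w; lra.
- move=> a b; apply/eqP; rewrite -subr_eq0; apply/eqP; apply: nrm_eq0.
  apply/eqP; rewrite eq_le nrm_ge0 andbT.
  have := HF (t a b) [:: (a, b)].
  by rewrite /phi /ten !big_seq1/= subrr nrm0 mulr0.
- move=> z; have := HF z [::].
  by rewrite /phi /ten !big_nil !subr0.
Qed.

End Tensor.

Section Flip.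
Context {R : realType} {A B T : cstarAlgType R} (t : A -> B -> T).
Hypothesis t_spatial : spatial_tensor t.

Let sw (X Y : Type) (p : X * Y) := (p.2, p.1).

Let alg_eval_sw (X Y : cstarAlgType R) (f : dual X) (g : dual Y) s :
  alg_eval g f (map (@sw X Y) s) = alg_eval f g s.
Proof. by rewrite /alg_eval big_map; apply: eq_bigr => p _; rewrite mulrC. Qed.

Let alg_star_sw (X Y : cstarAlgType R) (s : seq (X * Y)) :
  alg_star (map (@sw X Y) s) = map (@sw X Y) (alg_star s).
Proof. by rewrite /alg_star -!map_comp. Qed.

Let alg_mul_sw (X Y : cstarAlgType R) (s s' : seq (X * Y)) :
  alg_mul (map (@sw X Y) s) (map (@sw X Y) s') = map (@sw X Y) (alg_mul s s').
Proof.
rewrite /alg_mul; elim: s => //= p s ->; rewrite map_cat -!map_comp.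
by congr (_ ++ _).
Qed.

Let swK (X Y : Type) : cancel (map (@sw X Y)) (map (@sw Y X)).
Proof. by move=> s; rewrite -map_comp -[RHS]map_id; apply: eq_map => -[]. Qed.

(** Transfers slicing results from one leg to the other. *)
Lemma spatial_tensor_flip : spatial_tensor (fun b a => t a b).
Proof.
have [[tl tr] tm ts td tn] := t_spatial; split=> //.
- rewrite -td; congr (closure (lspan _)).
  by apply/seteqP; split=> _ [a _ [b _ <-]]; exists b => //; exists a.
- move=> s c c0; have := tn (map (@sw B A) s) c c0; rewrite big_map/= => H.
  split=> [/H.1{}H f g fp gp y|Hs].
    have := H g f gp fp (map (@sw B A) y).
    by rewrite !(alg_star_sw, alg_mul_sw) !alg_eval_sw.
  apply/H => f g fp gp y; rewrite -(swK y) !(alg_star_sw, alg_mul_sw) !alg_eval_sw.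
  have := Hs g f gp fp (map (@sw A B) y).
  by rewrite !(alg_star_sw, alg_mul_sw) alg_eval_sw.
Qed.
End Flip.

(** * Products of positive functionals *)

Section ProductFunctional.
Context {R : realType} {A B T : cstarAlgType R} (t : A -> B -> T).
Hypothesis t_spatial : spatial_tensor t.
Context {eA : A} {eB : B} (eAU : is_unit eA) (eBU : is_unit eB).
Implicit Types (a : A) (b : B) (s : seq (A * B)) (f : dual A) (g : dual B).

Lemma ten_unit : is_unit (t eA eB).
Proof.
have K (z : T) : nrm z <= (nrm (t eA eB) + 1) * nrm z.
  by rewrite mulrDl mul1r lerDr mulr_ge0 ?nrm_ge0.
have Kl z : nrm (t eA eB ** z) <= (nrm (t eA eB) + 1) * nrm z.
  by rewrite (le_trans (nrmM _ _))// ler_wpM2r ?nrm_ge0// lerDl.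
have Kr z : nrm (z ** t eA eB) <= (nrm (t eA eB) + 1) * nrm z.
  by rewrite (le_trans (nrmM _ _))// mulrC ler_wpM2r ?nrm_ge0// lerDl.
move=> z; split.
  refine (@ten_ext_eq _ _ _ _ t t_spatial T (fun z => t eA eB ** z) id _ _ Kl _ K _ z) => //.
    by move=> u v; rewrite cmulBr.
  elim=> [|[a b] s IHs]; first by rewrite /ten big_nil cmul0r.
  by rewrite -cat1s ten_cat cmulDr IHs /ten big_seq1 tenM// (unitl eAU) (unitl eBU).
refine (@ten_ext_eq _ _ _ _ t t_spatial T (fun z => z ** t eA eB) id _ _ Kr _ K _ z) => //.
  by move=> u v; rewrite cmulBl.
elim=> [|[a b] s IHs]; first by rewrite /ten big_nil cmul0l.
by rewrite -cat1s ten_cat cmulDl IHs /ten big_seq1 tenM// (unitr eAU) (unitr eBU).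
Qed.

Lemma alg_mul1l s : alg_mul [:: (eA, eB)] s = s.
Proof.
rewrite /alg_mul /= cats0 -[RHS]map_id; apply: eq_map => -[a b] /=.
by rewrite (unitl eAU) (unitl eBU).
Qed.

Lemma alg_mul1r s : alg_mul s [:: (eA, eB)] = s.
Proof.
rewrite /alg_mul; elim: s => [//|[a b] s IHs] /=.
by rewrite (unitr eAU) (unitr eBU) IHs.
Qed.

Lemma alg_star1 : alg_star [:: (eA, eB)] = [:: (eA, eB)].
Proof. by rewrite /alg_star /= (star_unit eAU) (star_unit eBU). Qed.

Lemma alg_eval_mul f g s s' : alg_eval f g (alg_mul s s') =
  \sum_(p <- s) \sum_(q <- s') (f (p.1 ** q.1) : R[i]) * g (p.2 ** q.2).
Proof. by rewrite /alg_eval /alg_mul big_allpairs_dep. Qed.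

Section FixFunctionals.
Context (f : dual A) (g : dual B).
Hypotheses (f_pos : positive_functional f) (g_pos : positive_functional g).

(** This is the spatial norm condition for the empty sum with [c = 1], tested on [y = s]. *)
Lemma alg_eval_ge0 s : 0 <= alg_eval f g (alg_mul (alg_star s) s).
Proof.
have [_ _ _ _ tn] := t_spatial; have [/(_ _ f g f_pos g_pos s) H _] := tn [::] 1 ler01.
have := H _; rewrite big_nil normr0 lecR expr1n mul1r => /(_ ler01).
suff -> : alg_mul (alg_mul (alg_star s) (alg_star [::])) (alg_mul [::] s) = [::].
  by rewrite /alg_eval big_nil.
by rewrite /alg_mul /=; elim: (alg_star s).
Qed.

(** Cauchy-Schwarz between the unit tensor and [s] for the form of [f (x) g]; the spatial norm
    condition, tested on the unit tensor, bounds the value at [s^* s]. *)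
Lemma alg_eval_bound s :
  cabs (alg_eval f g s) <= (l2 f eA * l2 g eB) ^+ 2 * nrm (ten t s).
Proof.
set D := l2 f eA * l2 g eB; have D0 : 0 <= D by rewrite mulr_ge0 ?l2_ge0.
have DE : (f eA : R[i]) * g eB = (D ^+ 2)%:C.
  by rewrite (l2_unit_sqr eAU f_pos) (l2_unit_sqr eBU g_pos) -rmorphM exprMn.
have [_ _ _ _ tn] := t_spatial.
have [H _] := tn s (nrm (ten t s)) (nrm_ge0 _).
have {}H := H _ f g f_pos g_pos [:: (eA, eB)].
rewrite alg_star1 alg_mul1l !alg_mul1r /= in H.
have {}H : alg_eval f g (alg_mul (alg_star s) s) <=
    (nrm (ten t s) ^+ 2)%:C * (D ^+ 2)%:C.
  apply: le_trans (H _) _; first by rewrite -/(ten t s) nrmE.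
  by rewrite [X in _ * X]/alg_eval big_seq1/= DE.
have [|||E1 E2] := @psd_quadratic_scalar _ (alg_eval f g (alg_mul (alg_star s) s))
   (alg_eval f g (alg_star s)) (alg_eval f g s) (f eA * g eB).
- exact: alg_eval_ge0.
- by rewrite DE lecR sqr_ge0.
- move=> k; have := alg_eval_ge0 ((k *: eA, eB) :: s).
  rewrite alg_eval_mul /= !big_cons /=.
  rewrite [X in _ + X](eq_bigr (fun p =>
      (f (p.1 ** (k *: eA)) : R[i]) * g (p.2 ** eB) +
      \sum_(q <- s) (f (p.1 ** q.1) : R[i]) * g (p.2 ** q.2))); last first.
    by move=> p _; rewrite big_cons.
  rewrite big_split /= -alg_eval_mul !starZ (star_unit eAU) (star_unit eBU).
  rewrite cmulZl cmulZr (unitl eAU) (unitl eBU) !dualZ.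
  have -> : \sum_(p <- s) (f ((k^* *: eA) ** p.1) : R[i]) * g (eB ** p.2) =
      k^* * alg_eval f g s.
    rewrite mulr_sumr; apply: eq_bigr => p _.
    by rewrite cmulZl (unitl eAU) (unitl eBU) dualZ mulrA.
  have -> : \sum_(p <- alg_star s) (f (p.1 ** (k *: eA)) : R[i]) * g (p.2 ** eB) =
      k * alg_eval f g (alg_star s).
    rewrite mulr_sumr; apply: eq_bigr => p _.
    by rewrite cmulZr (unitr eAU) (unitr eBU) dualZ mulrA.
  by congr (_ <= _); ring.
rewrite -(@ler_pXn2r _ 2) ?nnegrE ?mulr_ge0 ?nrm_ge0 ?sqr_ge0 ?l2_ge0//.
rewrite E1 nrmcJ; apply: le_trans E2 _; rewrite DE /=.
have := alg_eval_ge0 s => /ge0_ReE HE; move: H; rewrite HE -rmorphM lecR => H.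
by rewrite [(D ^+ 2 * _) ^+ 2]exprMn /=; have := ler_wpM2r (sqr_ge0 D) H; lra.
Qed.

Lemma product_functional : exists Phi : dual T,
  (forall a b, Phi (t a b) = f a * g b :> R[i]) /\ positive_functional Phi.
Proof.
have [||k a a' b|s|F [Fl Ft FK]] := @tensor_ext _ _ _ _ _ t_spatial R[i]^o
    (fun a b => (f a : R[i]) * g b) ((l2 f eA * l2 g eB) ^+ 2).
- exact: complex_rate_complete.
- exact: sqr_ge0.
- by rewrite dualD dualZ mulrDl -mulrA.
- exact: alg_eval_bound.
have FB : exists M : R, forall z, `|F z| <= M%:C * `|z|.
  by exists ((l2 f eA * l2 g eB) ^+ 2) => z; rewrite !nrmE -rmorphM lecR.
pose Phi : dual T := dual_of F Fl FB.
have PhiE s : Phi (ten t s) = alg_eval f g s :> R[i].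
  by rewrite /ten dual_sum; apply: eq_bigr => p _; exact: Ft.
exists Phi; split; first exact: Ft.
move=> z; apply: ge0_approx => d d0.
pose M := dual_norm Phi * (nrm z + nrm z + 1) + 1.
have M1 : 1 <= M.
  by rewrite lerDr mulr_ge0 ?dual_norm_ge0// addr_ge0// addr_ge0 ?nrm_ge0.
have M0 : 0 < M by rewrite (lt_le_trans ltr01).
have dm0 : 0 < Num.min 1 (d / M) by rewrite lt_min ltr01 divr_gt0.
have [s] := ten_dense t_spatial z dm0; rewrite le_min => /andP[s1 sd].
exists (alg_eval f g (alg_mul (alg_star s) s)); first exact: alg_eval_ge0.
rewrite -PhiE ten_mul// ten_alg_star// -dualB; apply: le_trans (dual_nrm _ _) _.
have -> : star z ** z - star (ten t s) ** ten t s =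
    star z ** (z - ten t s) + star (z - ten t s) ** ten t s.
  by cexpand; lmod_over R[i]; by ring.
have H1 := nrmD (star z ** (z - ten t s)) (star (z - ten t s) ** ten t s).
have H2 := nrmM (star z) (z - ten t s).
have H3 := nrmM (star (z - ten t s)) (ten t s).
have H4 : nrm (ten t s) <= nrm z + 1.
  by have := nrm_triangle (ten t s) z 0; rewrite !subr0 nrmB; lra.
rewrite !nrm_star in H2 H3.
have H5 : nrm (star z ** (z - ten t s) + star (z - ten t s) ** ten t s) <=
    (nrm z + nrm z + 1) * nrm (z - ten t s).
  by have := nrm_ge0 (z - ten t s); nra.
have H6 : M * nrm (z - ten t s) <= d by rewrite mulrC -ler_pdivlMr.
have := dual_norm_ge0 Phi; have := nrm_ge0 (z - ten t s).
move: H5 H6; rewrite /M.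
set X := nrm (_ + _); set Y := nrm (z - _); set N := dual_norm _ => H5 H6 Y0 N0.
have : N * X <= N * ((nrm z + nrm z + 1) * Y) by rewrite ler_wpM2l.
lra.
Qed.

End FixFunctionals.
End ProductFunctional.

Section TensorFunctionals.
Context {R : realType} {A B T : cstarAlgType R} (t : A -> B -> T).
Hypothesis t_spatial : spatial_tensor t.

Lemma ten_linear_eq (V : normedModType R[i]) (F G : T -> V) (K L : R) :
  linear F -> (forall z, nrm (F z) <= K * nrm z) ->
  linear G -> (forall z, nrm (G z) <= L * nrm z) ->
  (forall a b, F (t a b) = G (t a b)) -> F =1 G.
Proof.
move=> Fl FK Gl GL FG.
have linB (U : T -> V) : linear U -> forall z z', U (z - z') = U z - U z'.
  by move=> Ul z z'; have := Ul (-1) z' z; rewrite !scaleN1r ![- _ + _]addrC.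
have lin0 (U : T -> V) : linear U -> U 0 = 0.
  by move=> Ul; rewrite -(subrr (0 : T)) linB// subrr.
apply: (ten_ext_eq t_spatial (K := Num.max K L)).
- exact: linB.
- by move=> z; rewrite (le_trans (FK z))// ler_wpM2r ?nrm_ge0// le_max lexx.
- exact: linB.
- by move=> z; rewrite (le_trans (GL z))// ler_wpM2r ?nrm_ge0// le_max lexx orbT.
elim=> [|[a b] s IHs]; first by rewrite /ten big_nil !lin0.
have E U : linear U -> U (ten t ((a, b) :: s)) = U (t a b) + U (ten t s).
  by move=> Ul; rewrite /ten big_cons; have := Ul 1 (t a b) (ten t s); rewrite !scale1r.
by rewrite !E// FG IHs.
Qed.

Lemma ten_dual_eq (F G : dual T) :
  (forall a b, F (t a b) = G (t a b)) -> forall z, F z = G z.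
Proof.
by move=> FG; apply: (@ten_linear_eq R[i]^o F G (dual_norm F) (dual_norm G)) => //;
  [exact: linearP|exact: dual_nrm|exact: linearP|exact: dual_nrm].
Qed.

Context {eA : A} {eB : B} (eAU : is_unit eA) (eBU : is_unit eB).

Lemma l2_ten (f : dual A) (g : dual B) (Phi : dual T) a b :
  positive_functional f -> positive_functional g ->
  (forall a b, Phi (t a b) = f a * g b :> R[i]) ->
  l2 Phi (t a b) = l2 f a * l2 g b.
Proof.
move=> fp gp PhiE; rewrite {1}/l2 ten_star// tenM// PhiE (l2_sqr fp) (l2_sqr gp).
by rewrite -rmorphM /= -exprMn sqrtr_sqr ger0_norm// mulr_ge0 ?l2_ge0.
Qed.

(** The map [id (x) g]. Its boundedness is tested in the GNS representation of the faithful [h],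
    where the matrix coefficients of a slice are values of [h (x) g]. *)
Lemma slice_map (h : dual A) (g : dual B) :
  positive_functional h -> (forall a, h (star a ** a) = 0 -> a = 0) ->
  positive_functional g ->
  exists E : T -> A, exists K : R, [/\ linear E, forall z, nrm (E z) <= K * nrm z
    & forall a b, E (t a b) = g b *: a].
Proof.
move=> hp hf gp; have [Phi [PhiE Phip]] := product_functional t_spatial eAU eBU hp gp.
pose D := l2 g eB; have D0 : 0 <= D by exact: l2_ge0.
have H w y s : h (w ** (\sum_(p <- s) (g p.2 : R[i]) *: p.1) ** y) =
    Phi (t w eB ** ten t s ** t y eB).
  rewrite /ten; elim: s => [|p s IHs].
    by rewrite !big_nil !cmul0r !cmul0l !dual0.
  rewrite !big_cons !(cmulDl, cmulDr) dualD IHs [RHS]dualD; congr (_ + _).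
  rewrite cmulZr cmulZl dualZ !tenM// PhiE.
  by rewrite (unitl eBU) (unitr eBU) mulrC.
have [||k a a' b|s|E [El Et EK]] := @tensor_ext _ _ _ _ _ t_spatial A
    (fun a b => (g b : R[i]) *: a) (D ^+ 2).
- exact: cauchy_rate.
- exact: sqr_ge0.
- by rewrite scalerDr !scalerA mulrC.
- apply: (faithful_nrm_le eAU hp hf) => [|y]; first by rewrite mulr_ge0 ?sqr_ge0 ?nrm_ge0.
  set b := \sum_(p <- s) _; set x := b ** y.
  have xE : l2 h x ^+ 2 <= (l2 h x * D) * (nrm (ten t s) * (l2 h y * D)).
    rewrite -(nrm_real_ge0 (sqr_ge0 (l2 h x))) -l2_sqr// {2}/x cmulA H.
    rewrite -cmulA -[t (star x) eB]starK ten_star// starK (star_unit eBU).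
    apply: le_trans (cauchy_schwarz Phip _ _) _.
    rewrite -!(l2_ten _ _ hp gp PhiE) ler_wpM2l ?l2_ge0//.
    exact: l2_mul.
  have := l2_ge0 h x; rewrite le_eqVlt => /predU1P[<-|x0].
    by rewrite !mulr_ge0 ?sqr_ge0 ?l2_ge0 ?nrm_ge0.
  by rewrite -(ler_pM2r x0) -expr2 (le_trans xE)//; lra.
by exists E, (D ^+ 2).
Qed.

End TensorFunctionals.

Section SliceProperties.
Context {R : realType} {A B T : cstarAlgType R} (t : A -> B -> T).
Hypothesis t_spatial : spatial_tensor t.
Context {eA : A} {eB : B} (eAU : is_unit eA) (eBU : is_unit eB).
Context (g : dual B) (E : T -> A) (K : R).
Hypotheses (E_linear : linear E) (E_bounded : forall z, nrm (E z) <= K * nrm z).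
Hypothesis E_ten : forall a b, E (t a b) = g b *: a.

Let K_le z : nrm (E z) <= Num.max K 0 * nrm z.
Proof. by rewrite (le_trans (E_bounded z))// ler_wpM2r ?nrm_ge0// le_max lexx. Qed.

Let K0 : 0 <= Num.max K 0. Proof. by rewrite le_max lexx orbT. Qed.

Lemma slice_dual (f : dual A) (Phi : dual T) :
  (forall a b, Phi (t a b) = f a * g b :> R[i]) -> forall z, f (E z) = Phi z.
Proof.
move=> PhiE; apply: (@ten_linear_eq _ _ _ _ _ t_spatial R[i]^o (fun z => f (E z)) Phi
    (dual_norm f * Num.max K 0) (dual_norm Phi)).
- by move=> k x y; rewrite E_linear linearP.
- move=> z; rewrite (le_trans (dual_nrm f _))// -mulrA ler_wpM2l ?dual_norm_ge0//.
- exact: linearP.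
- exact: dual_nrm.
- by move=> a b; rewrite E_ten dualZ PhiE mulrC.
Qed.

Lemma slice_bimodule (w y : A) (z : T) :
  E (t w eB ** z ** t y eB) = w ** E z ** y.
Proof.
have tnn (u : T) (a b : A) : nrm (t a eB ** u ** t b eB) <=
    nrm (t a eB) * nrm (t b eB) * nrm u.
  rewrite (le_trans (nrmM _ _))// mulrAC ler_wpM2r ?nrm_ge0//.
  exact: nrmM.
move: z; apply: (@ten_linear_eq _ _ _ _ _ t_spatial A
    (fun z => E (t w eB ** z ** t y eB)) (fun z => w ** E z ** y)
    (Num.max K 0 * (nrm (t w eB) * nrm (t y eB)))
    (nrm w * nrm y * Num.max K 0)).
- by move=> k u v; rewrite cmulPr cmulPl E_linear.
- move=> z; apply: le_trans (K_le _) _; rewrite -[X in _ <= X]mulrA.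
  by apply: ler_wpM2l.
- by move=> k u v; rewrite E_linear cmulPr cmulPl.
- move=> z; apply: le_trans (nrmM _ _) _.
  apply: le_trans (ler_wpM2r (nrm_ge0 y) (nrmM _ _)) _.
  rewrite [X in X <= _]mulrAC -[X in _ <= X]mulrA.
  by apply: ler_wpM2l; rewrite ?mulr_ge0 ?nrm_ge0.
- move=> a b; rewrite !tenM// !E_ten (unitl eBU) (unitr eBU).
  by rewrite cmulZr cmulZl.
Qed.

End SliceProperties.

Section Separation.
Context {R : realType} {A B T : cstarAlgType R} (t : A -> B -> T).
Hypothesis t_spatial : spatial_tensor t.
Context {eA : A} {eB : B} (eAU : is_unit eA) (eBU : is_unit eB).
Context (hA : dual A) (hB : dual B).
Hypotheses (hA_pos : positive_functional hA) (hB_pos : positive_functional hB).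
Hypothesis hA_faithful : forall a, hA (star a ** a) = 0 -> a = 0.
Hypothesis hB_faithful : forall b, hB (star b ** b) = 0 -> b = 0.
Context (Psi : dual T) (PsiE : forall a b, Psi (t a b) = hA a * hB b :> R[i]).

(** Slicing and faithfulness replace [hA] by an arbitrary functional ([step1]), then [hB] through
    the flip ([step2]). So [Y] vanishes in all product GNS representations, which compute the
    spatial norm. *)
Lemma tensor_separation (Y : T) : (forall Z, Psi (Y ** Z) = 0) -> Y = 0.
Proof.
move=> HY; have tU := ten_unit t_spatial eAU eBU.
have step1 (f : dual A) (Phi : dual T) :
    (forall a b, Phi (t a b) = f a * hB b :> R[i]) ->
    forall w Z, Phi (t w eB ** Y ** Z) = 0.
  move=> PhiE w Z.
  have [E [K [El EK Et]]] := slice_map t_spatial eAU eBU hA_pos hA_faithful hB_pos.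
  have EY0 : E (Y ** Z) = 0.
    apply: (can_inj starK); rewrite star0; apply: hA_faithful; rewrite starK.
    have := slice_bimodule t_spatial eBU El EK Et eA (star (E (Y ** Z))) (Y ** Z).
    rewrite (unitl eAU) (unitl tU) => <-.
    by rewrite (slice_dual t_spatial El EK Et PsiE) -cmulA HY.
  have := slice_bimodule t_spatial eBU El EK Et w eA (Y ** Z).
  rewrite EY0 cmul0r cmul0l (unitr tU) cmulA => E0.
  by rewrite -(slice_dual t_spatial El EK Et PhiE) E0 dual0.
have step2 (f : dual A) (g : dual B) (Phi : dual T) : positive_functional f ->
    (forall a b, Phi (t a b) = f a * g b :> R[i]) ->
    forall X Z, Phi (X ** Y ** Z) = 0.
  move=> fp PhiE X Z; have t_flip := spatial_tensor_flip t_spatial.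
  have [F [K [Fl FK Ft]]] := slice_map t_flip eBU eAU hB_pos hB_faithful fp.
  have PhiE' b a : Phi (t a b) = g b * f a :> R[i] by rewrite PhiE mulrC.
  have [Phi' [Phi'E _]] := product_functional t_spatial eAU eBU fp hB_pos.
  have Phi'E' b' a : Phi' (t a b') = hB b' * f a :> R[i] by rewrite Phi'E mulrC.
  have FY0 w V : F (t w eB ** Y ** V) = 0.
    apply: (can_inj starK); rewrite star0; apply: hB_faithful; rewrite starK.
    have := slice_bimodule t_flip eAU Fl FK Ft eB (star (F (t w eB ** Y ** V))) (t w eB ** Y ** V).
    rewrite (unitl eBU) (unitl tU) => <-.
    rewrite (slice_dual t_flip Fl FK Ft Phi'E').
    by rewrite -cmulA (step1 f Phi' Phi'E).
  have ten0 w w' : Phi (t w w' ** (Y ** Z)) = 0.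
    have := slice_bimodule t_flip eAU Fl FK Ft w' eB (t w eB ** Y ** Z).
    rewrite FY0 cmul0r cmul0l (unitr tU) !cmulA tenM// (unitl eAU) (unitr eBU) => F0.
    by rewrite -(slice_dual t_flip Fl FK Ft PhiE') F0 dual0.
  rewrite -cmulA; apply: (@ten_linear_eq _ _ _ _ _ t_spatial R[i]^o
    (dual_lact (Y ** Z) Phi) (fun=> 0) (dual_norm (dual_lact (Y ** Z) Phi)) 0).
  - exact: linearP.
  - exact: dual_nrm.
  - by move=> k u v; rewrite scaler0 addr0.
  - by move=> z; rewrite nrm0 mul0r.
  - exact: ten0.
apply: nrm_small => d d0; rewrite subr0.
have d20 : 0 < d / 2 by rewrite divr_gt0.
(* The norm condition speaks of algebraic tensors only: [s] acts in each product GNS representation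
   as [s - Y] does, so its norm is at most [d / 2]. *)
have [s Hs] := ten_dense t_spatial Y d20.
suff : nrm (ten t s) <= d / 2.
  by have := nrm_triangle Y (ten t s) 0; rewrite !subr0; lra.
rewrite -lecR -nrmE; have [_ _ _ _ tn] := t_spatial.
apply/(tn s (d / 2) (ltW d20)) => f g fp gp y.
have [Phi [PhiE Phip]] := product_functional t_spatial eAU eBU fp gp.
have PhiS s' : alg_eval f g s' = Phi (ten t s') :> R[i].
  by rewrite /ten dual_sum; apply: eq_bigr => p _; rewrite PhiE.
rewrite !PhiS !ten_mul// !ten_alg_star// -starM !l2_sqr// -rmorphM lecR -exprMn.
have d00 := ltW d0; rewrite ler_pXn2r ?nnegrE ?mulr_ge0 ?l2_ge0//.
have Yy : l2 Phi (Y ** ten t y) = 0.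
  rewrite /l2; have -> : Phi (star (Y ** ten t y) ** (Y ** ten t y)) = 0 :> R[i].
    by rewrite cmulA (step2 f g Phi fp PhiE).
  exact: sqrtr0.
have -> : ten t s ** ten t y = Y ** ten t y + (ten t s - Y) ** ten t y.
  by cexpand; lmod_over R[i]; by ring.
apply: le_trans (l2D Phip _ _) _; rewrite Yy add0r.
apply: le_trans (l2_mul Phip _ _) _.
by rewrite ler_wpM2r ?l2_ge0// nrmB.
Qed.

End Separation.

(** * Compact quantum groups *)

Section CompactQuantumGroup.
Context {R : realType} {H : lcqg R} {e : C0 H} (eU : is_unit e).
Notation B := (C0 H).
Notation T := (C02 H).
Notation t := (tens H).
Implicit Types (a b c w x y : B) (z : T).

Let ts := @tens_spatial R H.
Let tU : is_unit (t e e) := ten_unit ts eU eU.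

(** Since [T] is unital, a double centraliser is multiplication by its value at the unit. *)
Lemma mult_unital (D : mult T) z :
  lmult D z = lmult D (t e e) ** z /\ rmult D z = z ** lmult D (t e e).
Proof.
have lE : lmult D (t e e) = rmult D (t e e).
  by rewrite -[LHS](unitl tU) multP (unitr tU).
split; first by rewrite -[LHS](unitl tU) multP -lE.
by rewrite -[LHS](unitr tU) -multP.
Qed.

(** The element representing [D] lies in every strict neighbourhood of [D], so the strict limit is
    the value of [f] there. *)
Lemma strict_value_unital (f : dual T) (D : mult T) (v : R[i]) :
  strict_value f D v -> f (lmult D (t e e)) = v.
Proof.
move=> Dv; apply: (@nrm_small R R[i]^o) => d d0.
have dC0 : 0 < (d%:C : R[i]) by rewrite ltcR.
have := Dv (ball (v : R[i]^o) d%:C) (nbhsx_ballx _ _ dC0).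
move=> [s [r r0 Hs]]; have := Hs (lmult D (t e e)).
have in_nbhs z : z \in s -> `|lmult D z - lmult D (t e e) ** z| < r%:C /\
    `|rmult D z - z ** lmult D (t e e)| < r%:C.
  by move=> _; have [-> ->] := mult_unital D z; rewrite !subrr normr0 ltcR.
move=> /(_ in_nbhs); rewrite /= -ball_normE /= nrmE ltcR nrmB.
exact: ltW.
Qed.

Definition cop b : T := lmult (Delta H b) (t e e).

Let Dh : mult_star_hom (Delta H) := @Delta_hom R H.

Lemma copE b z : lmult (Delta H b) z = cop b ** z.
Proof. by have [] := mult_unital (Delta H b) z. Qed.

Lemma copE' b z : rmult (Delta H b) z = z ** cop b.
Proof. by have [] := mult_unital (Delta H b) z. Qed.

Lemma cop_linear (k : R[i]) a b : cop (k *: a + b) = k *: cop a + cop b.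
Proof. by rewrite /cop; have [/(_ k a b)[-> _]] := Dh. Qed.

Lemma copB a b : cop (a - b) = cop a - cop b.
Proof. by have := cop_linear (-1) b a; rewrite !scaleN1r ![- _ + _]addrC. Qed.

Lemma copM a b : cop (a ** b) = cop a ** cop b.
Proof. by rewrite /cop; have [_ /(_ a b)[-> _] _] := Dh; rewrite /= copE. Qed.

Lemma cop_star a : cop (star a) = star (cop a).
Proof.
rewrite /cop; have [_ _ /(_ a)[-> _]] := Dh; rewrite /= (star_unit tU).
by rewrite copE' (unitl tU).
Qed.

Context (h : dual B) (hH : haar_state h).

Let h_pos : positive_functional h. Proof. by have [[]] := hH. Qed.

Let h_faithful a : h (star a ** a) = 0 -> a = 0.
Proof. by have [_ hf _ _] := hH; exact: hf. Qed.

Lemma haar_unit : h e = 1 :> R[i].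
Proof. by have [[_ h1] _ _ _] := hH; exact: state_unit eU _ h_pos h1. Qed.

Let l2e : l2 h e = 1.
Proof.
have : (l2 h e ^+ 2)%:C = 1%:C :> R[i] by rewrite -(l2_unit_sqr eU h_pos) haar_unit.
move/complexI/eqP; rewrite sqrf_eq1 => /orP[/eqP//|/eqP l2N1].
by have := l2_ge0 h e; rewrite l2N1; lra.
Qed.

Lemma haar_right_invariant (g : dual B) (Phi : dual T) b :
  (forall a b, Phi (t a b) = g a * h b :> R[i]) -> Phi (cop b) = g e * h b :> R[i].
Proof.
move=> PhiE; have [_ _ hr _] := hH; have [Phi' Phi'E Hs] := hr b e eU g.
rewrite (ten_dual_eq ts (G := Phi')); last by move=> x y; rewrite PhiE Phi'E.
by rewrite /cop (strict_value_unital Hs) dualZ mulrC.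
Qed.

Lemma haar_left_invariant (g : dual B) (Phi : dual T) b :
  (forall a b, Phi (t a b) = h a * g b :> R[i]) -> Phi (cop b) = h b * g e :> R[i].
Proof.
move=> PhiE; have [_ _ _ hl] := hH; have [Phi' Phi'E Hs] := hl b e eU g.
rewrite (ten_dual_eq ts (G := Phi')); last by move=> x y; rewrite PhiE Phi'E.
by rewrite /cop (strict_value_unital Hs) dualZ.
Qed.

Context (Psi : dual T) (PsiE : forall a b, Psi (t a b) = h a * h b :> R[i]).
Hypothesis Psi_pos : positive_functional Psi.

(** Right invariance applied to the functional [h(w . w')] on the first leg. *)
Lemma haar_right_conj w w' b :
  Psi (t w e ** cop b ** t w' e) = h (w ** w') * h b :> R[i].
Proof.
have := @haar_right_invariant (dual_ract (dual_lact w' h) w)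
  (dual_ract (dual_lact (t w' e) Psi) (t w e)) b.
rewrite /= (unitr eU); apply=> x y.
by rewrite /= !(tenM ts) PsiE (unitl eU) (unitr eU).
Qed.

Lemma haar_left_conj w w' b :
  Psi (t e w ** cop b ** t e w') = h (w ** w') * h b :> R[i].
Proof.
have := @haar_left_invariant (dual_ract (dual_lact w' h) w)
  (dual_ract (dual_lact (t e w') Psi) (t e w)) b.
rewrite /= (unitr eU) mulrC; apply=> x y.
by rewrite /= !(tenM ts) PsiE (unitl eU) (unitr eU).
Qed.

Lemma haar_cop b : Psi (cop b) = h b :> R[i].
Proof.
by have := haar_right_conj e e b; rewrite (unitl tU) (unitr tU) (unitl eU) haar_unit mul1r.
Qed.

Lemma l2_cop b : l2 Psi (cop b) = l2 h b.
Proof. by rewrite /l2 -cop_star -copM haar_cop. Qed.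

Context (E : T -> B) (K : R) (E_linear : linear E).
Hypothesis E_bounded : forall z, nrm (E z) <= K * nrm z.
Hypothesis E_ten : forall a b, E (t a b) = h b *: a.

Lemma h_slice z : h (E z) = Psi z.
Proof. exact (slice_dual ts E_linear E_bounded E_ten PsiE z). Qed.

Lemma nrm_slice_cop a c : nrm (E (cop a ** t e c)) <= l2 h (star a) * l2 h c.
Proof.
apply: (faithful_nrm_le eU h_pos h_faithful) => [|y].
  by rewrite mulr_ge0 ?l2_ge0.
set b := E _; set x := b ** y.
have xE : l2 h x ^+ 2 <= (l2 h (star a) * l2 h x) * (l2 h y * l2 h c).
  rewrite -(nrm_real_ge0 (sqr_ge0 (l2 h x))) -l2_sqr// {2}/x cmulA.
  rewrite -(slice_bimodule ts eU E_linear E_bounded E_ten) h_slice cmulA -cmulA.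
  rewrite (tenM ts) (unitl eU) (unitr eU) -[t _ _ ** cop a]starK.
  apply: le_trans (cauchy_schwarz Psi_pos _ _) _.
  rewrite (l2_ten ts _ _ h_pos h_pos PsiE) ler_wpM2r ?mulr_ge0 ?l2_ge0//.
  rewrite le_eqVlt; apply/orP; left.
  rewrite -(@eqrXn2 _ 2) ?mulr_ge0 ?l2_ge0//; apply/eqP/complexI.
  rewrite -l2_sqr// exprMn rmorphM/= -!l2_sqr// !starK starM (ten_star ts) !cmulA.
  rewrite -cop_star -[_ ** cop (star a)]cmulA -copM starK (star_unit eU).
  by rewrite haar_right_conj mulrC /x !cmulA.
have := l2_ge0 h x; rewrite le_eqVlt => /predU1P[<-|x0].
  by rewrite !mulr_ge0 ?l2_ge0.
by rewrite -(ler_pM2r x0) -expr2 (le_trans xE)//; lra.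
Qed.

End CompactQuantumGroup.

(** * Idempotents with an approximate density [c n] for the Haar state *)

Section ContractiveIdempotent.
Context {R : realType} {H : lcqg R} {e : C0 H} (eU : is_unit e).
Notation B := (C0 H).
Notation T := (C02 H).
Notation t := (tens H).
Implicit Types (a b w x y : B) (z : T).

Let ts := @tens_spatial R H.
Let tU : is_unit (t e e) := ten_unit ts eU eU.

Context (h : dual B) (hH : haar_state h).

Let h_pos : positive_functional h. Proof. by have [[]] := hH. Qed.

Let h_faithful a : h (star a ** a) = 0 -> a = 0.
Proof. by have [_ hf _ _] := hH; exact: hf. Qed.

Let h_le a b : cabs (h (a ** b)) <= l2 h (star a) * l2 h b.
Proof. by have := cauchy_schwarz h_pos (star a) b; rewrite starK. Qed.

Let l2_star x : l2 h (star (star x)) = l2 h x. Proof. by rewrite starK. Qed.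

Context (Psi : dual T) (PsiE : forall a b, Psi (t a b) = h a * h b :> R[i]).
Hypothesis Psi_pos : positive_functional Psi.

Let Psi_le (z z' : T) : cabs (Psi (z ** z')) <= l2 Psi (star z) * l2 Psi z'.
Proof. by have := cauchy_schwarz Psi_pos (star z) z'; rewrite starK. Qed.

Let dl (n : nat) : R := n.+1%:R^-1.

Let dl_gt0 n : 0 < dl n. Proof. by rewrite invr_gt0 ltr0n. Qed.

Let dl_le n m : (n <= m)%N -> dl m <= dl n.
Proof. by move=> nm; rewrite lef_pV2 ?posrE ?ltr0n// ler_nat. Qed.

Let dl_le1 n : dl n <= 1.
Proof. by rewrite invf_le1 ?ltr0n// ler1n. Qed.

Let dl_lim (C d : R) : 0 < d -> exists N, C * dl N <= d.
Proof. by move=> d0; have [N HN] := inv_rate C d0; exists N. Qed.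

Context (om : dual B) (c : nat -> B).
Hypothesis om_c : forall n b, cabs (om b - h (b ** c n)) <= dl n * l2 h (star b).
Hypothesis om_star_c : forall n, cabs (1 - (om (star (c n)) : R[i])) <= dl n.

(** Testing [om_c] on [star (c n)] gives [l^2 <= 1 + dl n + dl n * l], hence [l <= 1 + dl n]. *)
Lemma l2_riesz n : l2 h (c n) <= 1 + dl n.
Proof.
have H1 := om_c n (star (c n)); rewrite starK l2_sqr// in H1.
have H2 := om_star_c n; set l := l2 h (c n) in H1 *.
have l0 : 0 <= l by exact: l2_ge0.
have : l ^+ 2 <= 1 + (dl n + dl n * l).
  rewrite -(nrm_real_ge0 (sqr_ge0 l)).
  have N1 : nrm (1 : R[i]^o) = 1 by rewrite -[1]/(1%:C) nrm_real normr1.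
  have T1 := nrm_triangle ((l ^+ 2)%:C : R[i]^o) (om (star (c n))) 0.
  have T2 := nrm_triangle (om (star (c n)) : R[i]^o) 1 0.
  rewrite !subr0 ?N1 nrmB in T1; rewrite !subr0 ?N1 nrmB in T2.
  by move: H1 H2 T1 T2; lra.
by have := dl_gt0 n; nra.
Qed.

Lemma l2_riesz_sub n m : l2 h (c n - c m) <= dl n + dl m.
Proof.
set x := c n - c m.
have : l2 h x ^+ 2 <= (dl n + dl m) * l2 h x.
  rewrite -(nrm_real_ge0 (sqr_ge0 (l2 h x))) -l2_sqr// {2}/x cmulBr dualB.
  have := nrm_triangle (h (star x ** c n) : R[i]^o) (om (star x)) (h (star x ** c m)).
  have := om_c n (star x); have := om_c m (star x); rewrite starK.
  by rewrite (nrmB (om (star x)) (h (star x ** c n))); lra.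
have := l2_ge0 h x; rewrite le_eqVlt => /predU1P[<- _|x0].
  by rewrite addr_ge0// ltW.
by rewrite expr2 ler_pM2r.
Qed.

Lemma om_le b : cabs (om b) <= l2 h (star b).
Proof.
apply/ler_addgt0Pr => d d0; have [N HN] := dl_lim (2 * l2 h (star b)) d0.
have := nrm_triangle (om b : R[i]^o) (h (b ** c N)) 0; rewrite !subr0.
have := om_c N b; have := h_le b (c N); have := l2_riesz N.
have := l2_ge0 h (star b); have := dl_gt0 N; nra.
Qed.

Let tc n := t (c n) (c n).

Lemma l2_tc_sub n m : (n <= m)%N -> l2 Psi (tc m - tc n) <= 8 * dl n.
Proof.
move=> nm; have -> : tc m - tc n = t (c m - c n) (c m) + t (c n) (c m - c n).
  by rewrite /tc !(tenBl ts, tenBr ts) addrA subrK.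
apply: le_trans (l2D Psi_pos _ _) _; rewrite !(l2_ten ts _ _ h_pos h_pos PsiE).
have := l2_riesz_sub m n; have := l2_riesz m; have := l2_riesz n.
have := dl_le nm; have := dl_le1 n; have := dl_le1 m; have := dl_gt0 n; have := dl_gt0 m.
have := l2_ge0 h (c n); have := l2_ge0 h (c m); have := l2_ge0 h (c m - c n).
set p := l2 h (c m - c n); set q := l2 h (c m); set r := l2 h (c n).
move=> p0 q0 r0 m0 n0 m1 n1 mn r1 q1 p1.
have : p * q <= (2 * dl n) * 2 by rewrite ler_pM//; lra.
have : r * p <= 2 * (2 * dl n) by rewrite ler_pM//; lra.
lra.
Qed.

(** Since [om] need not be positive, [om (x) om] is built as the limit of the functionals
    [Psi(. (c_n (x) c_n))], which are Cauchy in the norm of [Psi]. *)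
Lemma tensor_square : exists W : dual T,
  (forall a b, W (t a b) = om a * om b :> R[i]) /\
  forall z n, cabs ((W z : R[i]) - Psi (z ** tc n)) <= 8 * l2 Psi (star z) * dl n.
Proof.
have ex z : exists v : R[i], forall n,
    cabs (v - Psi (z ** tc n)) <= 8 * l2 Psi (star z) * dl n.
  apply: (@complex_rate_complete R (fun n => Psi (z ** tc n))
    (fun n => 8 * l2 Psi (star z) * dl n)) => [n m nm|d d0]; last exact: dl_lim.
  have -> : Psi (z ** tc m) - Psi (z ** tc n) = Psi (z ** (tc m - tc n)).
    by rewrite cmulBr dualB.
  apply: le_trans (Psi_le _ _) _; have := l2_tc_sub nm.
  by have := l2_ge0 Psi (star z); nra.
have [W HW] : {W : T -> R[i] & forall z n,
    cabs (W z - Psi (z ** tc n)) <= 8 * l2 Psi (star z) * dl n}.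
  exact: (choice (P := fun z v => forall n,
    cabs (v - Psi (z ** tc n)) <= 8 * l2 Psi (star z) * dl n)) ex.
have dl_lim1 (d : R) : 0 < d -> exists N, dl N <= d.
  by move=> d0; have [N HN] := dl_lim 1 d0; exists N; rewrite mul1r in HN.
have Wl : linear (W : T -> R[i]^o).
  move=> k z z'.
  apply: (nrm_small_rate dl_lim1 (K := 8 * (l2 Psi (star (k *: z + z')) +
    cabs k * l2 Psi (star z) + l2 Psi (star z')))) => [|n].
    by rewrite mulr_ge0// !addr_ge0 ?mulr_ge0 ?l2_ge0 ?nrm_ge0.
  have -> : W (k *: z + z') - (k *: (W z : R[i]^o) + W z') =
      (W (k *: z + z') - Psi ((k *: z + z') ** tc n)) -
      (k *: (W z - Psi (z ** tc n) : R[i]^o) + (W z' - Psi (z' ** tc n))).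
    rewrite cmulPl dualD dualZ /GRing.scale /=; ring.
  apply: le_trans (nrmD _ _) _; rewrite nrmN.
  have := nrmD (k *: (W z - Psi (z ** tc n) : R[i]^o)) (W z' - Psi (z' ** tc n)).
  rewrite nrmZ; have := HW (k *: z + z') n; have := HW z n; have := HW z' n.
  have := nrm_ge0 (k : R[i]^o); move=> k0 H1 H2 H3 H4.
  have := ler_wpM2l k0 H2; lra.
have WM : exists M : R, forall z, `|(W z : R[i]^o)| <= M%:C * `|z|.
  exists (dual_norm Psi * nrm (tc 0) + 8 * l2 Psi (t e e)) => z.
  rewrite !nrmE -rmorphM lecR.
  have := HW z 0%N; have := dual_nrm Psi (z ** tc 0).
  have := nrmM z (tc 0); have := l2_le_nrm tU Psi_pos (star z); rewrite nrm_star.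
  have := nrm_triangle (W z : R[i]^o) (Psi (z ** tc 0)) 0; rewrite !subr0.
  have -> : dl 0 = 1 by rewrite /dl invr1.
  have := dual_norm_ge0 Psi; set N := dual_norm Psi; move=> N0 H1 H2 H3 H4 H5.
  have := ler_wpM2l N0 H3; lra.
exists (dual_of W Wl WM); split=> [a b|z n]; last exact: HW.
apply: (@nrm_small_rate R R[i]^o _ _ (8 * l2 Psi (star (t a b)) +
    2 * l2 h (star a) * l2 h (star b) + l2 h (star a) * l2 h (star b)) dl dl_lim1) => [|n].
  by rewrite !addr_ge0 ?mulr_ge0 ?l2_ge0.
have -> : (W (t a b) - (om a : R[i]) * om b : R[i]^o) =
    (W (t a b) - Psi (t a b ** tc n)) +
    (- (((om a : R[i]) - h (a ** c n)) * h (b ** c n))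
     - (om a : R[i]) * ((om b : R[i]) - h (b ** c n))).
  by rewrite /tc (tenM ts) PsiE; ring.
apply: le_trans (nrmD _ _) _.
have := nrmD (- (((om a : R[i]) - h (a ** c n)) * h (b ** c n)) : R[i]^o)
   (- ((om a : R[i]) * ((om b : R[i]) - h (b ** c n)))).
rewrite !nrmN !nrmcM.
have := HW (t a b) n; have := om_c n a; have := om_c n b; have := om_le a.
have := h_le b (c n); have := l2_riesz n; have := dl_le1 n; have := dl_gt0 n.
have := l2_ge0 h (star a); have := l2_ge0 h (star b); have := l2_ge0 h (c n).
have := nrm_ge0 (h (b ** c n) : R[i]^o); have := nrm_ge0 (om a : R[i]^o).
have := nrm_ge0 (om a - h (a ** c n) : R[i]^o).
have := nrm_ge0 (om b - h (b ** c n) : R[i]^o).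
set p1 := nrm (om b - _ : R[i]^o); set p2 := nrm (om a - _ : R[i]^o).
set p3 := nrm (om a : R[i]^o); set p4 := nrm (h _ : R[i]^o).
set la := l2 h (star a); set lb := l2 h (star b); set lc := l2 h (c n).
move=> p10 p20 p30 p40 c0 b0 a0 d0 d1 lc1 hp4 hp3 hp1 hp2 hW hD.
have : p4 <= lb * 2 by apply: le_trans hp4 _; rewrite ler_wpM2l//; lra.
move=> hp4'; have := ler_pM p20 p40 hp2 hp4'; have := ler_pM p30 p10 hp3 hp1.
lra.
Qed.

Notation cp := (@cop R H e).

Hypothesis om_conv : forall W : dual T,
  (forall a b, W (t a b) = om a * om b :> R[i]) -> forall b, W (cp b) = om b.

(* The limit of the slices [(id (x) h)(Delta(c_n^* )(1 (x) c_n))]; it converges in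
   norm because [|| (id (x) h)(Delta(a)(1 (x) c)) ||^2 <= h(a a^* ) h(c^* c)]. *)
Lemma exists_fixed_coisometry : exists x, nrm x <= 1 /\ om x = 1 :> R[i].
Proof.
have [E [K [El EK Et]]] := slice_map ts eU eU h_pos h_faithful h_pos.
pose y n := star (c n); pose x n := E (cp (y n) ** t e (c n)).
have EB z z' : E (z - z') = E z - E z'.
  by have := El (-1) z' z; rewrite !scaleN1r ![- _ + _]addrC.
have bound a b : nrm (E (cp a ** t e b)) <= l2 h (star a) * l2 h b.
  exact: nrm_slice_cop eU _ hH _ PsiE Psi_pos _ _ El EK Et a b.
have xB n m : (n <= m)%N -> nrm (x m - x n) <= 8 * dl n.
  move=> nm; have -> : x m - x n = E (cp (y m - y n) ** t e (c m)) +
      E (cp (y n) ** t e (c m - c n)).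
    rewrite copB (tenBr ts) cmulBl cmulBr !EB addrA subrK.
    by [].
  apply: le_trans (nrmD _ _) _.
  have := bound (y m - y n) (c m); have := bound (y n) (c m - c n).
  rewrite /y starB !starK.
  have := l2_riesz_sub m n; have := l2_riesz m; have := l2_riesz n.
  have := dl_le nm; have := dl_le1 n; have := dl_le1 m; have := dl_gt0 n; have := dl_gt0 m.
  have := l2_ge0 h (c n); have := l2_ge0 h (c m); have := l2_ge0 h (c m - c n).
  set p := l2 h (c m - c n); set q := l2 h (c m); set r := l2 h (c n).
  move=> p0 q0 r0 m0 n0 m1 n1 mn r1 q1 p1 B1 B2.
  have : p * q <= (2 * dl n) * 2 by rewrite ler_pM//; lra.
  have : r * p <= 2 * (2 * dl n) by rewrite ler_pM//; lra.
  lra.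
have [x' Hx'] : exists x', forall n, nrm (x' - x n) <= 8 * dl n.
  by apply: cauchy_rate xB _ => d d0; exact: dl_lim.
have x_n n : nrm (x n) <= (1 + dl n) * (1 + dl n).
  apply: le_trans (bound _ _) _; rewrite l2_star.
  by rewrite ler_pM ?l2_ge0 ?l2_riesz.
have dl_lim1 (d : R) : 0 < d -> exists N, dl N <= d.
  by move=> d0; have [N HN] := dl_lim 1 d0; exists N; rewrite mul1r in HN.
exists x'; split.
  apply/ler_addgt0Pr => d d0; have [N HN] := dl_lim 11 d0.
  have := nrm_triangle x' (x N) 0; rewrite !subr0.
  by have := Hx' N; have := x_n N; have := dl_le1 N; have := dl_gt0 N; nra.
have [W [Wt HW]] := tensor_square.
(* Four errors, in units of [dl n]: [8 * dual_norm om] for [x'] against [x n], 4 and 16 for the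
   comparisons with [Psi], and 1 for [om (y n)] against 1. *)
apply: (@nrm_small_rate R R[i]^o _ _ (21 + 8 * dual_norm om) dl dl_lim1) => [|n].
  by rewrite addr_ge0 ?mulr_ge0 ?dual_norm_ge0.
(* The left side approximates [om (x n)], the right side [(om (x) om)(Delta(y n))], which
   idempotency identifies with [om (y n)], a value near 1. *)
have E1 : h (x n ** c n) = Psi (cp (y n) ** tc n) :> R[i].
  have := slice_bimodule ts eU El EK Et e (c n) (cp (y n) ** t e (c n)).
  rewrite (unitl eU) (unitl tU) => <-.
  rewrite (slice_dual ts El EK Et PsiE) -cmulA (tenM ts) (unitl eU) (unitr eU).
  by [].
have H1 := om_star_c n; have H2 := HW (cp (y n)) n.
have H3 := om_c n (x n); have H4 := dual_nrm om (x' - x n); rewrite dualB in H4.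
have H5 : l2 h (star (x n)) <= 4.
  apply: le_trans (l2_le_nrm eU h_pos _) _; rewrite nrm_star.
  have := l2_ge0 h e; have l2e : l2 h e <= 1.
    rewrite -(@ler_pXn2r _ 2) ?nnegrE ?l2_ge0// -lecR -(l2_unit_sqr eU h_pos).
    by rewrite (haar_unit eU hH) expr1n.
  by have := x_n n; have := nrm_ge0 (x n); have := dl_le1 n; have := dl_gt0 n; nra.
have H6 : l2 Psi (star (cp (y n))) <= 2.
  rewrite -(cop_star eU) (l2_cop eU hH PsiE) l2_star.
  by have := l2_riesz n; have := dl_le1 n; lra.
rewrite (om_conv Wt) in H2; rewrite E1 in H3.
have -> : (om x' - 1 : R[i]^o) = (om x' - om (x n)) + (om (x n) - Psi (cp (y n) ** tc n))
   - (om (y n) - Psi (cp (y n) ** tc n)) - (1 - om (y n)).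
  by ring.
set A1 : R[i]^o := om x' - om (x n); set A2 : R[i]^o := om (x n) - _.
set A3 : R[i]^o := om (y n) - _; set A4 : R[i]^o := 1 - _.
have D1 := nrmD (A1 + A2 - A3) (- A4); have D2 := nrmD (A1 + A2) (- A3).
have D3 := nrmD A1 A2; rewrite !nrmN in D1 D2.
have G1 : nrm A1 <= dual_norm om * (8 * dl n).
  by apply: le_trans H4 _; rewrite ler_wpM2l ?dual_norm_ge0.
have G2 : nrm A2 <= dl n * 4.
  by apply: le_trans H3 _; rewrite ler_wpM2l// ltW.
have G3 : nrm A3 <= 8 * 2 * dl n.
  by apply: le_trans H2 _; have := dl_gt0 n; have := H6; nra.
have G4 : nrm A4 <= dl n by exact: H1.
apply: le_trans D1 _; lra.
Qed.

Lemma exists_group_like_density : exists u,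
  [/\ unitary u, group_like u & forall b, om b = h (b ** u) :> R[i]].
Proof.
have [x [x1 omx]] := exists_fixed_coisometry.
have he : h e = 1 :> R[i] := haar_unit eU hH.
have l2e : l2 h e = 1.
  have : (l2 h e ^+ 2)%:C = 1%:C :> R[i] by rewrite -(l2_unit_sqr eU h_pos).
  move/complexI/eqP; rewrite sqrf_eq1 => /orP[/eqP//|/eqP l2N1].
  by have := l2_ge0 h e; rewrite l2N1; lra.
have l2x : l2 h (star x) = 1.
  apply/eqP; rewrite eq_le; apply/andP; split.
    by apply: le_trans (l2_le_nrm eU h_pos _) _; rewrite l2e mulr1 nrm_star.
  by have := om_le x; rewrite omx -[1]/(1%:C) nrm_real normr1.
have hxx : h (x ** star x) = 1 :> R[i].
  by rewrite -[X in X ** _]starK l2_sqr// l2x expr1n.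
have xx : x ** star x = e.
  have [||r [rsa _ rE _]] := @exists_one_sub_sqrt _ _ (x ** star x).
  - by rewrite /self_adjoint starM starK.
  - by rewrite nrm_cstar'; have := nrm_ge0 x; nra.
  suff er : e - r = 0.
    move/eqP: er; rewrite subr_eq0 => /eqP er.
    by rewrite -rE -er (unitl eU) mulr2n addrK.
  apply: h_faithful; rewrite starB rsa (star_unit eU).
  have -> : (e - r) ** (e - r) = e - x ** star x.
    by rewrite -rE; cexpand; rewrite !(unitl eU) !(unitr eU); lmod_over R[i]; by ring.
  by rewrite dualB he hxx subrr.
have om_x b : om b = h (b ** star x) :> R[i].
  have [|||_] := @psd_quadratic_scalar R 0 (h (x ** star b) - (om b : R[i])^* )
    (h (b ** star x) - om b) (h (b ** star b) - om b * (om b : R[i])^* ).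
  - exact: lexx.
  - rewrite -[X in h (X ** _)]starK l2_sqr// -nrm_sqr -rmorphB lecR subr_ge0.
    by rewrite ler_pXn2r ?nnegrE ?nrm_ge0 ?l2_ge0// om_le.
  - move=> k; have H1 := om_le (x + k^* *: b).
    have : 0 <= h (star (star (x + k^* *: b)) ** star (x + k^* *: b)) -
        (om (x + k^* *: b) : R[i]) * (om (x + k^* *: b) : R[i])^*.
      rewrite l2_sqr// -nrm_sqr -rmorphB lecR subr_ge0.
      by rewrite ler_pXn2r ?nnegrE ?nrm_ge0 ?l2_ge0.
    rewrite starK; cexpand; rewrite conjCK !dualD !dualZ hxx omx.
    rewrite rmorphD rmorphM rmorph1/= conjCK => H2; apply: le_trans H2 _.
    by rewrite le_eqVlt; apply/orP; left; apply/eqP; ring.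
  rewrite mul0r => H1.
  have xb : h (x ** star b) - (om b : R[i])^* = 0.
    apply: (@nrm_eq0 R R[i]^o); apply/eqP; rewrite -sqrf_eq0 eq_le H1.
    exact: sqr_ge0.
  have := pos_conj h_pos (star x) (star b); rewrite !starK => ->.
  by move/eqP: xb; rewrite subr_eq0 => /eqP ->; rewrite conjCK.
have xxx : x ** (star x ** x) = x by rewrite cmulA xx (unitl eU).
have copxx : cp x ** cp (star x) = cp e by rewrite -(copM eU) xx.
have gl : cp x = t x x.
  apply/eqP; rewrite -subr_eq0; apply/eqP; set Y := _ - _.
  apply: (tensor_separation ts eU eU h_pos h_pos h_faithful h_faithful PsiE) => Z.
  have W : Psi (cp x ** t (star x) (star x)) = 1 :> R[i].
    have := @om_conv (dual_lact (t (star x) (star x)) Psi) _ x.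
    rewrite /= omx; apply=> a b.
    by rewrite (tenM ts) PsiE !om_x.
  have YY : l2 Psi (star Y) = 0.
    suff : Psi (star (star Y) ** star Y) = 0 :> R[i].
      by rewrite /l2 => ->; rewrite sqrtr0.
    rewrite starK /Y starB (ten_star ts) -(cop_star eU) cmulBl !cmulBr !dualB.
    rewrite copxx (haar_cop eU hH PsiE) he W (tenM ts) PsiE hxx.
    have := pos_conj Psi_pos (star (cp x)) (t (star x) (star x)).
    rewrite starK W (ten_star ts) starK -(cop_star eU) => ->.
    by rewrite rmorph1; ring.
  apply: (@nrm_eq0 R R[i]^o); apply/eqP; rewrite eq_le nrm_ge0 andbT.
  by have := Psi_le Y Z; rewrite YY mul0r.
pose p := star x ** x.
have hp : h p = h p * h p :> R[i].
  rewrite -[LHS](haar_cop eU hH PsiE) /p (copM eU) (cop_star eU) gl (ten_star ts).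
  by rewrite (tenM ts) PsiE.
have pe : p = e.
  have hp1 : h p = 1 :> R[i].
    (* If [h p = 0], faithfulness gives [x = 0], against [x ** star x = e]. *)
    have [hp0|hp0] := eqVneq (h p : R[i]) 0.
      have x0 : x = 0 by apply: h_faithful.
      by move: he; rewrite -xx x0 cmul0l dual0 => /eqP; rewrite eq_sym oner_eq0.
    by apply: (mulfI hp0); rewrite mulr1 -hp.
  have ep : e - p = 0.
    apply: h_faithful; rewrite starB (star_unit eU) /p starM starK.
    have -> : (e - star x ** x) ** (e - star x ** x) = e - star x ** x.
      cexpand; rewrite !(unitl eU) !(unitr eU) -!cmulA xxx.
      by lmod_over R[i]; by ring.
    by rewrite dualB he -/p hp1 subrr.
  by move/eqP: ep; rewrite subr_eq0 => /eqP.
exists (star x); split=> //.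
  by split; rewrite starK ?xx// -/p pe.
split=> z /=; first by rewrite (copE eU) (cop_star eU) gl (ten_star ts).
by rewrite (copE' eU) (cop_star eU) gl (ten_star ts).
Qed.

Lemma haar_group_like_conj u : unitary u -> group_like u ->
  forall b, h (star u ** b ** u) = h b :> R[i].
Proof.
move=> [uu1 uu2] [ul _] b.
have uuE v : is_unit v -> v = e by move=> vU; rewrite -[LHS](unitl eU) (unitr vU).
have E1 := uuE _ uu1; have E2 := uuE _ uu2.
have copu : cp u = t u u by rewrite /cop ul /= (unitr tU).
have := haar_left_conj eU hH PsiE (star u) u b; rewrite E1 (haar_unit eU hH) mul1r => <-.
have := haar_right_conj eU hH PsiE u (star u) (star u ** b ** u).
rewrite E2 (haar_unit eU hH) mul1r => <-; congr (Psi _ : R[i]).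
rewrite !(copM eU) (cop_star eU) copu (ten_star ts) !cmulA (tenM ts) E2 (unitl eU).
by rewrite -!cmulA (tenM ts) (unitr eU) E2.
Qed.

End ContractiveIdempotent.

(** * Contractive idempotents *)

Section Bidual.
Context {R : realType} {A : cstarAlgType R}.

Lemma dual_starE (f : dual A) a : dual_star f a = (f (star a) : R[i])^*.
Proof. by []. Qed.

(** Linearity with coefficient [k = 0] removes the dependence on the continuity proofs carried by
    [f] and [g]. *)
Lemma bidual_ext (x : bidual A) (f g : dual A) : f =1 g -> x f = x g.
Proof.
move=> fg; rewrite (@bidual_linear _ _ x 0 g g f) ?mul0r ?add0r// => a.
by rewrite mul0r add0r fg.
Qed.

Lemma bidual_sub_bound (x : bidual A) (M : R) (f g : dual A) (d : R) :
  (forall f, `|x f| <= (M * dual_norm f)%:C) -> 0 <= M -> 0 <= d ->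
  (forall a, cabs ((f a : R[i]) - g a) <= d * nrm a) -> cabs (x f - x g) <= M * d.
Proof.
move=> xM M0 d0 fg.
have dl : linear (fun a => (f a : R[i]) - g a : R[i]^o).
  by move=> k a b; rewrite !linearP /GRing.scale /=; ring.
have dM : exists M : R, forall a, `|(f a : R[i]) - g a : R[i]^o| <= M%:C * `|a|.
  by exists d => a; rewrite !nrmE -rmorphM lecR.
rewrite (@bidual_linear _ _ x 1 g (dual_of _ dl dM) f); last first.
  by move=> a /=; rewrite mul1r addrC subrK.
rewrite mul1r addrC addKr -lecR -nrmE; apply: le_trans (xM _) _.
rewrite lecR ler_wpM2l//; apply: dual_norm_le => // a /=.
by rewrite !nrmE -rmorphM lecR.
Qed.

End Bidual.

(** Riesz representation without completing the space: [Q c] is the squared distance from [c] to the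
    representing vector, up to a constant. If [c] minimises [Q] up to [d^2], perturbing by
    [k *: star b] gives a nonnegative quadratic in [k], whose discriminant is the claim. *)
Lemma riesz_approximation (R : realType) (B : cstarAlgType R) (h om : dual B) (M : R) :
  positive_functional h -> (forall b, cabs (om b) <= M * l2 h (star b)) ->
  forall d : R, 0 < d ->
  exists c, forall b, cabs ((om b : R[i]) - h (b ** c)) <= d * l2 h (star b).
Proof.
move=> hp omM d d0.
pose Q c := l2 h c ^+ 2 - 2 * complex.Re (om (star c) : R[i]).
have QC c : (Q c)%:C = (h (star c ** c) : R[i]) - (om (star c) : R[i]) - (om (star c) : R[i])^*.
  rewrite l2_sqr// /Q; case: (om (star c) : R[i]) => x y.
  by apply/eqP; rewrite eq_complex /=; apply/andP; split; apply/eqP; ring.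
have Q_ge c : - Q c <= M ^+ 2.
  have := omM (star c); rewrite starK.
  have := Re_le_nrm (om (star c) : R[i]); rewrite /Q => H1 H2.
  by have := sqr_ge0 (l2 h c - M); nra.
move: Q QC Q_ge => Q QC Q_ge; pose S := [set - Q c | c in [set: B]].
have supS : has_sup S.
  by split; [exists (- Q 0), 0|exists (M ^+ 2) => _ [c _ <-]].
have d20 : 0 < d ^+ 2 by rewrite exprn_gt0.
have [_ [c _ <-] Hc] := sup_adherent d20 supS.
have Qmin c' : Q c - d ^+ 2 <= Q c'.
  have : - Q c' <= sup S by apply: ub_le_sup; [have [] := supS|exists c'].
  lra.
exists c => b.
have [|||_] := @psd_quadratic_scalar R (d ^+ 2)%:C
  (h (star c ** star b) - (om b : R[i])^* ) (h (b ** c) - om b) (h (b ** star b)).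
- by rewrite lecR ltW.
- by have := hp (star b); rewrite starK.
- move=> k; have := Qmin (c + k *: star b); rewrite -subr_ge0 -lecR !rmorphB/= !QC.
  cexpand; rewrite !dualD !dualZ => H1; apply: le_trans H1 _.
  rewrite rmorphD rmorphM/= conjCK le_eqVlt; apply/orP; left; apply/eqP.
  by rewrite /=; ring.
have -> : h (b ** star b) = (l2 h (star b) ^+ 2)%:C :> R[i].
  by rewrite -l2_sqr// starK.
rewrite /= -exprMn.
rewrite ler_pXn2r ?nnegrE ?mulr_ge0 ?l2_ge0 ?nrm_ge0 ?(ltW d0)//.
apply: le_trans; rewrite -nrmcJ rmorphB nrmB /=.
have := pos_conj hp (star b) c; rewrite starK => ->.
exact: lexx.
Qed.

Theorem theorem2p5 (R : realType) (G : lcqg R) (hG : coamenable G)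
    (omega : dual (C0 G)) (homega : idempotent_functional omega)
    (hcontr : dual_norm omega <= 1)
    (w : bidual (C0 G)) (absr : dual (C0 G))
    (hpolar : polar_decomposition omega w absr)
    (H : lcqg R) (hH : coamenable H) (pi : C0 G -> C0 H) (h : dual (C0 H))
    (hhaar : haar_idempotent pi h absr) :
  (exists u : C0 H,
    [/\ unitary u, group_like u & forall a : C0 G, omega a = h (pi a ** u)]) /\
  (forall a : C0 G, absr a = left_absolute_value w absr a).
Proof.
have [_ _ [[e eU] pi_hom pi_surj [P [P_hom Pt Pcop]]] h_haar absrE] := hhaar.
have [_ _ [_ supp _] omegaE] := hpolar.
have [_ omega_conv] := homega.
have [pi_lin piM pi_star] := pi_hom.
have [[h_pos _] h_faithful _ _] := h_haar.
have l2e : l2 h e <= 1.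
  rewrite -(@ler_pXn2r _ 2) ?nnegrE ?l2_ge0// -lecR -(l2_unit_sqr eU h_pos).
  by rewrite (haar_unit eU h_haar) expr1n.
have l2_nrm b : l2 h b <= nrm b.
  apply: le_trans (l2_le_nrm eU h_pos _) _.
  by have := nrm_ge0 b; have := l2_ge0 h e; nra.
have pi_nrm a : nrm (pi a) <= nrm a by exact: star_hom_contractive.
have [M M0 wM] := bidual_boundP w.
(* [omega a] is [w] applied to [absr(a .)], a functional of norm at most [l2 h (star (pi a))] by
   Cauchy-Schwarz. In particular [omega] kills the kernel of [pi]. *)
have omega_le a : cabs (omega a) <= M * l2 h (star (pi a)).
  rewrite -lecR -nrmE omegaE; apply: le_trans (wM _) _; rewrite lecR ler_wpM2l//.
  apply: dual_norm_le => [|b /=]; first exact: l2_ge0.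
  rewrite !nrmE -rmorphM lecR absrE piM -[pi a]starK.
  apply: le_trans (cauchy_schwarz h_pos _ _) _; rewrite starK ler_wpM2l ?l2_ge0//.
  exact: le_trans (l2_nrm _) (pi_nrm _).
have [s sK] : {s : C0 H -> C0 G & forall b, pi (s b) = b}.
  exact: (choice (P := fun b a => pi a = b)) pi_surj.
have omega_pi a a' : pi a = pi a' -> omega a = omega a'.
  move=> aa'; have pi0 : pi (a - a') = 0.
    by have := pi_lin (-1) a' a; rewrite !scaleN1r ![- _ + _]addrC aa' subrr.
  apply/eqP; rewrite -subr_eq0 -linearB/=; apply/eqP; apply: (@nrm_eq0 R R[i]^o).
  apply/eqP; rewrite eq_le nrm_ge0 andbT; have := omega_le (a - a').
  have := l2_nrm (star (pi (a - a'))); rewrite pi0 star0 nrm0.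
  by have := l2_ge0 h (0 : C0 H); nra.
have om_lin : linear (fun b => omega (s b) : R[i]^o).
  move=> k b b'; rewrite -linearP; apply: omega_pi.
  by rewrite pi_lin !sK.
have om_bnd : exists M : R, forall b, `|omega (s b)| <= M%:C * `|b|.
  exists M => b; rewrite !nrmE -rmorphM lecR; apply: le_trans (omega_le _) _.
  rewrite sK ler_wpM2l//; apply: le_trans (l2_nrm _) _.
  by rewrite nrm_star.
pose om : dual (C0 H) := dual_of _ om_lin om_bnd.
have om_pi a : om (pi a) = omega a by apply: omega_pi; rewrite sK.
have om_le b : cabs (om b) <= M * l2 h (star b) by have := omega_le (s b); rewrite sK.
(* The conjugate of [w (dual_star omega)] is [|omega|_r(w^* w)]. A preimage [a0] of the unit
   satisfies [a0.absr = absr], so the support condition evaluated at [a0] gives 1. *)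
have w_star : w (dual_star omega) = 1.
  have [a0 pia0] := pi_surj e.
  have lact_a0 : dual_lact a0 absr =1 absr.
    by move=> b /=; rewrite !absrE piM pia0 (unitr eU).
  have : bidual_mul (bidual_star w) w absr = 1.
    rewrite -(bidual_ext (bidual_mul (bidual_star w) w) lact_a0).
    by rewrite -(haar_unit eU h_haar) -pia0 -absrE; exact: supp.
  have -> : bidual_mul (bidual_star w) w absr = (w (dual_star omega))^*.
    rewrite [LHS](_ : _ = (w (dual_star (bidual_lact w absr)))^* )//.
    by congr (_^* ); apply: bidual_ext => b; rewrite !dual_starE omegaE.
  by move=> /(congr1 (fun z : R[i] => z^* )); rewrite rmorph1 conjCK.
have om_riesz d : 0 < d -> exists c, (forall b, cabs ((om b : R[i]) - h (b ** c)) <=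
    d * l2 h (star b)) /\ cabs (1 - (om (star c) : R[i])) <= d.
  move=> d0; pose d' := d / (M + 1).
  have M10 : 0 < M + 1 by rewrite ltr_wpDl.
  have d'0 : 0 < d' by rewrite divr_gt0.
  have d'E : d' * (M + 1) = d by rewrite divfK ?gt_eqF.
  have [c Hc] := riesz_approximation h_pos om_le d'0.
  exists c; split=> [b|].
    by apply: le_trans (Hc b) _; rewrite ler_wpM2r ?l2_ge0//; nra.
  have [al pial] := pi_surj (star c).
  (* The functional [absr(al .)] is close in norm to [dual_star omega], on which [w] takes the value
     1; the factor [M + 1] in [d'] absorbs the bound of [w]. *)
  have -> : om (star c) = w (dual_ract absr al).
    by rewrite -pial om_pi omegaE.
  rewrite -w_star; apply: le_trans (bidual_sub_bound wM M0 (ltW d'0) _) _; last by nra.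
  move=> a; rewrite dual_starE /= absrE piM pial -om_pi pi_star.
  have := Hc (star (pi a)); rewrite starK -nrmcJ rmorphB/=.
  rewrite -(pos_conj h_pos (pi a) c) => H1; apply: le_trans H1 _.
  by rewrite ler_wpM2l ?(ltW d'0)//; exact: le_trans (l2_nrm _) (pi_nrm _).
have [c cP] : {c : nat -> C0 H & forall n,
    (forall b, cabs ((om b : R[i]) - h (b ** c n)) <= n.+1%:R^-1 * l2 h (star b)) /\
    cabs (1 - (om (star (c n)) : R[i])) <= n.+1%:R^-1}.
  apply: (choice (P := fun n c =>
    (forall b, cabs ((om b : R[i]) - h (b ** c)) <= n.+1%:R^-1 * l2 h (star b)) /\
    cabs (1 - (om (star c) : R[i])) <= n.+1%:R^-1)) => n.
  by apply: om_riesz; rewrite invr_gt0 ltr0n.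
have tsG := @tens_spatial R G; have tsH := @tens_spatial R H.
have tU := ten_unit tsH eU eU.
have om_conv (W : dual (C02 H)) : (forall a b, W (tens H a b) = om a * om b :> R[i]) ->
    forall b, W (@cop R H e b) = om b.
  move=> WE b; have [a <-] := pi_surj b; rewrite om_pi.
  have [phi phiE phi_strict] := omega_conv a.
  have P_nrm z : nrm (P z) <= nrm z by exact: star_hom_contractive.
  have [P_lin _ _] := P_hom.
  have WP z : W (P z) = phi z.
    move: z; apply: (@ten_linear_eq _ _ _ _ _ tsG R[i]^o (fun z => W (P z)) phi
      (dual_norm W) (dual_norm phi)).
    - by move=> k x y; rewrite P_lin linearP.
    - by move=> z; apply: le_trans (dual_nrm _ _) _; rewrite ler_wpM2l ?dual_norm_ge0.
    - exact: linearP.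
    - exact: dual_nrm.
    - by move=> x y; rewrite Pt WE phiE !om_pi.
  have [a0 pia0] := pi_surj e.
  have P00 : P (tens G a0 a0) = tens H e e by rewrite Pt pia0.
  have copP : P (lmult (Delta G a) (tens G a0 a0)) = @cop R H e (pi a).
    have [/(_ (tens H e e)) /= H1 _] := Pcop a (tens G a0 a0).
    by rewrite P00 (unitl tU) (unitr tU) in H1; rewrite -H1.
  apply: (@nrm_small R R[i]^o) => d d0.
  pose N := dual_norm W + 1; have N0 : 0 < N by rewrite ltr_wpDl ?dual_norm_ge0.
  have d2C : 0 < ((d / 2)%:C : R[i]) by rewrite ltcR divr_gt0.
  have [t [r r0 tr]] := phi_strict (ball (omega a : R[i]^o) (d / 2)%:C) (nbhsx_ballx _ _ d2C).
  have DG : mult_star_hom (Delta G) := @Delta_hom R G.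
  (* One [z] serves both sides: it lies in the strict neighbourhood where [phi z] is near [omega a],
     and, since [P] sends [a0 (x) a0] to the unit, [P z] is near [Delta(pi a)] in norm. *)
  have [|z Hz] := strict_approximation (C := nrm a)
    (fun z => (mult_star_hom_contractive a z DG).2)
    (tens G a0 a0 :: t) (d := Num.min r (d / 2 / N)).
    by rewrite lt_min r0 !divr_gt0.
  have Hz1 : nrm (phi z - omega a : R[i]^o) < d / 2.
    have := tr z; rewrite /= -ball_normE /= nrmE ltcR nrmB; apply.
    move=> b' b't; have [|H1 H2] := Hz b'; first by rewrite inE b't orbT.
    by move: H1 H2; rewrite !lt_min !nrmE !ltcR => /andP[-> _] /andP[-> _].
  have [] := Hz (tens G a0 a0); first by rewrite inE eqxx.
  rewrite lt_min => /andP[_ Hz2] _.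
  have [_ PM _] := P_hom.
  have PB x y : P (x - y) = P x - P y.
    by have := P_lin (-1) y x; rewrite !scaleN1r ![- _ + _]addrC.
  have Hz3 : nrm (@cop R H e (pi a) - P z) <= d / 2 / N.
    have := P_nrm (lmult (Delta G a) (tens G a0 a0) - z ** tens G a0 a0).
    rewrite PB PM P00 copP (unitr tU) => H1; apply: le_trans H1 (ltW Hz2).
  have := nrm_triangle (W (@cop R H e (pi a)) : R[i]^o) (W (P z)) (omega a).
  have := dual_nrm W (@cop R H e (pi a) - P z); rewrite dualB WP.
  have H4 : N * nrm (@cop R H e (pi a) - P z) <= d / 2.
    by rewrite mulrC -ler_pdivlMr.
  have := nrm_ge0 (@cop R H e (pi a) - P z); move: H4; rewrite /N; lra.
have [Psi [PsiE Psi_pos]] := product_functional tsH eU eU h_pos h_pos.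
have [u [u_unit u_gl uE]] := exists_group_like_density eU h_haar PsiE Psi_pos
  (fun n => (cP n).1) (fun n => (cP n).2) om_conv.
have omegaU a : omega a = h (pi a ** u) by rewrite -om_pi uE.
split; first by exists u.
(* With this [be], the adjoint of [a.omega] is [absr(be .)]. So the left absolute value at [a] is
   the conjugate of [omega be = h(u^* pi(a)^* u)], that is [h(u^* pi(a) u)]. *)
move=> a; have [be pibe] := pi_surj (star u ** star (pi a)).
have -> : left_absolute_value w absr a =
    (w (dual_star (dual_lact a (bidual_lact w absr))))^* by [].
have -> : w (dual_star (dual_lact a (bidual_lact w absr))) = w (dual_ract absr be).
  apply: bidual_ext => b; rewrite dual_starE.
  have -> : dual_lact a (bidual_lact w absr) (star b) = omega (star b ** a).
    by rewrite omegaE.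
  rewrite /= absrE [pi (be ** b)]piM pibe omegaU.
  by rewrite piM pi_star -!cmulA -(pos_conj h_pos (pi b) (pi a ** u)) starM -cmulA.
have -> : w (dual_ract absr be) = omega be by rewrite omegaE.
rewrite omegaU pibe absrE -(haar_group_like_conj eU h_haar PsiE u_unit u_gl).
by rewrite -(pos_star eU h_pos) !starM !starK cmulA.
Qed.
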